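(* Let $\mathbb F=\mathrm{Frac}(R)$ and $\mathcal S^+_{\mathrm{loc}}=\mathcal S^+\otimes_R\mathbb F$. Under Assumptions Ъ and Ь (stated in the context), $\mathcal S^+_{\mathrm{loc}}$ is generated as an $\mathbb F$-algebra (under the shuffle product) by the elements $$e_{i,k}=z_{i1}^k,\qquad i\in I,\ k\ge0,$$ where $z_{i1}^k$ is regarded as a polynomial in a single variable of color $i$ (also for $k=0$).
   Context: **Setting.** $Q$ is a quiver with finite vertex set $I$ and finite arrow set $\Omega$; $\Omega_{\text{loop}}\subset\Omega$ is the set of loops; $\mathbb N\ni0$. $T\cong(\mathbb C^* )^r$ is a torus, $R=\mathbb Z[\mathrm{Lie}(T)]$ (symmetric algebra of the character lattice), with chosen linear elements $\hbar,u_\alpha\in R$ ($\alpha\in\Omega$) given by characters of $T$. The doubled quiver has arrows $\bar\Omega=\{\alpha,\bar\alpha\}_{\alpha\in\Omega}$, where $\bar\alpha:j\to i$ for $\alpha:i\to j$, and $u_{\bar\alpha}:=\hbar-u_\alpha$. **Big shuffle algebra.** $\mathcal V^+=\bigoplus_{\mathbf n\in\mathbb N^I}R[z_{i1},\dots,z_{in_i}]_{i\in I}^{\mathrm{sym}}$ (symmetric in $z_{i1},\dots,z_{in_i}$ for each $i$ separately), with $$\zeta_{ij}(x)=\Big(\tfrac{x-\hbar}{x}\Big)^{\delta_{ij}}\prod_{(\alpha:i\to j)\in\bar\Omega}(-x-u_\alpha)$$ and product $$E*E'=\mathrm{Sym}\Big[\tfrac{E(z_{i1},\dots,z_{in_i})E'(z_{i,n_i+1},\dots,z_{i,n_i+n_i'})}{\mathbf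 n!\,\mathbf n'!}\prod_{i,j\in I}\prod_{1\le a\le n_i,\ n_j<b\le n_j+n'_j}\zeta_{ij}(z_{ia}-z_{jb})\Big],$$ where $\mathbf n!=\prod_i n_i!$ and Sym is the sum over all permutations of $z_{i1},\dots,z_{i,n_i+n_i'}$ for each $i$ independently. **Integral shuffle algebra.** $\mathcal S^+\subset\mathcal V^+$ is the $R$-subalgebra of (sums of) $E(z_{i1},\dots,z_{in_i})_{i\in I}\in\mathcal V^+$ such that for every $I$-composition $\{n_i=n_i^{(1)}+\dots+n_i^{(d_i)}\}_{i\in I}$ into positive integers, the specialization $$E\big(x_{ia},x_{ia}+\hbar,\dots,x_{ia}+(n_i^{(a)}-1)\hbar\big)_{i\in I,\,1\le a\le d_i}$$ is divisible in $R[x_{i1},\dots,x_{id_i}]_{i\in I}$ by $$\prod_{i\in I}\Big(\hbar^{n_i}\prod_{a=1}^{d_i}n_i^{(a)}!\Big)\prod_{(\alpha:i\to j)\in\Omega}\ \prod_{1\le a\le d_i,\,1\le b\le d_j}\ \prod_{c\in\mathbb Z}(x_{jb}-x_{ia}+c\hbar-u_\alpha)^{\chi_{n_i^{(a)},n_j^{(b)}}(c)},$$ with $\chi_{k,k'}(c)=\max(0,\min(k,k',c+k-1,k'-c))$. **Assumption Ъ.** $\hbar\neq0$, and the equation $\sum_{\alpha\in\Omega}(x_\alpha u_\alpha+y_\alpha u_{\bar\alpha})=0$ has no non-trivial solution with $x_\alpha,y_\alpha\in\mathbb Z_{\ge0}$. **Assumption Ь.** $\hbar\ne0$, and: (1)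 for all $i,j\in I$, with $\alpha$ ranging over arrows $i\to j$ of $Q$ and $\beta$ over arrows $j\to i$ of $Q$, the sets $\bigcup_\alpha(u_\alpha+\mathbb Z_{<0}\hbar)\cup\bigcup_\beta(-u_\beta+\mathbb Z_{>0}\hbar)$ and $\bigcup_\alpha(u_\alpha+\mathbb Z_{\ge0}\hbar)\cup\bigcup_\beta(-u_\beta+\mathbb Z_{\le0}\hbar)$ are disjoint; (2) for all $\alpha,\beta\in\Omega_{\text{loop}}$, $m\in\mathbb Z_{<0}$, $m'\in\mathbb Z_{\ge0}$ and $x,y\in\mathbb Z$, $x(u_\alpha+m\hbar)=y(u_\beta+m'\hbar)$ implies $x=y=0$. *)

(* Defs.v *)
From HB Require Import structures.
From mathcomp Require Import all_boot all_order all_algebra all_fingroup.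
From mathcomp Require Import mpoly.
From mathcomp Require Import zify ring.
From Stdlib Require Import ClassicalEpsilon FunctionalExtensionality.

Set Implicit Arguments.
Unset Strict Implicit.
Unset Printing Implicit Defensive.

Import GRing.Theory Num.Theory.
Local Open Scope ring_scope.

Record quiver := Quiver {
  vert : finType;
  arrow : finType;
  src : arrow -> vert;
  tgt : arrow -> vert }.

(* [inl a] is the arrow a itself, [inr a] is the opposite arrow a-bar. *)
Definition double_quiver (Q : quiver) : quiver :=
  @Quiver (vert Q) (arrow Q + arrow Q)%type
    (fun x => match x with inl a => src a | inr a => tgt a end)
    (fun x => match x with inl a => tgt a | inr a => src a end).

Definition double_weight (Q : quiver) (A : zmodType) (hbar : A)
    (u : arrow Q -> A) (x : arrow (double_quiver Q)) : A :=
  match x with inl a => u a | inr a => hbar - u a end.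

Notation dimvec I := {ffun I -> nat}.


(* Indices are counted from 0: the variable z_(i,a) with 1 <= a <= d_i is the
   pair (i, a-1). *)
Definition zvar (I : finType) (d : dimvec I) : finType := {i : I & 'I_(d i)}.

Definition nvar (I : finType) (d : dimvec I) : nat := #|{: zvar d}|.

Notation zpoly A d := {mpoly A[nvar d]}.

Section ColoredPolynomials.
Variable I : finType.

Variable A : idomainType.

(* The index a is a natural number rather than an ordinal, with a junk value 0
   when a >= d i, so that a variable of one dimension vector can be named
   inside another one without casts. *)
Definition zX (d : dimvec I) (i : I) (a : nat) : zpoly A d :=
  if (insub a : option 'I_(d i)) is Some b
  then 'X_(enum_rank (Tagged (fun j => 'I_(d j)) b : zvar d))
  else 0.

(* The value of p at z_(i,a) := y i a. *)
Definition zsubst (d e : dimvec I) (y : I -> nat -> zpoly A e) (p : zpoly A d) :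
    zpoly A e :=
  mmap (@mpolyC _ A)
       (fun k : 'I_(nvar d) => let v : zvar d := enum_val k in y (tag v) (tagged v)) p.

Definition colperm (d : dimvec I) := {dffun forall i : I, {perm 'I_(d i)}}.

Definition permz (d : dimvec I) (s : colperm d) (i : I) (a : nat) : zpoly A d :=
  if (insub a : option 'I_(d i)) is Some b then zX d i (s i b) else 0.

Definition zsym (d : dimvec I) (p : zpoly A d) : Prop :=
  forall s : colperm d, zsubst (permz s) p = p.

(* Elements of the direct sum over all dimension vectors are families of
   polynomials, subject to the finiteness condition in [Vplus]. *)
Definition vfamily := forall d : dimvec I, zpoly A d.

Definition Vplus (E : vfamily) : Prop :=
  (exists s : seq (dimvec I), forall d, d \notin s -> E d = 0) /\
  (forall d, zsym (E d)).

Definition fam_add (E E' : vfamily) : vfamily := fun d => E d + E' d.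
Definition fam_scale (c : A) (E : vfamily) : vfamily := fun d => c *: E d.
Definition fam_one : vfamily := fun d => if d == [ffun=> 0%N] then 1 else 0.

(* z_(i,1)^k, in dimension vector delta_i. *)
Definition e_ (i : I) (k : nat) : vfamily :=
  fun d => if d == [ffun j => (j == i) : nat] then zX d i 0 ^+ k else 0.

End ColoredPolynomials.

Arguments vfamily I A : clear implicits.
Arguments fam_one I A : clear implicits.
Arguments zX {I} A d i a.
Arguments permz {I} A {d} s i a.
Arguments e_ {I} A i k d.

Section Shuffle.
Variables (Q : quiver) (A : idomainType) (hbar : A) (u : arrow Q -> A).
Notation I := (vert Q).

Section Product.
Variables m k l : dimvec I.

Notation K := {fraction zpoly A m}.

Definition scal (c : A) : K := FracField.tofrac (c%:MP : zpoly A m).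

Definition zeta (i j : I) (x : K) : K :=
  ((x - scal hbar) / x) ^+ (i == j) *
  \prod_(g : arrow (double_quiver Q) | (src g == i) && (tgt g == j))
    (- x - scal (double_weight hbar u g)).

Definition dimfact (d : dimvec I) : nat := (\prod_i (d i)`!)%N.

(* Sym[...] is computed by evaluating the bracket at the permuted variables
   [permz s]; it is meant for m = k + l. *)
Definition shuffle_frac (E : zpoly A k) (E' : zpoly A l) : K :=
  \sum_(s : colperm m)
    let zs i a := FracField.tofrac (permz A s i a) in
    FracField.tofrac (zsubst (permz A s) E) *
    FracField.tofrac (zsubst (fun i b => permz A s i (k i + b)%N) E') /
    (dimfact k * dimfact l)%:R *
    \prod_i \prod_j \prod_(a < k i) \prod_(b < l j)
      zeta i j (zs i a - zs j (k j + b)%N).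

(* The polynomial equal to the rational function above: its poles cancel for
   m = k + l over a field of characteristic other than 2, see [shuffleP]. *)
Definition shuffle (E : zpoly A k) (E' : zpoly A l) : zpoly A m :=
  epsilon (inhabits 0) (fun p => FracField.tofrac p = shuffle_frac E E').

End Product.

Definition fam_mul (E E' : vfamily I A) : vfamily I A := fun m =>
  \sum_(f : {dffun forall i : I, 'I_(m i).+1})
    let k : dimvec I := [ffun i => f i : nat] in
    let l : dimvec I := [ffun i => (m i - f i)%N] in
    shuffle m (E k) (E' l).

Definition subalgebra (P : vfamily I A -> Prop) : Prop :=
  [/\ P (fam_one I A),
      forall E E', P E -> P E' -> P (fam_add E E'),
      forall c E, P E -> P (fam_scale c E)
    & forall E E', P E -> P E' -> P (fam_mul E E')].

Definition generated (G : vfamily I A -> Prop) (E : vfamily I A) : Prop :=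
  forall P, subalgebra P -> (forall X, G X -> P X) -> P E.

Definition chi (k k' : nat) (c : int) : nat :=
  absz (Num.max 0 (Num.min (Num.min k%:Z k'%:Z)
                           (Num.min (c + k%:Z - 1) (k'%:Z - c)))).

Definition is_composition (d : dimvec I) (c : I -> seq nat) : Prop :=
  forall i, all (leq 1) (c i) /\ sumn (c i) = d i.

Definition nparts (c : I -> seq nat) : dimvec I := [ffun i => size (c i)].

Definition part (c : I -> seq nat) (i : I) (a : nat) : nat := nth 0%N (c i) a.

(* The list x_i1, x_i1 + hbar, ..., x_i1 + (n_i1 - 1) hbar, x_i2, ... *)
Definition strings (c : I -> seq nat) (i : I) : seq (zpoly A (nparts c)) :=
  flatten [seq [seq zX A (nparts c) i a + (hbar *+ t)%:MP | t <- iota 0 (part c i a)]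
          | a <- iota 0 (size (c i))].

Definition specialize (d : dimvec I) (c : I -> seq nat) (E : zpoly A d) :
    zpoly A (nparts c) :=
  zsubst (fun i a => nth 0 (strings c i) a) E.

(* In the innermost product c ranges over the interval [-k, k'], with k and k'
   the two parts: [chi k k'] vanishes outside of it, see [chi_out]. *)
Definition divisor (d : dimvec I) (c : I -> seq nat) : zpoly A (nparts c) :=
  (\prod_i (hbar ^+ d i * (\prod_(a < size (c i)) (part c i a)`!)%:R))%:MP *
  \prod_(g : arrow Q)
    \prod_(a < size (c (src g))) \prod_(b < size (c (tgt g)))
      let k := part c (src g) a in
      let k' := part c (tgt g) b in
      \prod_(t < (k + k').+1)
        let cc := t%:Z - k%:Z in
        (zX A (nparts c) (tgt g) b - zX A (nparts c) (src g) a
          + (hbar *~ cc - u g)%:MP) ^+ chi k k' cc.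

Definition Splus (E : vfamily I A) : Prop :=
  Vplus E /\
  forall (d : dimvec I) (c : I -> seq nat), is_composition d c ->
    exists q, specialize c (E d) = q * divisor d c.

End Shuffle.

Lemma chi_out (k k' : nat) (c : int) :
  c < - k%:Z \/ k'%:Z < c -> chi k k' c = 0%N.
Proof.
by rewrite /chi; lia.
Qed.

Section ShuffleIsPolynomial.

Fact congM (K : comNzRingType) (h x g c y y' c' : K) :
  x = g + h * c -> y = y' + h * c' -> x * y = g * y' + h * (c * y + g * c').
Proof. by move=> -> ->; ring. Qed.

Variables (I : finType) (A : idomainType).

Section Subst.
Variables (d e : dimvec I) (y : I -> nat -> zpoly A e).

HB.instance Definition _ := GRing.RMorphism.copy (zsubst y : zpoly A d -> zpoly A e)
  (mmap (@mpolyC (nvar e) A)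
    (fun k : 'I_(nvar d) => let v : zvar d := enum_val k in y (tag v) (tagged v))).

Lemma zsubstC c : zsubst y (c%:MP : zpoly A d) = c%:MP.
Proof. by rewrite /zsubst mmapC. Qed.

Lemma zsubstX i a : (a < d i)%N -> zsubst y (zX A d i a) = y i a.
Proof.
by move=> lta; rewrite /zX insubT /zsubst mmapX mmap1U enum_rankK.
Qed.

End Subst.

Lemma zsubst_eq (d e : dimvec I) (y1 y2 : I -> nat -> zpoly A e) (p : zpoly A d) :
  (forall i a, (a < d i)%N -> y1 i a = y2 i a) -> zsubst y1 p = zsubst y2 p.
Proof.
move=> eqy; rewrite /zsubst /mmap; apply: eq_bigr => m _; congr (_ * _).
by apply: mmap1_eq => k /=; apply: eqy.
Qed.

Lemma zsubst_comp (c d e : dimvec I) (y : I -> nat -> zpoly A d)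
    (y' : I -> nat -> zpoly A e) (p : zpoly A c) :
  zsubst y' (zsubst y p) = zsubst (fun i a => zsubst y' (y i a)) p.
Proof.
rewrite {2 3}/zsubst /mmap rmorph_sum; apply: eq_bigr => m _.
rewrite rmorphM /= zsubstC /mmap1 rmorph_prod; congr (_ * _).
by apply: eq_bigr => k _; rewrite rmorphXn.
Qed.

Lemma zX_enum (d : dimvec I) (k : 'I_(nvar d)) :
  zX A d (tag (enum_val k : zvar d)) (tagged (enum_val k : zvar d)) = 'X_k.
Proof.
rewrite /zX insubT //= => lt; congr 'X_(_); apply: (canLR enum_valK).
by case: (enum_val k) lt => i a lt; congr Tagged; apply: val_inj.
Qed.

Lemma zsubst_id (d : dimvec I) (p : zpoly A d) : zsubst (zX A d) p = p.
Proof.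
rewrite /zsubst -[RHS]comp_mpoly_id /comp_mpoly /mmap; apply: eq_bigr => m _.
by congr (_ * _); apply: mmap1_eq => k /=; rewrite tnth_mktuple -zX_enum.
Qed.

Section Divide.
Variables (d : dimvec I) (i : I) (a b : nat).
Hypotheses (lta : (a < d i)%N) (ltb : (b < d i)%N) (neab : a != b).

Definition glue (j : I) (c : nat) : zpoly A d :=
  if (j == i) && (c == b) then zX A d i a else zX A d j c.

Let h := zX A d i a - zX A d i b.

Lemma glue_mul q : zsubst glue (h * q) = 0.
Proof.
rewrite rmorphM rmorphB /= !zsubstX // /glue !eqxx (negbTE neab) /=.
by rewrite subrr mul0r.
Qed.

Lemma glue_div (p : zpoly A d) : zsubst glue p = 0 -> exists q, p = h * q.
Proof.
suff [q eqp] : exists q, p = zsubst glue p + h * q.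
  by move=> gp; exists q; rewrite {1}eqp gp add0r.
elim/mpolyind: p => [|c m p _ _ [q eqp]]; first by exists 0; rewrite mulr0 rmorph0 addr0.
suff [q' eqm] : exists q', 'X_[m] = zsubst glue 'X_[m] + h * q'.
  exists (c *: q' + q); rewrite -!mul_mpolyC rmorphD rmorphM /= zsubstC.
  rewrite {1}eqm {1}eqp mulrDr [h * (_ + _)]mulrDr -!addrA; congr (_ + _).
  by rewrite addrCA mulrCA.
rewrite /zsubst mmapX /mmap1 mpolyXE_id.
elim/big_rec2: _ => [|k y1 y2 _ [q1 eq1]]; first by exists 0; rewrite mulr0 addr0.
suff [q2 eq2] : exists q2,
    'X_k = glue (tag (enum_val k : zvar d)) (tagged (enum_val k : zvar d)) + h * q2.
  elim: (m k) => [|n [q3 eq3]].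
    by exists q1; rewrite !expr0 !mul1r eq1.
  by eexists; rewrite !exprS -!mulrA; apply: congM eq2 eq3.
rewrite -zX_enum /glue; move: (tag _) (nat_of_ord _) => j a'.
case: ifP => [/andP[/eqP-> /eqP->]|_].
  by exists (-1); rewrite mulrN1 opprB addrC subrK.
by exists 0; rewrite mulr0 addr0.
Qed.

Lemma glue_zX j c : (c < d j)%N -> glue j c = zX A d j (if (j == i) && (c == b) then a else c).
Proof. by rewrite /glue; case: ifP => // /andP[/eqP-> _]. Qed.

End Divide.

Section Sym.
Variable d : dimvec I.

Definition colmul (s t : colperm d) : colperm d := [ffun i => (s i * t i)%g].

Lemma permzE (s : colperm d) i (a : 'I_(d i)) : permz A s i a = zX A d i (s i a).
Proof. by rewrite /permz valK. Qed.

Lemma permz_comp (s t : colperm d) i a :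
  zsubst (permz A t) (permz A s i a) = permz A (colmul s t) i a.
Proof.
have [lta|gea] := ltnP a (d i); last first.
  by rewrite /permz !insubF ?ltnNge ?gea // rmorph0.
rewrite -[a]/(val (Ordinal lta)) !permzE zsubstX //.
by rewrite permzE ffunE permM.
Qed.

Lemma colmul_inj t : injective (colmul^~ t).
Proof.
move=> s s' /ffunP eqs; apply/ffunP => i.
by have := eqs i; rewrite !ffunE => /mulIg.
Qed.

Definition coltr i (a b : 'I_(d i)) : colperm d :=
  [ffun j => dfwith (fun=> 1%g) (tperm a b) j].

Lemma coltrE i (a b : 'I_(d i)) : coltr a b i = tperm a b.
Proof. by rewrite ffunE dfwith_in. Qed.

Lemma coltr_out i (a b : 'I_(d i)) j : i != j -> coltr a b j = 1%g.
Proof. by move=> ne; rewrite ffunE dfwith_out. Qed.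

Lemma zX_inj j (a b : nat) : (a < d j)%N -> (b < d j)%N ->
  zX A d j a = zX A d j b -> a = b.
Proof.
move=> lta ltb; rewrite /zX !insubT /=.
set u := Tagged _ _; set v := Tagged _ _.
move/(congr1 (mcoeff U_(enum_rank v))); rewrite !mcoeffXU eqxx (inj_eq enum_rank_inj).
have [equv _|_ /eqP] := eqVneq u v; last by rewrite eq_sym oner_eq0.
by have /eqP := equv; rewrite eq_Tagged /= => /eqP[].
Qed.

Variable h : (I -> nat -> zpoly A d) -> zpoly A d.
Hypothesis h_nat : forall w y,
  zsubst w (h y) = h (fun i a => zsubst w (y i a)).
Hypothesis h_vanish : forall y i a b, (a < d i)%N -> (b < d i)%N -> a != b ->
  y i a = y i b -> h y = 0.
Hypothesis two_neq0 : 2%:R != 0 :> A.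

Let M := \sum_(s : colperm d) h (permz A s).

Lemma M_sym t : zsubst (permz A t) M = M.
Proof.
rewrite /M rmorph_sum [RHS](reindex_inj (@colmul_inj t)) /=.
apply: eq_bigr => s _; rewrite h_nat; congr h.
do 2 apply: functional_extensionality => ?; exact: permz_comp.
Qed.

Lemma M_glue i (a b : 'I_(d i)) : a != b -> zsubst (glue d i a b) M = 0.
Proof.
move=> neab; rewrite /M rmorph_sum big1 // => s _; rewrite /= h_nat.
apply: (@h_vanish _ i ((s i)^-1%g a) ((s i)^-1%g b)) => //.
  by rewrite (inj_eq val_inj) (inj_eq perm_inj).
by rewrite !permzE !permKV !zsubstX // !glue_zX // !eqxx /= (inj_eq val_inj) (negbTE neab).
Qed.

Lemma M_double i (a b : 'I_(d i)) (q : zpoly A d) : a != b ->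
  M = (zX A d i a - zX A d i b) * q -> zsubst (glue d i a b) q = 0.
Proof.
move=> neab eqM; set t := coltr a b.
have nz : zX A d i a - zX A d i b != 0.
  rewrite subr_eq0; apply: contraNneq neab => eqX.
  by apply/eqP/val_inj; apply: zX_inj eqX.
have eqq : q = - zsubst (permz A t) q.
  apply: (mulfI nz); rewrite -eqM -(M_sym t) eqM rmorphM rmorphB /=.
  rewrite !zsubstX // !permzE coltrE tpermL tpermR.
  by rewrite mulrN -mulNr opprB.
have eqg : zsubst (glue d i a b) (zsubst (permz A t) q) = zsubst (glue d i a b) q.
  rewrite zsubst_comp; apply: zsubst_eq => j c ltc.
  rewrite -[c]/(val (Ordinal ltc)) permzE zsubstX // !glue_zX //; congr zX.
  have [eqj|nej] /= := eqVneq j i; last first.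
    by rewrite coltr_out 1?eq_sym // perm1.
  subst j; rewrite coltrE.
  case: tpermP => [/(congr1 val)/= ->|/(congr1 val)/= ->|_ /eqP neb].
  - by rewrite eqxx (inj_eq val_inj) (negbTE neab).
  - by rewrite eqxx (inj_eq val_inj) (negbTE neab).
  - by rewrite /=.
have /eqP := congr1 (zsubst (glue d i a b)) eqq.
rewrite rmorphN /= eqg -addr_eq0 -mulr2n -mulr_natl mulf_eq0.
rewrite -(rmorph_nat (@mpolyC (nvar d) A)) mpolyC_eq0 (negbTE two_neq0).
by move/eqP.
Qed.

Let p (x : {i : I & ('I_(d i) * 'I_(d i))%type}) : zpoly A d :=
  zX A d (tag x) (tagged x).1 - zX A d (tag x) (tagged x).2.

Lemma glue_p_neq0 i (a b : 'I_(d i)) (x : {i : I & ('I_(d i) * 'I_(d i))%type}) :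
  a != b -> (tagged x).1 != (tagged x).2 ->
  x != Tagged (fun i => ('I_(d i) * 'I_(d i))%type) (a, b) ->
  x != Tagged (fun i => ('I_(d i) * 'I_(d i))%type) (b, a) ->
  zsubst (glue d i a b) (p x) != 0.
Proof.
case: x => j [a' b'] /= neab neab' ne1 ne2.
rewrite rmorphB /= !zsubstX // !glue_zX // subr_eq0.
have [eqj|nej] /= := eqVneq j i; last first.
  by apply: contraNneq neab' => eqX; apply/eqP/val_inj; apply: zX_inj eqX.
subst j; move: ne1 ne2; rewrite !eq_Tagged /= !xpair_eqE => ne1 ne2.
apply/eqP; rewrite !(inj_eq val_inj) => /zX_inj eqX.
have {eqX} : (if a' == b then a else a') = (if b' == b then a else b').
  by apply: val_inj; move: eqX; do 2 case: ifP => _; apply.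
move: ne1 ne2 neab'; case: (eqVneq a' b) => [->|_]; case: (eqVneq b' b) => [->|_].
- by rewrite ?eqxx.
- by move=> _ + _ eqab; rewrite ?eqab ?eqxx.
- by move=> + _ _ eqab; rewrite ?eqab ?eqxx.
- by move=> _ _ + eqab; rewrite ?eqab ?eqxx.
Qed.

Lemma M_dvd (L : seq {i : I & ('I_(d i) * 'I_(d i))%type}) :
  uniq L -> all (fun x => (tagged x).1 != (tagged x).2) L ->
  exists q, M = (\prod_(x <- L) p x) * q.
Proof.
elim: L => [|x L IH] /=; first by exists M; rewrite big_nil mul1r.
case: x => i [a b] /andP[xL uL] /andP[/= neab aL].
have [q eqM] := IH uL aL.
pose y := Tagged (fun i => ('I_(d i) * 'I_(d i))%type) (b, a).
suff [q' eqq] : exists q', q = (zX A d i a - zX A d i b) * q'.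
  exists q'; rewrite big_cons eqM eqq /p /=.
  by rewrite mulrA [_ * (_ - _)]mulrC.
apply: glue_div => //.
have nzprod (L' : seq {i : I & ('I_(d i) * 'I_(d i))%type}) : {subset L' <= L} -> y \notin L' ->
    zsubst (glue d i a b) (\prod_(x <- L') p x) != 0.
  move=> sL' yL'; rewrite rmorph_prod prodf_seq_neq0; apply/allP => x xL' /=.
  apply: glue_p_neq0 => //.
  - exact: (allP aL) (sL' _ xL').
  - by apply/eqP => eqx; have := sL' _ xL'; rewrite eqx; apply/negP.
  - by apply/eqP => eqx; move: xL'; rewrite eqx; apply/negP.
have [yL|yL] := boolP (y \in L); last first.
  have /eqP := M_glue neab; rewrite eqM rmorphM mulf_eq0 /=.
  by rewrite (negbTE (nzprod L _ _)) // => /eqP.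
have eqM' : M = (zX A d i a - zX A d i b) * (- ((\prod_(x <- rem y L) p x) * q)).
  rewrite eqM (big_rem _ yL) /= -mulrA mulrN -mulNr; congr (_ * _).
  by rewrite /p /= opprB.
have /eqP := M_double neab eqM'; rewrite rmorphN oppr_eq0 rmorphM mulf_eq0 /=.
rewrite (negbTE (nzprod _ _ _)) /=; first by move/eqP.
- exact: mem_rem.
- by rewrite mem_rem_uniq // inE eqxx.
Qed.

Definition zdelta (y : I -> nat -> zpoly A d) : zpoly A d :=
  \prod_i \prod_(0 <= a < d i) \prod_(0 <= b < d i | b != a) (y i a - y i b).

Lemma zdelta_sym s : zdelta (permz A s) = zdelta (zX A d).
Proof.
apply: eq_bigr => i _; rewrite !big_mkord [RHS](reindex_inj (@perm_inj _ (s i))).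
apply: eq_bigr => a _; rewrite !big_mkord [RHS](reindex_inj (@perm_inj _ (s i))).
apply: eq_big => [b|b _]; last by rewrite !permzE.
by rewrite !(inj_eq val_inj) (inj_eq perm_inj).
Qed.

Lemma zdelta_neq0 : zdelta (zX A d) != 0.
Proof.
apply/prodf_neq0 => i _; rewrite big_mkord; apply/prodf_neq0 => a _.
rewrite big_mkord; apply/prodf_neq0 => b neba; rewrite subr_eq0.
by apply: contraNneq neba => /zX_inj ->.
Qed.

Lemma sym_div : exists q, \sum_(s : colperm d) h (permz A s) = zdelta (zX A d) * q.
Proof.
pose P (x : {i : I & ('I_(d i) * 'I_(d i))%type}) := (tagged x).1 != (tagged x).2.
have [|| q eqM] := @M_dvd (filter P (index_enum _)); first 2 last.
- exists q; rewrite -/M eqM big_filter; congr (_ * _); rewrite /zdelta.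
  under [RHS]eq_bigr => i _.
    rewrite big_mkord.
    under eq_bigr => a _ do rewrite big_mkord.
    rewrite pair_big_dep; over.
  rewrite sig_big_dep; apply: eq_bigl => -[i [a b]] /=.
  by rewrite /P /= eq_sym (inj_eq val_inj).
- by rewrite filter_uniq // index_enum_uniq.
- exact: filter_all.
Qed.

End Sym.
End ShuffleIsPolynomial.

Fact clear_den (K : fieldType) (a b c n r D : K) : D != 0 ->
  a * b * c * n * r = D * r * (a * b * c * (n / D)).
Proof. by move=> nzD; field. Qed.

Section ShuffleSpec.
Variables (Q : quiver) (A : fieldType) (hbar : A) (u : arrow Q -> A).
Notation I := (vert Q).
Variables (m k l : dimvec I) (E : zpoly A k) (E' : zpoly A l).
Hypothesis eqm : forall i, m i = (k i + l i)%N.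
Hypothesis two_neq0 : 2%:R != 0 :> A.
Notation tofrac := (@FracField.tofrac (zpoly A m)).
Implicit Type y : I -> nat -> zpoly A m.

Let num (i j : I) (x : zpoly A m) : zpoly A m :=
  (x - hbar%:MP) ^+ (i == j) *
  \prod_(g : arrow (double_quiver Q) | (src g == i) && (tgt g == j))
    (- x - (double_weight hbar u g)%:MP).

Let nums y := \prod_i \prod_j \prod_(a < k i) \prod_(b < l j)
  num i j (y i a - y j (k j + b)%N).

Let den y := \prod_i \prod_(a < k i) \prod_(b < l i) (y i a - y i (k i + b)%N).

Let rest y (i : I) :=
  (\prod_(0 <= a < k i) \prod_(0 <= b < k i | b != a) (y i a - y i b)) *
  (\prod_(k i <= a < m i) \prod_(0 <= b < m i | b != a) (y i a - y i b)).

Let h y : zpoly A m :=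
  zsubst y E * zsubst (fun i b => y i (k i + b)%N) E' *
  ((dimfact k * dimfact l)%:R^-1)%:MP * nums y * \prod_i rest y i.

Let zdeltaE y : zdelta y = den y * \prod_i rest y i.
Proof.
rewrite /zdelta /den -big_split; apply: eq_bigr => i _ /=.
have lekm : (k i <= m i)%N by rewrite eqm leq_addr.
rewrite (big_cat_nat _ lekm) //= /rest [RHS]mulrA; congr (_ * _).
rewrite mulrC -(big_mkord xpredT (fun a => \prod_(b < l i) (y i a - y i (k i + b)%N))).
rewrite -big_split; apply: eq_big_nat => a /andP[_ lta] /=.
rewrite (big_cat_nat _ lekm) //=; congr (_ * _).
rewrite -{1}[k i]add0n big_addn eqm addKn.
rewrite big_mkord; apply: eq_big => [b|b _]; last by rewrite addnC.
by lia.
Qed.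

Let h_nat w y : zsubst w (h y) = h (fun i a => zsubst w (y i a)).
Proof.
rewrite /h !rmorphM /= !zsubst_comp zsubstC; congr (_ * _ * _).
  rewrite /nums rmorph_prod; apply: eq_bigr => i _.
  rewrite rmorph_prod; apply: eq_bigr => j _.
  rewrite rmorph_prod; apply: eq_bigr => a _.
  rewrite rmorph_prod; apply: eq_bigr => b _.
  rewrite /num rmorphM rmorphXn !rmorphB /= zsubstC; congr (_ * _).
  rewrite rmorph_prod; apply: eq_bigr => g _.
  by rewrite rmorphB rmorphN !rmorphB /= zsubstC.
rewrite rmorph_prod; apply: eq_bigr => i _; rewrite /rest rmorphM /=.
by congr (_ * _); rewrite rmorph_prod; apply: eq_bigr => a _;
  rewrite rmorph_prod; apply: eq_bigr => b _; rewrite rmorphB.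
Qed.

Let h_vanish y i a b : (a < m i)%N -> (b < m i)%N -> a != b -> y i a = y i b ->
  h y = 0.
Proof.
move=> lta ltb neab eqy; rewrite /h (bigD1 i) //=.
suff -> : rest y i = 0 by rewrite mul0r mulr0.
rewrite /rest; wlog leba : a b lta ltb neab eqy / (b <= a)%N.
  move=> hw; case: (leqP b a) => [|/ltnW] le; first exact: (hw a b).
  by apply: (hw b a) => //; rewrite eq_sym.
have [ltak|geak] := ltnP a (k i).
  rewrite (big_rem a) ?mem_index_iota //= (big_rem b) ?mem_index_iota; last by lia.
  by rewrite [b == a]eq_sym neab eqy subrr /= !mul0r.
apply/eqP; rewrite mulf_eq0; apply/orP; right; apply/eqP.
rewrite (big_rem a) ?mem_index_iota ?geak //= (big_rem b) ?mem_index_iota //=.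
by rewrite [b == a]eq_sym neab eqy subrr /= !mul0r.
Qed.

Let zetaE i j x : zeta hbar u i j (tofrac x) = tofrac (num i j x) / tofrac x ^+ (i == j).
Proof.
rewrite /zeta /num expr_div_n rmorphM rmorphXn rmorphB /= mulrAC; congr (_ * _ * _).
by rewrite rmorph_prod; apply: eq_bigr => g _; rewrite rmorphB rmorphN.
Qed.

Let zeta_prod y :
  \prod_i \prod_j \prod_(a < k i) \prod_(b < l j)
     zeta hbar u i j (tofrac (y i a) - tofrac (y j (k j + b)%N))
  = tofrac (nums y) / tofrac (den y).
Proof.
rewrite /nums /den !rmorph_prod -prodf_div; apply: eq_bigr => i _.
transitivity (\prod_j \prod_(a < k i) \prod_(b < l j)
  (tofrac (num i j (y i a - y j (k j + b)%N)) /
   tofrac (y i a - y j (k j + b)%N) ^+ (i == j))).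
  do 3 (apply: eq_bigr => ? _); by rewrite -tofracB zetaE.
under eq_bigr => j _ do (under eq_bigr => a _ do rewrite prodf_div; rewrite prodf_div).
rewrite prodf_div; congr (_ / _).
  by do 3 (rewrite rmorph_prod; apply: eq_bigr => ? _).
rewrite (bigD1 i) //= [X in _ * X]big1 ?mulr1 => [|j neji]; last first.
  by rewrite big1 // => a _; rewrite big1 // => b _; rewrite eq_sym (negbTE neji).
by do 2 (rewrite rmorph_prod; apply: eq_bigr => ? _); rewrite eqxx.
Qed.

Lemma shuffleP :
  FracField.tofrac (shuffle hbar u m E E') = shuffle_frac hbar u m E E'.
Proof.
apply: (epsilon_spec (inhabits 0)
  (fun p => FracField.tofrac p = shuffle_frac hbar u m E E')).
have [q eqq] := sym_div h_nat h_vanish two_neq0.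
exists q; have nzd := zdelta_neq0 A m.
have nzD : tofrac (zdelta (zX A m)) != 0 by rewrite tofrac_eq0.
apply: (mulfI nzD); rewrite -tofracM -eqq rmorph_sum mulr_sumr.
apply: eq_bigr => s _ /=; rewrite -(zdelta_sym A s) in nzD *.
set y := permz A s in nzD *.
have nzden : tofrac (den y) != 0.
  rewrite tofrac_eq0; apply: contraNneq nzd => den0.
  by rewrite -(zdelta_sym A s) zdeltaE den0 mul0r.
rewrite zeta_prod zdeltaE /h !tofracM.
have -> : tofrac ((dimfact k * dimfact l)%:R^-1)%:MP = (dimfact k * dimfact l)%:R^-1.
  have := fmorphV (tofrac \o @mpolyC (nvar m) A) (dimfact k * dimfact l)%:R.
  by rewrite rmorph_nat.
exact: clear_den.
Qed.

End ShuffleSpec.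

(* Z[Lie(T)] for a torus T of rank r with a basis of its character lattice. *)
Notation Rtorus r := {mpoly int[r]}.

Definition char_lin (r : nat) (x : 'rV[int]_r) : Rtorus r :=
  \sum_(k < r) x 0 k *: 'X_k.

Section Localization.
Variables (Q : quiver) (R : idomainType) (hbar : R) (u : arrow Q -> R).

(* S+ (x)_R Frac(R), inside V+ (x)_R Frac(R) = (+)_n Frac(R)[z]^sym: the
   R-module V+ is torsion-free and Frac(R) is the localization of R at its
   nonzero elements. *)
Definition Sloc (X : vfamily (vert Q) {fraction R}) : Prop :=
  exists (s : R) (E : vfamily (vert Q) R),
    [/\ s != 0, Splus hbar u E &
        forall d, X d = (FracField.tofrac s)^-1 *:
                        map_mpoly (@FracField.tofrac R) (E d)].

End Localization.

Section Assumptions.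
Variables (Q : quiver) (R : idomainType) (hbar : R) (u : arrow Q -> R).

Definition assumption_hard_sign : Prop :=
  hbar != 0 /\
  forall x y : arrow Q -> nat,
    \sum_(g : arrow Q) (u g *+ x g + (hbar - u g) *+ y g) = 0 ->
    forall g, x g = 0%N /\ y g = 0%N.

Definition is_loop (g : arrow Q) : Prop := src g = tgt g.

Definition assumption_soft_sign : Prop :=
  [/\ hbar != 0,
      forall (i j : vert Q) (w : R),
        ~ (((exists g (m : int), [/\ src g = i, tgt g = j, m < 0
                                  & w = u g + hbar *~ m]) \/
            (exists g (m : int), [/\ src g = j, tgt g = i, m > 0
                                  & w = - u g + hbar *~ m])) /\
           ((exists g (m : int), [/\ src g = i, tgt g = j, m >= 0
                                  & w = u g + hbar *~ m]) \/
            (exists g (m : int), [/\ src g = j, tgt g = i, m <= 0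
                                  & w = - u g + hbar *~ m])))
    & forall (g g' : arrow Q) (m m' x y : int),
        is_loop g -> is_loop g' -> m < 0 -> m' >= 0 ->
        (u g + hbar *~ m) *~ x = (u g' + hbar *~ m') *~ y ->
        x = 0 /\ y = 0].

End Assumptions.

(* Main.v *)
From HB Require Import structures.
From mathcomp Require Import all_boot all_order all_algebra all_fingroup.
From mathcomp Require Import mpoly.
From mathcomp Require Import zify ring.
From Stdlib Require Import ClassicalEpsilon FunctionalExtensionality Classical.
Require Import Defs.

Set Implicit Arguments.
Unset Strict Implicit.
Unset Printing Implicit Defensive.

Import GRing.Theory Num.Theory.
Local Open Scope ring_scope.

(** Why the theorem holds.

    In dimension vector d the shuffle product of powers of single variables, taken
    in an order w of the variables, is the symmetrization of a monomial times the
    product of zeta(X_a - X_b) over the pairs with a before b in w. Multiplication by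
    the discriminant Delta clears the denominators, so the subalgebra generated by
    the e_(i,k) consists, in each dimension vector, of the E such that Delta E is a sum
    of symmetrized ordered products: this is [in_span], and
    [generated_in_span_fam] is the statement. Clearing the denominators of an element
    and of the finitely many quotients by the divisors ([Splus_Sloc]) moves the
    divisibility conditions to the field of fractions, where the claim becomes that
    the divisibility conditions describe [in_span].

    The elements of the span satisfy the conditions ([in_span_specialize]). Specialize
    an ordered product at strings x, x + hbar, ... If some string is not listed upwards,
    then a factor X_a - X_b - hbar of zeta vanishes. Otherwise, for an arrow and two
    strings, each factor of the divisor occurs at least chi times: a discrete
    intermediate value argument ([chi_le_count]). Delta can be cancelled because no
    weight u is a multiple of hbar.

    For the converse ([string_divisible_in_span]), consider the symmetric f such that
    f E lies in the span. If the ideal that they generate is the unit ideal, then E lies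
    in the span. Otherwise enlarge it to a proper ideal H modulo which every linear
    form X_a - X_b - c, with c one of 0, hbar, u, hbar - u, is zero or invertible
    ([ideal_decide]); H serves as a point at which all these f vanish. Modulo units the
    kernel at this point is a product of differences of centred coordinates
    ([zeta_kernel_factor]). By positivity of the weights the values of the coordinates
    can be ranked so that arrows go up and steps by -hbar go down
    ([local_structureP]). If E satisfies the local form of the divisibility
    conditions, then E is a local combination of symmetrized ordered products
    ([local_theorem]), which yields an expansion of v Delta E with v invertible
    modulo H. Symmetrizing it against products of differences X_(s a) - X_b, which
    vanish unless the permutation s preserves the point, gives an element of H that is
    invertible modulo H, a contradiction.

    The local theorem is proved by induction on the number of variables. Let t be a
    variable of maximal rank. When a string from t downwards is glued to t, the
    conditions force E to be divisible by explicit factors, and the quotient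
    satisfies the conditions for the variables outside the string
    ([quotient_exists]). By induction the quotient is a combination of ordered
    products; with the string put in front they give an element E0 of the span with
    the same restriction as E ([string_step]). Then E - E0 vanishes on that string, and
    one passes to shorter strings until E itself is reached ([string_induction]). This
    produces symmetrizations over the permutations that fix t only, and Lagrange
    interpolation at the variables that have the value of t restores the rest
    ([Sym_leading]). *)

(** * Divisibility and substitution *)

Definition dv (R : comNzRingType) (p q : R) : Prop := exists r, q = r * p.

Section Divisibility.
Variable R : comNzRingType.
Implicit Types p q r : R.

Lemma dv_refl p : dv p p. Proof. by exists 1; rewrite mul1r. Qed.
Lemma dv1 p : dv 1 p. Proof. by exists p; rewrite mulr1. Qed.
Lemma dv0 p : dv p 0. Proof. by exists 0; rewrite mul0r. Qed.
Lemma dvD p q r : dv p q -> dv p r -> dv p (q + r).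
Proof. by move=> [x ->] [y ->]; exists (x + y); rewrite mulrDl. Qed.
Lemma dv_mull p q r : dv p r -> dv p (q * r).
Proof. by move=> [x ->]; exists (q * x); rewrite mulrA. Qed.
Lemma dv_mulr p q r : dv p r -> dv p (r * q).
Proof. by rewrite mulrC; apply: dv_mull. Qed.
Lemma dvM p q p' q' : dv p q -> dv p' q' -> dv (p * p') (q * q').
Proof. by move=> [x ->] [y ->]; exists (x * y); rewrite mulrACA. Qed.
Lemma dv_trans q p r : dv p q -> dv q r -> dv p r.
Proof. by move=> [x ->] [y ->]; exists (y * x); rewrite mulrA. Qed.
Lemma dvX p (m k : nat) : (m <= k)%N -> dv (p ^+ m) (p ^+ k).
Proof. by move=> le; exists (p ^+ (k - m)); rewrite -exprD subnK. Qed.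
Lemma dv_sum (J : Type) (s : seq J) (a : pred J) p (f : J -> R) :
  (forall j, a j -> dv p (f j)) -> dv p (\sum_(j <- s | a j) f j).
Proof. by move=> H; elim/big_ind: _ => //; [exact: dv0 | move=> *; exact: dvD]. Qed.
Lemma dv_prod (J : Type) (s : seq J) (a : pred J) (f g : J -> R) :
  (forall j, a j -> dv (f j) (g j)) ->
  dv (\prod_(j <- s | a j) f j) (\prod_(j <- s | a j) g j).
Proof.
by move=> H; elim/big_ind2: _ => //; [exact: dv_refl | move=> *; exact: dvM].
Qed.
Lemma dv_prod_seq (J : eqType) (s : seq J) (f g : J -> R) :
  (forall j, j \in s -> dv (f j) (g j)) ->
  dv (\prod_(j <- s) f j) (\prod_(j <- s) g j).
Proof. by rewrite !big_seq; exact: dv_prod. Qed.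
Lemma dv_rmorph (S : comNzRingType) (f : {rmorphism R -> S}) p q :
  dv p q -> dv (f p) (f q).
Proof. by move=> [x ->]; exists (f x); rewrite rmorphM. Qed.
End Divisibility.

Section Evaluation.
Variable F : fieldType.

Definition ev n n' (th : 'I_n -> {mpoly F[n']}) (p : {mpoly F[n]}) : {mpoly F[n']} :=
  mmap (@mpolyC n' F) th p.

HB.instance Definition _ n n' (th : 'I_n -> {mpoly F[n']}) :=
  GRing.RMorphism.copy (ev th) (mmap (@mpolyC n' F) th).

Lemma evC n n' (th : 'I_n -> {mpoly F[n']}) c : ev th c%:MP = c%:MP.
Proof. by rewrite /ev mmapC. Qed.
Lemma evX n n' (th : 'I_n -> {mpoly F[n']}) k : ev th 'X_k = th k.
Proof. by rewrite /ev mmapX mmap1U. Qed.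
Lemma ev_eq n n' (th th' : 'I_n -> {mpoly F[n']}) : th =1 th' -> ev th =1 ev th'.
Proof. by move=> e p; rewrite (functional_extensionality _ _ e). Qed.

Lemma mpoly_gen_ind n (Pr : {mpoly F[n]} -> Prop) :
  (forall c, Pr c%:MP) -> (forall k, Pr 'X_k) ->
  (forall p q, Pr p -> Pr q -> Pr (p + q)) ->
  (forall p q, Pr p -> Pr q -> Pr (p * q)) -> forall p, Pr p.
Proof.
move=> hC hX hD hM; elim/mpolyind=> [|c m p _ _ IH]; first by rewrite -mpolyC0.
apply: hD => //; rewrite -mul_mpolyC; apply: (hM) => //.
rewrite mpolyXE_id; elim/big_ind: _ => [|p1 p2|k _]; first by rewrite -mpolyC1.
- exact: (hM).
- elim: (m k) => [|e IHe]; first by rewrite expr0 -mpolyC1.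
  by rewrite exprS; apply: hM.
Qed.

Lemma ev_comp n n' n'' (th : 'I_n -> {mpoly F[n']}) (th' : 'I_n' -> {mpoly F[n'']}) p :
  ev th' (ev th p) = ev (fun k => ev th' (th k)) p.
Proof.
elim/mpoly_gen_ind: p => [c|k|p q hp hq|p q hp hq].
- by rewrite !evC.
- by rewrite !evX.
- by rewrite !rmorphD /= hp hq.
- by rewrite !rmorphM /= hp hq.
Qed.

Lemma ev_id n (p : {mpoly F[n]}) : ev (fun k => 'X_k) p = p.
Proof.
elim/mpoly_gen_ind: p => [c|k|p q hp hq|p q hp hq].
- by rewrite !evC.
- by rewrite !evX.
- by rewrite !rmorphD /= hp hq.
- by rewrite !rmorphM /= hp hq.
Qed.

Definition sb n n' (f : 'I_n -> 'I_n') : {mpoly F[n]} -> {mpoly F[n']} :=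
  ev (fun k => 'X_(f k)).

HB.instance Definition _ n n' (f : 'I_n -> 'I_n') :=
  GRing.RMorphism.copy (sb f) (ev (fun k => 'X_(f k))).

Lemma sbX n n' (f : 'I_n -> 'I_n') k : sb f 'X_k = 'X_(f k).
Proof. exact: evX. Qed.
Lemma sbC n n' (f : 'I_n -> 'I_n') c : sb f c%:MP = c%:MP.
Proof. exact: evC. Qed.
Lemma sb_eq n n' (f g : 'I_n -> 'I_n') : f =1 g -> sb f =1 sb g.
Proof. by move=> e; apply: ev_eq => k; rewrite e. Qed.
Lemma sb_comp n n' n'' (f : 'I_n -> 'I_n') (g : 'I_n' -> 'I_n'') p :
  sb g (sb f p) = sb (g \o f) p.
Proof. by rewrite /sb ev_comp; apply: ev_eq => k; rewrite evX. Qed.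
Lemma sb_id n (f : 'I_n -> 'I_n) p : f =1 id -> sb f p = p.
Proof. by move=> e; rewrite -[RHS]ev_id; apply: ev_eq => k; rewrite e. Qed.
Lemma ev_sb n n' n'' (f : 'I_n -> 'I_n') (th : 'I_n' -> {mpoly F[n'']}) p :
  ev th (sb f p) = ev (th \o f) p.
Proof. by rewrite /sb ev_comp; apply: ev_eq => k; rewrite evX. Qed.
Lemma sbK n (s : {perm 'I_n}) p : sb s^-1%g (sb s p) = p.
Proof. by rewrite sb_comp sb_id // => k /=; rewrite permK. Qed.
Lemma sb_perm_mul n (s t : {perm 'I_n}) p : sb s (sb t p) = sb (t * s)%g p.
Proof. by rewrite sb_comp; apply: sb_eq => k /=; rewrite permM. Qed.

Record ideal (R : comNzRingType) (J : R -> Prop) : Prop := Ideal {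
  ideal0 : J 0;
  idealD : forall x y, J x -> J y -> J (x + y);
  idealM : forall r x, J x -> J (r * x) }.

Section Ideal.
Variables (R : comNzRingType) (J : R -> Prop).
Hypothesis idJ : ideal J.
Lemma idealN x : J x -> J (- x).
Proof. by rewrite -mulN1r; apply: idealM. Qed.
Lemma idealB x y : J x -> J y -> J (x - y).
Proof. by move=> hx hy; apply: idealD => //; apply: idealN. Qed.
Lemma idealMr r x : J x -> J (x * r).
Proof. by rewrite mulrC; apply: idealM. Qed.
Lemma ideal_sum (K : Type) (s : seq K) (a : pred K) (f : K -> R) :
  (forall j, a j -> J (f j)) -> J (\sum_(j <- s | a j) f j).
Proof. by move=> H; elim/big_ind: _ => //; [exact: ideal0 | exact: idealD]. Qed.

Definition inv_mod x := exists y, J (x * y - 1).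
Lemma inv_mod1 : inv_mod 1.
Proof. by exists 1; rewrite mulr1 subrr; apply: ideal0. Qed.
Lemma inv_modM x y : inv_mod x -> inv_mod y -> inv_mod (x * y).
Proof.
move=> [x' hx] [y' hy]; exists (x' * y').
have -> : x * y * (x' * y') - 1 = (y * y') * (x * x' - 1) + (y * y' - 1) by ring.
by apply: idealD => //; apply: idealM.
Qed.
Lemma inv_modN x : inv_mod x -> inv_mod (- x).
Proof. by move=> [y hy]; exists (- y); rewrite mulrNN. Qed.
Lemma inv_mod_prod (K : Type) (s : seq K) (a : pred K) (f : K -> R) :
  (forall j, a j -> inv_mod (f j)) -> inv_mod (\prod_(j <- s | a j) f j).
Proof. by move=> H; elim/big_ind: _ => //; [exact: inv_mod1 | exact: inv_modM]. Qed.
Lemma inv_mod_congr x y : J (x - y) -> inv_mod x -> inv_mod y.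
Proof.
move=> hxy [z hz]; exists z.
have -> : y * z - 1 = (x * z - 1) - (x - y) * z by ring.
by apply: idealB => //; apply: idealMr.
Qed.
Lemma inv_mod_ideal x : inv_mod x -> J x -> J 1.
Proof.
move=> [y hy] hx; have -> : 1 = y * x - (x * y - 1) by ring.
by apply: idealB => //; apply: idealM.
Qed.
End Ideal.

Lemma ideal_dv (R : comNzRingType) (p : R) : ideal (dv p).
Proof. by split; [exact: dv0 | exact: dvD | move=> r x; exact: dv_mull]. Qed.

Lemma ev_congr n n' (J : {mpoly F[n']} -> Prop) (th th' : 'I_n -> {mpoly F[n']}) p :
  ideal J -> (forall k, J (th k - th' k)) -> J (ev th p - ev th' p).
Proof.
move=> idJ hth; elim/mpoly_gen_ind: p => [c|k|p q hp hq|p q hp hq].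
- by rewrite !evC subrr; apply: ideal0.
- by rewrite !evX.
- rewrite !rmorphD /=; set A := ev th p; set B := ev th q; set A' := ev th' p; set B' := ev th' q.
  have -> : A + B - (A' + B') = (A - A') + (B - B') by ring.
  exact: idealD.
- rewrite !rmorphM /=; set A := ev th p; set B := ev th q; set A' := ev th' p; set B' := ev th' q.
  have -> : A * B - (A' * B') = B * (A - A') + A' * (B - B') by ring.
  by apply: idealD => //; apply: idealM.
Qed.

(** * Linear forms X_a - X_b - c *)

Section LinearForms.
Variable n : nat.
Notation P := {mpoly F[n]}.

Definition lin (a b : 'I_n) (c : F) : P := 'X_a - 'X_b - c%:MP.

Definition lin_red (a b : 'I_n) (c : F) (k : 'I_n) : P :=
  if k == a then 'X_b + c%:MP else 'X_k.

(** Modulo X_a - X_b - c every polynomial is congruent to its restriction to the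
    hyperplane X_a = X_b + c, which involves X_a no longer. *)
Lemma lin_dvP a b c p : a != b -> dv (lin a b c) p <-> ev (lin_red a b c) p = 0.
Proof.
move=> neab; have red0 : ev (lin_red a b c) (lin a b c) = 0.
  rewrite !rmorphB /= !evX evC /lin_red eqxx eq_sym (negbTE neab).
  by ring.
split=> [[q ->]|e0]; first by rewrite rmorphM /= red0 mulr0.
rewrite -[p]subr0 -{1}e0 -[in X in X - _](ev_id p).
apply: ev_congr; first exact: ideal_dv.
move=> k; rewrite /lin_red; case: eqP => [->|_]; last by rewrite subrr; apply: dv0.
by exists 1; rewrite mul1r /lin opprD addrA.
Qed.

Lemma lin_prime a b c p q : a != b ->
  dv (lin a b c) (p * q) -> dv (lin a b c) p \/ dv (lin a b c) q.
Proof.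
move=> neab /(lin_dvP _ _ neab); rewrite rmorphM => /eqP; rewrite mulf_eq0.
by case/orP=> /eqP e0; [left | right]; apply/lin_dvP.
Qed.

Lemma meval_lin (v : 'I_n -> F) a b c : (lin a b c).@[v] = v a - v b - c.
Proof. by rewrite /lin !mevalB !mevalXU mevalC. Qed.

Lemma lin_neq0 a b c : a != b -> lin a b c != 0.
Proof.
move=> neab; apply/eqP => /(congr1 (meval (fun k => if k == a then c + 1 else 0))).
rewrite meval_lin meval0 eqxx eq_sym (negbTE neab) subr0 addrC addKr.
by move/eqP; rewrite oner_eq0.
Qed.

(** If one form divides another, then the second vanishes on the hyperplane of the
    first. Moving a variable that does not occur in the first form stays on the
    hyperplane, so the second form has the same two variables. *)
Lemma lin_assoc a b c a' b' c' : a != b -> a' != b' ->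
  dv (lin a b c) (lin a' b' c') ->
  (a' = a /\ b' = b /\ c' = c) \/ (a' = b /\ b' = a /\ c' = - c).
Proof.
move=> neab neab' [q eq].
have ev0 (v : 'I_n -> F) : v a - v b = c -> v a' - v b' = c'.
  move=> vab; have := congr1 (meval v) eq.
  rewrite mevalM !meval_lin vab subrr mulr0.
  by move/eqP; rewrite subr_eq0 => /eqP.
pose v0 k := if k == a then c else 0.
have e0 : v0 a' - v0 b' = c'.
  by apply: ev0; rewrite /v0 eqxx eq_sym (negbTE neab) subr0.
have in_ab k : (k == a') || (k == b') -> (k == a) || (k == b).
  move=> hk; apply/negPn/negP; rewrite negb_or => /andP[nka nkb].
  have := ev0 (fun j => v0 j + (j == k)%:R).
  rewrite [a == k]eq_sym [b == k]eq_sym (negbTE nka) (negbTE nkb) !addr0.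
  rewrite {1 2}/v0 eqxx [b == a]eq_sym (negbTE neab) subr0 => /(_ erefl).
  rewrite -e0; set x := v0 a'; set y := v0 b' => e.
  have {e} : (a' == k)%:R - (b' == k)%:R = 0 :> F.
    by rewrite -[RHS](subrr (x - y)) -{1}e; ring.
  case/orP: hk => /eqP ->; rewrite eqxx ?[b' == a']eq_sym (negbTE neab').
    by rewrite subr0 => /eqP; rewrite oner_eq0.
  by rewrite sub0r => /eqP; rewrite oppr_eq0 oner_eq0.
have ha := in_ab a'; have hb := in_ab b'; rewrite eqxx in ha; rewrite eqxx orbT in hb.
have {}ha := ha isT; have {}hb := hb isT; rewrite -e0 /v0.
case/orP: ha => /eqP ea; case/orP: hb => /eqP eb; rewrite ea eb ?eqxx.
- by rewrite ea eb eqxx in neab'.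
- by left; rewrite eq_sym (negbTE neab) subr0.
- by right; rewrite eq_sym (negbTE neab) sub0r.
- by rewrite ea eb eqxx in neab'.
Qed.

Definition fprod (Ph : 'I_n -> 'I_n -> F -> Prop) (p : P) : Prop :=
  exists l : seq ('I_n * 'I_n * F),
    (forall x, x \in l -> Ph x.1.1 x.1.2 x.2) /\ p = \prod_(x <- l) lin x.1.1 x.1.2 x.2.

Lemma fprod1 Ph : fprod Ph 1.
Proof. by exists [::]; rewrite big_nil. Qed.

Lemma fprod_lin (Ph : 'I_n -> 'I_n -> F -> Prop) a b c : Ph a b c -> fprod Ph (lin a b c).
Proof.
by move=> h; exists [:: (a, b, c)]; rewrite big_seq1; split=> // x; rewrite inE => /eqP ->.
Qed.

Lemma fprodM Ph p q : fprod Ph p -> fprod Ph q -> fprod Ph (p * q).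
Proof.
move=> [l [hl ->]] [l' [hl' ->]]; exists (l ++ l'); rewrite big_cat; split=> // x.
by rewrite mem_cat => /orP[/hl|/hl'].
Qed.

Lemma fprodX Ph p e : (e != 0%N -> fprod Ph p) -> fprod Ph (p ^+ e).
Proof.
case: e => [_|e /(_ isT) h]; first by rewrite expr0; apply: fprod1.
by elim: e => [|e IH]; rewrite exprS ?expr0 ?mulr1 //; apply: fprodM.
Qed.

Lemma fprod_prod Ph (K : eqType) (s : seq K) (a : pred K) (f : K -> P) :
  (forall j, j \in s -> a j -> fprod Ph (f j)) -> fprod Ph (\prod_(j <- s | a j) f j).
Proof.
move=> H; rewrite big_seq_cond; elim/big_ind: _ => [|p q|j /andP[]].
- exact: fprod1.
- exact: fprodM.
- exact: H.
Qed.

Lemma fprod_sub (Ph Ps : 'I_n -> 'I_n -> F -> Prop) p :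
  (forall a b c, Ph a b c -> Ps a b c) -> fprod Ph p -> fprod Ps p.
Proof. by move=> H [l [hl ->]]; exists l; split=> // x /hl; apply: H. Qed.

Lemma lin_dv_fprod Ph a b c M : a != b -> fprod Ph M -> dv (lin a b c) M ->
  exists a' b' c', Ph a' b' c' /\ dv (lin a b c) (lin a' b' c').
Proof.
move=> neab [l [hl ->]]; elim: l hl => [|x l IH] hl.
  rewrite big_nil => -[q eq1]; exfalso.
  have /(lin_dvP c 1 neab) : dv (lin a b c) 1 by exists q.
  by rewrite rmorph1 => /eqP; rewrite oner_eq0.
rewrite big_cons => /(lin_prime neab) [h|h].
  by exists x.1.1, x.1.2, x.2; split=> //; apply: hl; rewrite mem_head.
by apply: IH => // y hy; apply: hl; rewrite inE hy orbT.
Qed.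

(** Linear forms are prime, so a product of linear forms can be cancelled
    against a product of other, non-proportional, linear forms. *)
Lemma fprod_cancel (Ph Ps : 'I_n -> 'I_n -> F -> Prop) D M x :
  fprod Ph D -> fprod Ps M ->
  (forall a b c, Ph a b c -> a != b) ->
  (forall a b c a' b' c', Ph a b c -> Ps a' b' c' -> ~ dv (lin a b c) (lin a' b' c')) ->
  dv D (M * x) -> dv D x.
Proof.
move=> [l [hl ->]] hM neab ndv; elim: l hl x => [|y l IH] hl x.
  by rewrite big_nil => _; apply: dv1.
have hy : Ph y.1.1 y.1.2 y.2 by apply: hl; rewrite mem_head.
have ney := neab _ _ _ hy.
rewrite big_cons; set ly := lin _ _ _ => -[q eq].
have [hdv|[x' ex]] : dv ly M \/ dv ly x.
- by apply: lin_prime => //; rewrite eq; apply/dv_mull/dv_mulr/dv_refl.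
- have [a' [b' [c' [hps hdv']]]] := lin_dv_fprod ney hM hdv.
  by case: (ndv _ _ _ _ _ _ hy hps).
have {}IH := IH _ x'; rewrite ex [ly * _]mulrC; apply: dvM; last exact: dv_refl.
apply: IH; first by move=> z hz; apply: hl; rewrite inE hz orbT.
exists q; apply: (mulIf (lin_neq0 y.2 ney)).
by rewrite -mulrA -ex eq -/ly mulrA mulrAC.
Qed.

(** Non-proportional linear forms are coprime, so divisibility by each power
    separately gives divisibility by their product. *)
Lemma dv_prod_lin (l : seq ('I_n * 'I_n * F)) e p :
  (forall x, x \in l -> x.1.1 != x.1.2) ->
  pairwise (fun x y => ~~ [|| y == x | y == (x.1.2, x.1.1, - x.2)]) l ->
  (forall x, x \in l -> dv (lin x.1.1 x.1.2 x.2 ^+ e) p) ->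
  dv (\prod_(x <- l) lin x.1.1 x.1.2 x.2 ^+ e) p.
Proof.
elim: l p => [|x l IH] p ne; first by rewrite big_nil => *; apply: dv1.
rewrite /= => /andP[hx hl] hd; have nex : x.1.1 != x.1.2 by apply: ne; rewrite mem_head.
have [q ep] := hd x (mem_head _ _); subst p; rewrite big_cons mulrC; apply: dvM; last exact: dv_refl.
apply: IH => // y yl; first by apply: ne; rewrite inE yl orbT.
have ney : y.1.1 != y.1.2 by apply: ne; rewrite inE yl orbT.
have : dv (lin y.1.1 y.1.2 y.2 ^+ e) (lin x.1.1 x.1.2 x.2 ^+ e * q).
  by rewrite mulrC; apply: hd; rewrite inE yl orbT.
apply: (fprod_cancel (Ph := fun a b c => (a, b, c) = y) (Ps := fun a b c => (a, b, c) = x)).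
- by apply: fprodX => _; apply: fprod_lin; case: (y) => -[].
- by apply: fprodX => _; apply: fprod_lin; case: (x) => -[].
- by move=> a b c ey; move: ney; rewrite -ey.
move=> a b c a' b' c' ey ex; move: (allP hx y yl) ney nex; rewrite -ey -ex /= => nyx ney nex /lin_assoc.
case/(_ ney nex) => -[ea [eb ec]]; case/negP: nyx; subst; rewrite ?eqxx //.
by rewrite opprK eqxx orbT.
Qed.

End LinearForms.
End Evaluation.

(** * Symmetrization over the permutations preserving a labelling *)

Section Symmetrization.
Variables (F : fieldType) (n : nat) (V : eqType) (pt : 'I_n -> V).
Notation P := {mpoly F[n]}.
Implicit Types (B : seq 'I_n) (s t : {perm 'I_n}).

Definition inW B s : bool :=
  [forall a, pt (s a) == pt a] && [forall a, (a \notin B) ==> (s a == a)].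

Lemma inWP B s : reflect ((forall a, pt (s a) = pt a) /\ (forall a, a \notin B -> s a = a))
  (inW B s).
Proof.
apply: (iffP andP) => [[/forallP h1 /forallP h2]|[h1 h2]]; split.
- by move=> a; apply/eqP.
- by move=> a; have /implyP h := h2 a; move/h/eqP.
- by apply/forallP => a; apply/eqP.
- by apply/forallP => a; apply/implyP => /h2 ->.
Qed.

Lemma inW1 B : inW B 1%g.
Proof. by apply/inWP; split=> a; rewrite perm1. Qed.

Lemma inWM B s t : inW B s -> inW B t -> inW B (s * t)%g.
Proof.
move=> /inWP[h1 h2] /inWP[h3 h4]; apply/inWP; split=> a; rewrite permM; first by rewrite h3.
by move=> ha; rewrite h2 ?h4.
Qed.

Lemma inWV B s : inW B s -> inW B s^-1%g.
Proof.
move=> /inWP[h1 h2]; apply/inWP; split=> a; first by rewrite -{2}[a](permKV s) h1.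
by move=> /h2 e; rewrite -{1}e permK.
Qed.

Lemma inWMr B s t : inW B t -> inW B (s * t)%g = inW B s.
Proof.
move=> ht; apply/idP/idP => [h|h]; last exact: inWM.
by rewrite -[s](mulgK t); apply: inWM => //; apply: inWV.
Qed.

Lemma inWMl B s t : inW B s -> inW B (s * t)%g = inW B t.
Proof.
move=> hs; apply/idP/idP => [h|h]; last exact: inWM.
by rewrite -[t](mulKg s); apply: inWM => //; apply: inWV.
Qed.

Lemma inW_tperm B a b : a \in B -> b \in B -> pt a = pt b -> inW B (tperm a b).
Proof.
move=> ha hb e; apply/inWP; split=> c; first by case: tpermP => // ->.
by move=> hc; rewrite tpermD //; apply: contraNneq hc => <-.
Qed.

Lemma inW_sub B B' s : {subset B <= B'} -> inW B s -> inW B' s.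
Proof.
move=> h /inWP[h1 h2]; apply/inWP; split=> // a ha; apply: h2.
by apply: contra ha; apply: h.
Qed.

Lemma inW_mem B s a : inW B s -> (s a \in B) = (a \in B).
Proof.
move=> /inWP[_ h]; apply/idP/idP => ha.
  by apply: contraLR ha => ha; rewrite h.
apply: contraLR ha => ha; have /perm_inj e := h _ ha.
by rewrite -e.
Qed.

Lemma inW_map B s : uniq B -> inW B s -> perm_eq (map s B) B.
Proof.
move=> uB hs; apply: uniq_perm => //; first by rewrite map_inj_uniq //; apply: perm_inj.
move=> b; rewrite -[b](permKV s) mem_map; last exact: perm_inj.
by rewrite (inW_mem _ hs).
Qed.

Definition Sym B (x : P) : P := \sum_(s : {perm 'I_n} | inW B s) sb s x.

Lemma SymD B x y : Sym B (x + y) = Sym B x + Sym B y.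
Proof. by rewrite /Sym -big_split; apply: eq_bigr => s _; rewrite /= rmorphD. Qed.
Lemma Sym0 B : Sym B 0 = 0.
Proof. by rewrite /Sym big1 // => s _; rewrite rmorph0. Qed.
Lemma Sym_sum B (K : Type) (r : seq K) (f : K -> P) :
  Sym B (\sum_(k <- r) f k) = \sum_(k <- r) Sym B (f k).
Proof. by elim/big_rec2: _ => [|k a b _ <-]; [exact: Sym0 | rewrite SymD]. Qed.

Lemma sb_Sym B s x : inW B s -> sb s (Sym B x) = Sym B x.
Proof.
move=> hs; rewrite /Sym rmorph_sum [RHS](reindex_inj (mulIg s)) /=.
by apply: eq_big => [t|t _]; rewrite ?inWMr // sb_perm_mul.
Qed.

Lemma Sym_sb B s x : inW B s -> Sym B (sb s x) = Sym B x.
Proof.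
move=> hs; rewrite /Sym [RHS](reindex_inj (mulgI s)) /=.
by apply: eq_big => [t|t _]; rewrite ?inWMl // sb_perm_mul.
Qed.

Lemma SymM B x y : (forall s, inW B s -> sb s y = y) -> Sym B (y * x) = y * Sym B x.
Proof.
by move=> h; rewrite /Sym mulr_sumr; apply: eq_bigr => s hs; rewrite rmorphM /= h.
Qed.

Lemma Sym_inv B y : (forall s, inW B s -> sb s y = y) ->
  Sym B y = #|[pred s | inW B s]|%:R * y.
Proof.
move=> h; rewrite /Sym (eq_bigr (fun=> y)); last exact: h.
by rewrite sumr_const mulr_natl.
Qed.

Lemma inW_card_gt0 B : (0 < #|[pred s | inW B s]|)%N.
Proof. by apply/card_gt0P; exists 1%g; rewrite inE inW1. Qed.

(** Each pair occurs in both orders, so this is the discriminant up to sign; unlike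
    the Vandermonde product it is invariant. *)
Definition Delta B : P :=
  \prod_(a <- B) \prod_(b <- B | (b != a) && (pt b == pt a)) ('X_a - 'X_b).

Lemma prod2_inW (B : seq 'I_n) (c : rel 'I_n) (z : 'I_n -> 'I_n -> P) s :
  uniq B -> inW B s -> (forall a b, c (s a) (s b) = c a b) ->
  (forall a b, sb s (z a b) = z (s a) (s b)) ->
  sb s (\prod_(a <- B) \prod_(b <- B | c a b) z a b) =
  \prod_(a <- B) \prod_(b <- B | c a b) z a b.
Proof.
move=> uB hs hc hz; have hB := inW_map uB hs.
transitivity (\prod_(a <- map s B) \prod_(b <- map s B | c a b) z a b); last first.
  by rewrite (perm_big _ hB); apply: eq_bigr => a _; apply: perm_big.
rewrite big_map rmorph_prod; apply: eq_bigr => a _ /=.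
rewrite big_map rmorph_prod; apply: eq_big => [b|b _] /=; first by rewrite hc.
exact: hz.
Qed.

Lemma Delta_perm B B' : perm_eq B B' -> Delta B = Delta B'.
Proof. by move=> h; rewrite /Delta (perm_big _ h); apply: eq_bigr => a _; apply: perm_big. Qed.

Lemma sb_Delta B s : uniq B -> inW B s -> sb s (Delta B) = Delta B.
Proof.
move=> uB hs; apply: (prod2_inW (z := fun a b => 'X_a - 'X_b)) => // a b.
  by have /inWP[h _] := hs; rewrite (inj_eq perm_inj) !h.
by rewrite rmorphB /= !sbX.
Qed.

Lemma linE a b : 'X_a - 'X_b = lin a b 0 :> P.
Proof. by rewrite /lin mpolyC0 subr0. Qed.

Lemma Delta_neq0 B : Delta B != 0.
Proof.
rewrite /Delta prodf_seq_neq0; apply/allP => a _ /=.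
rewrite prodf_seq_neq0; apply/allP => b _; apply/implyP => /andP[ne _].
by rewrite linE lin_neq0 // eq_sym.
Qed.

Lemma Delta_dv_squares B :
  dv (Delta B) (\prod_(a <- B) \prod_(b <- B | (a < b)%N && (pt b == pt a)) lin a b 0 ^+ 2).
Proof.
have -> : Delta B = \prod_(a <- B) \prod_(b <- B | (a < b)%N && (pt b == pt a))
    (('X_a - 'X_b) * ('X_b - 'X_a)).
  under [RHS]eq_bigr => a _ do rewrite big_split.
  rewrite big_split /= [X in _ * X](exchange_big_dep xpredT) //= -big_split.
  apply: eq_bigr => a _ /=.
  rewrite (bigID (fun b : 'I_n => (a < b)%N)) /=; congr (_ * _); apply: eq_bigl => b.
    by rewrite andbAC -(inj_eq val_inj) /=; case: ltngtP.
  by rewrite [pt a == _]eq_sym -(inj_eq val_inj) /=; case: ltngtP => _; rewrite ?andbF ?andbT.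
apply: dv_prod => a _; apply: dv_prod => b _; exists (- 1); rewrite -linE expr2; ring.
Qed.

(** If X_a - X_b divides a symmetrization, then the quotient changes sign under the
    transposition of a and b, so it vanishes at X_a = X_b and X_a - X_b divides the
    symmetrization twice. *)
Lemma Delta_dv_Sym B x : 2%:R != 0 :> F -> uniq B ->
  (forall a b, a \in B -> b \in B -> a != b -> pt a = pt b -> dv (lin a b 0) x) ->
  dv (Delta B) (Sym B x).
Proof.
move=> two uB hx; apply: dv_trans (Delta_dv_squares B) _.
pose r := [seq y : 'I_n * 'I_n <- [seq (a, b) | a <- B, b <- B] | (y.1 < y.2)%N && (pt y.2 == pt y.1)].
pose l := [seq (ab, 0 : F) | ab <- r].
have -> : \prod_(a <- B) \prod_(b <- B | (a < b)%N && (pt b == pt a)) lin a b 0 ^+ 2 =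
          \prod_(y <- l) lin y.1.1 y.1.2 y.2 ^+ 2 :> P.
  rewrite /l big_map /r big_filter [RHS]big_mkcond /= big_allpairs.
  by apply: eq_bigr => a _; rewrite -big_mkcond.
have lP ab : ab \in l ->
    exists a b, [/\ ab = (a, b, 0), a \in B, b \in B, (a < b)%N & pt a = pt b].
  move=> /mapP[[a b] + ->]; rewrite mem_filter /= => /andP[/andP[lt /eqP e]].
  case/allpairsP => -[a' b'] /= [ha hb [? ?]]; subst; exists a', b'; split=> //.
have ult (a b : 'I_n) : (a < b)%N -> a != b by rewrite -(inj_eq val_inj) /= => /ltn_eqF ->.
apply: dv_prod_lin.
- by move=> y /lP[a [b [-> _ _ lt _]]] /=; apply: ult.
- have ul : uniq l.
    rewrite map_inj_uniq; last by move=> ? ? [].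
    by apply: filter_uniq; apply: allpairs_uniq => // -[a b] [a' b'] _ _ [-> ->].
  move: ul; rewrite uniq_pairwise; apply: (@sub_in_pairwise _ (mem l)); last exact/allP.
  move=> y y' /lP[a [b [-> _ _ lt _]]] /lP[a' [b' [-> _ _ lt' _]]] /=.
  rewrite eq_sym => /negbTE ->; apply/eqP => -[? ?]; subst.
  by move: (ltn_trans lt lt'); rewrite ltnn.
move=> y /lP[a [b [-> ha hb lt e]]] /=.
have neab := ult _ _ lt; have hW := inW_tperm ha hb e.
have hall s : inW B s -> dv (lin a b 0) (sb s x).
  move=> hs; have /inWP[hpt _] := inWV hs.
  have := hx (s^-1%g a) (s^-1%g b); rewrite !(inW_mem _ (inWV hs)) (inj_eq perm_inj) !hpt.
  move=> /(_ ha hb neab e) /(dv_rmorph (sb s)) /=.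
  by rewrite -linE rmorphB /= !sbX !permKV linE.
have [q eq] : dv (lin a b 0) (Sym B x) by apply: dv_sum.
have nz := lin_neq0 (0 : F) neab.
have eqq : q = - sb (tperm a b) q.
  apply: (mulIf nz); rewrite -eq -(sb_Sym x hW) eq rmorphM mulNr -mulrN /=; congr (_ * _).
  by rewrite -linE rmorphB /= !sbX tpermL tpermR opprB.
have : dv (lin a b 0) q.
  apply/(lin_dvP _ _ neab); set g := lin_red a b 0.
  have eg : ev g (sb (tperm a b) q) = ev g q.
    rewrite ev_sb; apply: ev_eq => k /=; rewrite /g /lin_red mpolyC0 addr0.
    case: tpermP => [->|->|/eqP nka /eqP nkb].
    - by rewrite eqxx [b == a]eq_sym (negbTE neab).
    - by rewrite eqxx [b == a]eq_sym (negbTE neab).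
    - by rewrite (negbTE nka).
  have /eqP := congr1 (ev g) eqq; rewrite rmorphN /= eg -addr_eq0 -mulr2n -mulr_natl mulf_eq0.
  rewrite -(rmorph_nat (@mpolyC n F)) mpolyC_eq0 (negbTE two) /=.
  by move/eqP.
by move=> [q' eq']; exists q'; rewrite eq eq' expr2 mulrA.
Qed.

Definition ordprod (z : 'I_n -> 'I_n -> P) (bf : rel 'I_n) B : P :=
  \prod_(a <- B) \prod_(b <- B | bf a b) z a b.

Definition before (w : seq 'I_n) : rel 'I_n := fun a b => (index a w < index b w)%N.

Lemma ordprod_perm z bf B B' : perm_eq B B' -> ordprod z bf B = ordprod z bf B'.
Proof. by move=> h; rewrite /ordprod (perm_big _ h); apply: eq_bigr => a _; apply: perm_big. Qed.

Lemma before_map w s a b : before (map s w) (s a) (s b) = before w a b.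
Proof. by rewrite /before !index_map //; apply: perm_inj. Qed.

Lemma sb_ordprod z w B s : (forall s a b, inW B s -> sb s (z a b) = z (s a) (s b)) ->
  uniq B -> inW B s -> sb s (ordprod z (before w) B) = ordprod z (before (map s w)) B.
Proof.
move=> hz uB hs; rewrite -[in RHS](ordprod_perm _ _ (inW_map uB hs)) /ordprod big_map rmorph_prod.
apply: eq_bigr => a _; rewrite big_map rmorph_prod /=.
by apply: eq_big => [b|b _]; rewrite ?before_map ?hz.
Qed.

(** The span, in one dimension vector, of the shuffle products of powers of single
    variables. Such a product is the symmetrization of a polynomial times the kernel
    over the pairs in the order of the factors, and Delta clears its denominators. *)
Definition in_span z B (E : P) : Prop :=
  exists L : seq (seq 'I_n * P), (forall x, x \in L -> perm_eq x.1 B) /\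
    Delta B * E = \sum_(x <- L) Sym B (x.2 * ordprod z (before x.1) B).

Lemma in_span0 z B : in_span z B 0.
Proof. by exists [::]; rewrite big_nil mulr0. Qed.

Lemma in_spanD z B E E' : in_span z B E -> in_span z B E' -> in_span z B (E + E').
Proof.
move=> [L [hL eL]] [L' [hL' eL']]; exists (L ++ L'); split=> [x|].
  by rewrite mem_cat => /orP[/hL|/hL'].
by rewrite mulrDr eL eL' big_cat.
Qed.

Lemma in_span_sum z B (K : eqType) (r : seq K) (f : K -> P) :
  (forall k, k \in r -> in_span z B (f k)) -> in_span z B (\sum_(k <- r) f k).
Proof.
elim: r => [|k r IH] h; first by rewrite big_nil; apply: in_span0.
rewrite big_cons; apply: in_spanD; first by apply: h; rewrite mem_head.
by apply: IH => j hj; apply: h; rewrite inE hj orbT.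
Qed.

Lemma in_spanM z B E y : (forall s, inW B s -> sb s y = y) -> in_span z B E -> in_span z B (y * E).
Proof.
move=> hy [L [hL eL]]; exists [seq (x.1, y * x.2) | x <- L]; split=> [x|].
  by move=> /mapP[x' hx' ->]; apply: (hL x').
rewrite mulrCA eL mulr_sumr big_map; apply: eq_bigr => x _ /=.
by rewrite -(SymM _ hy) mulrA.
Qed.

Lemma in_spanZ z B E c : in_span z B E -> in_span z B (c *: E).
Proof. by rewrite -mul_mpolyC; apply: in_spanM => s _; rewrite sbC. Qed.

End Symmetrization.

(** * Strings and the local shuffle kernel *)

Section LocalKernel.
Variables (F : fieldType) (n : nat) (V L : eqType) (pt : 'I_n -> V) (ln : V -> L).
Variables (dn : rel V) (ar : V -> V -> nat) (rk : V -> nat).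
Notation P := {mpoly F[n]}.

(** Combinatorics of the shuffle kernel near a point. A value v in V is a colour
    together with a coordinate; dn v w means that w has the colour of v and the
    coordinate of v minus hbar; ar v w is the number of arrow factors of the kernel
    from v to w that vanish; ln v is the class of v modulo integer multiples of
    hbar; rk decreases along dn and increases along arrows. The mesh relation holds
    since an arrow of weight c from v to w is the opposite of one of weight
    hbar - c from w to v + hbar. *)
Record local_structure : Prop := LocalStructure {
  dn_fun : forall v w w', dn v w -> dn v w' -> w = w';
  dn_rk : forall v w, dn v w -> (rk w < rk v)%N;
  dn_ln : forall v w, dn v w -> ln v = ln w;
  ar_rk : forall v w, ar v w != 0%N -> (rk v < rk w)%N;
  ar_ln : forall v w, ar v w != 0%N -> ln v != ln w;
  mesh : forall v' v w, dn v' v -> ar v w = ar w v' }.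

Hypothesis ls : local_structure.

Definition dn_var : rel 'I_n := fun a b => dn (pt a) (pt b).

(** The part of lowest degree of the kernel at the point, up to a unit. Its
    denominator X_a - X_b is cancelled against a factor of Delta, which leaves
    X_b - X_a. *)
Definition local_kernel (a b : 'I_n) : P :=
  ('X_a - 'X_b) ^+ (ar (pt a) (pt b) + dn (pt a) (pt b)) *
  (if pt a == pt b then 'X_b - 'X_a else 1).

(** Each string lists its variables downwards, and to_head sends all of them to the
    first one. *)
Fixpoint to_head (S : seq (seq 'I_n)) (a : 'I_n) : 'I_n :=
  if S is s :: S' then (if a \in s then head a s else to_head S' a) else a.

Definition head_div (t : 'I_n) (s R : seq 'I_n) : P :=
  \prod_(b <- R) ('X_t - 'X_b) ^+ (\sum_(a <- s) ar (pt a) (pt b)).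

(** Arrows increase the rank, and no variable of a later string has a higher rank than
    the head of an earlier one. So the head itself contributes nothing to its factor,
    and the exponents count the arrows from the tail. *)
Fixpoint strings_div (S : seq (seq 'I_n)) : P :=
  if S is s :: S' then
    (if s is t :: _ then sb (to_head S') (head_div t s (flatten S')) else 1) * strings_div S'
  else 1.

Fixpoint ok_strings (S : seq (seq 'I_n)) : bool :=
  if S is s :: S' then
    (if s is t :: s' then
       path dn_var t s' && all (fun b => (rk (pt b) <= rk (pt t))%N) (flatten S')
     else false) && ok_strings S'
  else true.

Definition string_cond B (E : P) : Prop :=
  forall S, ok_strings S -> perm_eq (flatten S) B -> dv (strings_div S) (sb (to_head S) E).

Lemma string_rk t s : path dn_var t s -> sorted (fun a b => (rk (pt b) < rk (pt a))%N) (t :: s).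
Proof. by apply: sub_path => a b; apply: (dn_rk ls). Qed.

Lemma string_uniq_pt t s : path dn_var t s -> uniq (map pt (t :: s)).
Proof.
move=> h; apply: (@sorted_uniq _ (fun v w => (rk w < rk v)%N)).
- by move=> a b c h1 h2; apply: ltn_trans h2 h1.
- by move=> v; rewrite ltnn.
- by rewrite sorted_map; apply: string_rk.
Qed.

Lemma string_uniq t s : path dn_var t s -> uniq (t :: s).
Proof. by move/string_uniq_pt/map_uniq. Qed.

Lemma string_pt_inj t s a b : path dn_var t s -> a \in t :: s -> b \in t :: s ->
  pt a = pt b -> a = b.
Proof.
move=> /string_uniq_pt; elim: (t :: s) => [//|c r IH] /= /andP[hc u].
rewrite !inE => /orP[/eqP->|ha] /orP[/eqP->|hb] // e; last exact: IH.
- by move: hc; rewrite e map_f.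
- by move: hc; rewrite -e map_f.
Qed.

Lemma string_ln t s a : path dn_var t s -> a \in t :: s -> ln (pt a) = ln (pt t).
Proof.
elim: s t => [|b s IH] t /=; first by rewrite inE => _ /eqP ->.
move=> /andP[h /IH {}IH]; rewrite inE => /orP[/eqP -> //|/IH ->].
by rewrite (dn_ln ls h).
Qed.

Lemma to_head_out S a : a \notin flatten S -> to_head S a = a.
Proof.
elim: S => //= s S IH; rewrite mem_cat negb_or => /andP[/negbTE -> ]; exact: IH.
Qed.

Lemma to_head_mem S a : a \in flatten S -> to_head S a \in flatten S.
Proof.
elim: S => //= s S IH; rewrite !mem_cat; case: ifP => [|_ /= /IH ->]; last by rewrite orbT.
by case: s => //= t s _ _; rewrite mem_head.
Qed.

Lemma to_head_ln S a : ok_strings S -> ln (pt (to_head S a)) = ln (pt a).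
Proof.
elim: S => //= s S IH /andP[hs /IH {}IH]; case: ifP => // ha.
by case: s hs ha => // t s /andP[hp _] ha /=; rewrite (string_ln hp ha).
Qed.

Lemma to_head_inj_pt S a b : ok_strings S -> uniq (flatten S) ->
  pt a = pt b -> to_head S a = to_head S b -> a = b.
Proof.
elim: S => //= s S IH /andP[hs hS]; rewrite cat_uniq => /and3P[_ hd uS] e.
have out c : c \in s -> c \notin flatten S.
  by move=> hc; apply: contra hd => hc'; apply/hasP; exists c.
have hh c : c \in s -> head c s \in s by case: (s) => //= *; rewrite mem_head.
have gs c : c \notin s -> to_head S c \notin s.
  case hc: (c \in flatten S) => hcs; last by rewrite to_head_out ?hc.
  by apply/negP => /out; rewrite to_head_mem.
case: ifP => ha; case: ifP => hb.
- case: s hs ha hb {IH hd out hh gs} => // t s /andP[hp _] ha hb _.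
  exact: string_pt_inj hp ha hb e.
- by move=> e'; have := gs b (negbT hb); rewrite -e' hh.
- by move=> e'; have := gs a (negbT ha); rewrite e' hh.
- exact: IH.
Qed.

Lemma to_head_cons s S a : uniq (flatten (s :: S)) -> to_head (s :: S) a = to_head S (to_head [:: s] a).
Proof.
rewrite /= cat_uniq => /and3P[_ hd _]; case: ifP => // ha.
rewrite to_head_out //; apply: contra hd => h; apply/hasP; exists (head a s) => //.
by case: (s) ha => //= *; rewrite mem_head.
Qed.

Lemma sb_to_head_cons s S (x : P) : uniq (flatten (s :: S)) ->
  sb (to_head (s :: S)) x = sb (to_head S) (sb (to_head [:: s]) x).
Proof. by move=> u; rewrite sb_comp; apply: sb_eq => a /=; rewrite -to_head_cons. Qed.

Lemma to_head1_out s a : a \notin s -> to_head [:: s] a = a.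
Proof. by move=> /= /negbTE ->. Qed.
Lemma to_head1_in t s a : a \in t :: s -> to_head [:: t :: s] a = t.
Proof. by move=> /= ->. Qed.
Lemma to_head_hd t s S a : a \in t :: s -> to_head ((t :: s) :: S) a = t.
Proof. by move=> /= ->. Qed.
Arguments to_head : simpl never.

Definition Phi (T : seq 'I_n) (a b : 'I_n) (c : F) : Prop :=
  [/\ a \in T, b \in T, ln (pt a) != ln (pt b) & c = 0].
Definition Psi (a b : 'I_n) (c : F) : Prop := [/\ a != b, ln (pt a) = ln (pt b) & c = 0].

Lemma Phi_ne T a b c : Phi T a b c -> a != b.
Proof. by case=> _ _ h _; apply: contraNneq h => ->. Qed.

Lemma Phi_Psi T a b c a' b' c' : Phi T a b c -> Psi a' b' c' ->
  ~ dv (lin a b c) (lin a' b' c').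
Proof.
move=> h1 [ne e _] /lin_assoc -/(_ (Phi_ne h1) ne); case: h1 => _ _ /eqP h _.
by case=> -[ea [eb _]]; subst; apply: h.
Qed.

Lemma ar_sum_ln t s b : path dn_var t s -> (\sum_(a <- t :: s) ar (pt a) (pt b))%N != 0%N ->
  ln (pt t) != ln (pt b).
Proof.
move=> hp; rewrite sum_nat_seq_neq0 => /hasP[a ha /= h].
by rewrite -(string_ln hp ha); apply: (ar_ln ls).
Qed.

Lemma fprod_strings_div S : ok_strings S -> uniq (flatten S) -> fprod (Phi (flatten S)) (strings_div S).
Proof.
elim: S => [|s S IH] /=; first by move=> *; apply: fprod1.
move=> /andP[hs /[dup] hS /IH {}IH]; rewrite cat_uniq => /and3P[us hd /[dup] uS /IH {}IH].
apply: fprodM; last first.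
  by apply: fprod_sub IH => a b c [ha hb h1 h2]; split=> //; rewrite mem_cat ?ha ?hb orbT.
case: s hs us hd => // t s /andP[hp _] us hd; rewrite rmorph_prod.
apply: fprod_prod => b hb _; rewrite rmorphXn; apply: fprodX => h.
rewrite rmorphB /= !sbX linE; apply: fprod_lin; split=> //.
- rewrite to_head_out ?mem_head //; apply: contra hd => h'; apply/hasP; exists t => //.
  by rewrite mem_head.
- by rewrite -cat_cons mem_cat to_head_mem ?orbT.
- by rewrite !to_head_ln //; apply: (ar_sum_ln hp h).
Qed.

Lemma ordprod_cat (z : 'I_n -> 'I_n -> P) bf s R :
  ordprod z bf (s ++ R) = ordprod z bf s * ordprod z bf R *
  \prod_(b <- R) ((\prod_(a <- s | bf a b) z a b) * (\prod_(a <- s | bf b a) z b a)).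
Proof.
rewrite {1}/ordprod big_cat /=.
under eq_bigr => a _ do rewrite big_cat /=.
under [X in _ * X]eq_bigr => a _ do rewrite big_cat /=.
rewrite !big_split /= -/(ordprod z bf s) -/(ordprod z bf R).
rewrite [X in _ * X * _ = _](exchange_big_dep xpredT) //=.
by set A := ordprod _ _ s; set B := ordprod _ _ R; ring.
Qed.

Lemma ordprod_zero (bf : rel 'I_n) (B : seq 'I_n) (g : 'I_n -> 'I_n) a b : a \in B -> b \in B -> bf a b -> dn_var a b ->
  g a = g b -> sb g (ordprod local_kernel bf B) = 0.
Proof.
move=> ha hb hbf hd e; rewrite /ordprod (big_rem _ ha) /= (big_rem _ hb) /= hbf.
rewrite /local_kernel; move: (hd); rewrite /dn_var => ->; rewrite addn1 exprS.
by rewrite !rmorphM /= rmorphB /= !sbX e subrr !mul0r.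
Qed.

(** Suppose that the order lists the string upwards. An element a that comes after b
    contributes ar b a, and by the mesh relation this is the contribution ar a' b of
    the element a' under a. So the count over the whole string is at least the
    arrow count of its tail. *)
Lemma chain_count (bf : rel 'I_n) t s b : transitive bf ->
  path (fun a a' => dn_var a a' && bf a' a) t s ->
  (\sum_(a <- s) ar (pt a) (pt b) <=
   \sum_(a <- t :: s) (if bf a b then ar (pt a) (pt b) else ar (pt b) (pt a)))%N.
Proof.
move=> tr; elim: s t => [|a' s IH] t; first by rewrite big_nil.
move=> /= /andP[/andP[hd hb] hp]; case tb: (bf t b); last first.
  rewrite big_cons [X in (_ <= X)%N]big_cons tb (mesh ls _ hd).
  by rewrite leq_add2l; apply: IH.
rewrite [X in (_ <= X)%N]big_cons; apply: leq_trans (leq_addl _ _).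
have : path (fun a a' => bf a' a) t (a' :: s).
  by rewrite /= hb; apply: sub_path hp => x y /andP[].
have tr' : transitive (fun a a' => bf a' a) by move=> x y z h1 h2; apply: tr h2 h1.
move/(order_path_min tr')/allP => hall; rewrite !big_seq.
by apply: leq_sum => a ha; rewrite (tr _ _ _ (hall a ha) tb).
Qed.

(** If the order does not list some string upwards, then a factor of dn makes the
    ordered product vanish on gluing; otherwise chain_count gives the divisor, one
    string at a time. *)
Lemma ordprod_dv (bf : rel 'I_n) S : transitive bf ->
  ok_strings S -> uniq (flatten S) -> (forall a b, a \in flatten S -> b \in flatten S ->
     a != b -> bf a b = ~~ bf b a) ->
  sb (to_head S) (ordprod local_kernel bf (flatten S)) = 0 \/ dv (strings_div S) (sb (to_head S) (ordprod local_kernel bf (flatten S))).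
Proof.
move=> tr; elim: S => [|s S IH] hS uS tot; first by right; apply: dv1.
case: s hS uS tot => [//|t s]; rewrite [ok_strings _]/= -andbA => /and3P[hp hall hS] uS tot.
have := uS; rewrite [flatten _]/= -cat_cons cat_uniq => /and3P[us hd uS'].
have out a : a \in flatten S -> a \notin t :: s.
  by move=> h; apply: contra hd => h'; apply/hasP; exists a.
case inc: (path (fun a a' => dn_var a a' && bf a' a) t s); last first.
  left; suff [a [a' [ha ha' hda hba]]] :
      exists a a', [/\ a \in t :: s, a' \in t :: s, dn_var a a' & bf a a'].
    apply: (@ordprod_zero _ _ _ a a') => //; rewrite ?mem_cat -?cat_cons ?mem_cat ?ha ?ha' //.
    by rewrite !to_head_hd.
  have {}tot a a' : a \in t :: s -> a' \in t :: s -> a != a' -> bf a a' = ~~ bf a' a.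
    by move=> ha ha'; apply: tot; rewrite /= -cat_cons mem_cat ?ha ?ha'.
  elim: s t hp inc us tot {hall hd out uS} => //= a s IHs t /andP[hda hp].
  move=> + /andP[nt us] tot.
  rewrite hda /=; case ba: (bf a t) => /=.
    move=> inc; have [|b [b' [h1 h2 h3 h4]]] := IHs a hp inc us.
      by move=> b b' hb hb'; apply: tot; rewrite inE ?hb ?hb' orbT.
    by exists b, b'; split=> //; rewrite inE ?h1 ?h2 orbT.
  move=> _; exists t, a; split=> //; rewrite ?inE ?eqxx ?orbT //.
  rewrite tot ?inE ?eqxx ?orbT ?ba //; apply: contraNneq nt => ->.
  by rewrite inE eqxx.
have uS2 : uniq (flatten ((t :: s) :: S)) by [].
rewrite sb_to_head_cons // /= -cat_cons ordprod_cat !rmorphM /=.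
set ZR := ordprod local_kernel bf (flatten S).
have gR : sb (to_head [:: t :: s]) ZR = ZR.
  rewrite /ZR /ordprod rmorph_prod; apply: eq_big_seq => a ha; rewrite rmorph_prod.
  rewrite big_seq_cond [RHS]big_seq_cond; apply: eq_bigr => b /andP[hb _].
  rewrite /local_kernel rmorphM rmorphXn rmorphB /= !sbX !to_head1_out ?out //; congr (_ * _).
  by case: ifP => _; rewrite ?rmorph1 // rmorphB /= !sbX !to_head1_out ?out.
rewrite gR; have [|e0|hdv] := IH hS uS'.
- by move=> a b ha hb; apply: tot; rewrite /= -cat_cons mem_cat ?ha ?hb orbT.
- by left; rewrite e0 mulr0 mul0r.
right; rewrite [X in dv _ X]mulrC; apply: dvM; last exact: dv_mull.
apply: dv_rmorph; rewrite /head_div rmorph_prod; apply: dv_prod_seq => b hb.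
have -> : \prod_(a <- t :: s | bf b a) local_kernel b a = \prod_(a <- t :: s | ~~ bf a b) local_kernel b a.
  rewrite big_seq_cond [RHS]big_seq_cond; apply: eq_bigl => a.
  case ha: (a \in t :: s) => //=; apply: tot; rewrite /= -?cat_cons ?mem_cat ?ha ?hb ?orbT //.
  by apply: contraTneq ha => <-; apply: out.
have -> : (\prod_(a <- t :: s | bf a b) local_kernel a b) * (\prod_(a <- t :: s | ~~ bf a b) local_kernel b a) =
    \prod_(a <- t :: s) (if bf a b then local_kernel a b else local_kernel b a).
  rewrite [RHS](bigID (fun a => bf a b)) /=; congr (_ * _); apply: eq_bigr => a.
    by move=> ->.
  by move=> /negbTE ->.
rewrite rmorph_prod; set e := (\sum_(a <- _) _)%N.
pose c a := if bf a b then ar (pt a) (pt b) else ar (pt b) (pt a).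
apply: (@dv_trans _ (('X_t - 'X_b) ^+ (\sum_(a <- t :: s) c a))).
  apply: dvX; rewrite /e big_cons (_ : ar (pt t) (pt b) = 0%N); first exact: chain_count.
  apply/eqP/negPn/negP => /(ar_rk ls); rewrite ltnNge.
  by rewrite (allP hall b hb).
rewrite expr_sum; apply: dv_prod_seq => a ha; rewrite /c.
have gb : to_head [:: t :: s] b = b by rewrite to_head1_out ?out.
case: (bf a b); rewrite /local_kernel rmorphM rmorphXn rmorphB /= !sbX.
  rewrite gb to_head1_in // exprD.
  exact/dv_mulr/dv_mulr/dv_refl.
rewrite gb to_head1_in // exprD.
apply/dv_mulr/dv_mulr; exists ((-1) ^+ ar (pt b) (pt a)).
by rewrite -exprMn mulN1r opprB.
Qed.

End LocalKernel.

(** * Gluing a string *)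

Section StringGluing.
Variables (F : fieldType) (n : nat) (V L : eqType) (pt : 'I_n -> V) (ln : V -> L).
Variables (dn : rel V) (ar : V -> V -> nat) (rk : V -> nat).
Hypothesis ls : local_structure ln dn ar rk.
Notation P := {mpoly F[n]}.
Notation local_kernel := (local_kernel F pt dn ar).
Notation below := (dn_var pt dn).
Notation W := (inW pt).

Lemma sb_local_kernel s (a b : 'I_n) : (forall c, pt (s c) = pt c) -> sb s (local_kernel a b) = local_kernel (s a) (s b).
Proof.
move=> hs; rewrite /local_kernel !hs rmorphM rmorphXn rmorphB /= !sbX; congr (_ * _).
by case: ifP => _; rewrite ?rmorph1 // rmorphB /= !sbX.
Qed.

Variables (t : 'I_n) (s R : seq 'I_n).
Hypotheses (hp : path below t s) (uR : uniq R).
Hypothesis dis : forall b, b \in R -> b \notin t :: s.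
Let g := to_head [:: t :: s].

Definition next_prod : P := \prod_(b <- R) ('X_t - 'X_b) ^+ (below (last t s) b).
Definition pole_prod : P := \prod_(b <- R)
  (('X_t - 'X_b) ^+ (\sum_(a <- s) (pt a == pt b)) * ('X_b - 'X_t) ^+ (\sum_(a <- t :: s) (pt a == pt b))).
Notation D := (head_div F pt ar t (t :: s) R).

Let g_out a : a \notin t :: s -> g a = a. Proof. exact: to_head1_out. Qed.
Let g_in a : a \in t :: s -> g a = t. Proof. exact: to_head1_in. Qed.
Let g_R b : b \in R -> g b = b. Proof. by move/dis/g_out. Qed.
Let gt : g t = t. Proof. by rewrite g_in ?mem_head. Qed.
Let tR : t \notin R. Proof. by apply/negP => /dis; rewrite mem_head. Qed.

Lemma to_head_idem a : g (g a) = g a.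
Proof. by case: (boolP (a \in t :: s)) => h; rewrite ?(g_in h) ?gt // !g_out. Qed.

Lemma to_head_comm sg a : W R sg -> g (sg a) = sg (g a).
Proof.
move=> hs; have /inWP[_ hout] := hs.
have fx c : c \in t :: s -> sg c = c.
  by move=> hc; apply: hout; apply/negP => /dis; rewrite hc.
case: (boolP (a \in t :: s)) => h; first by rewrite fx // (g_in h) fx ?mem_head.
rewrite (g_out h) g_out //; apply: contra h => h.
by rewrite -[a](permK sg) -(fx _ h) permK.
Qed.

Lemma prodR_inv (f : 'I_n -> P) sg : W R sg -> (forall b, sb sg (f b) = f (sg b)) ->
  sb sg (\prod_(b <- R) f b) = \prod_(b <- R) f b.
Proof.
move=> hs hf; rewrite -[RHS](perm_big _ (inW_map uR hs)) big_map rmorph_prod.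
by apply: eq_bigr => b _; apply: hf.
Qed.

Let fix_t sg : W R sg -> sg t = t.
Proof. by move/inWP=> [_]; apply. Qed.

Lemma D_inv sg : W R sg -> sb sg D = D.
Proof.
move=> hs; apply: prodR_inv => // b; have /inWP[h _] := hs.
by rewrite rmorphXn rmorphB /= !sbX fix_t // h.
Qed.

Lemma U_inv sg : W R sg -> sb sg next_prod = next_prod.
Proof.
move=> hs; apply: prodR_inv => // b; have /inWP[h _] := hs.
by rewrite rmorphXn rmorphB /= !sbX fix_t // /dn_var h.
Qed.

Lemma C_inv sg : W R sg -> sb sg pole_prod = pole_prod.
Proof.
move=> hs; apply: prodR_inv => // b; have /inWP[h _] := hs.
by rewrite rmorphM !rmorphXn !rmorphB /= !sbX fix_t // h.
Qed.

Let prodR_fix (f : 'I_n -> P) : (forall b, b \in R -> sb g (f b) = f b) ->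
  sb g (\prod_(b <- R) f b) = \prod_(b <- R) f b.
Proof. by move=> hf; rewrite rmorph_prod; apply: eq_big_seq => b /hf. Qed.

Lemma g_D : sb g D = D.
Proof. by apply: prodR_fix => b hb; rewrite rmorphXn rmorphB /= !sbX gt g_R. Qed.
Lemma g_U : sb g next_prod = next_prod.
Proof. by apply: prodR_fix => b hb; rewrite rmorphXn rmorphB /= !sbX gt g_R. Qed.

Lemma g_ordprod (z : 'I_n -> 'I_n -> P) bf :
  (forall a b, a \in R -> b \in R -> sb g (z a b) = z a b) -> sb g (ordprod z bf R) = ordprod z bf R.
Proof.
move=> hz; apply: prodR_fix => a ha; rewrite rmorph_prod.
by rewrite big_seq_cond [RHS]big_seq_cond; apply: eq_bigr => b /andP[hb _]; apply: hz.
Qed.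

Lemma g_local_kernel a b : a \in R -> b \in R -> sb g (local_kernel a b) = local_kernel a b.
Proof.
move=> ha hb; rewrite /local_kernel rmorphM rmorphXn rmorphB /= !sbX !g_R //; congr (_ * _).
by case: ifP => _; rewrite ?rmorph1 // rmorphB /= !sbX !g_R.
Qed.

Lemma g_Delta : sb g (Delta F pt R) = Delta F pt R.
Proof.
apply: prodR_fix => a ha; rewrite rmorph_prod.
rewrite big_seq_cond [RHS]big_seq_cond; apply: eq_bigr => b /andP[hb _].
by rewrite rmorphB /= !sbX !g_R.
Qed.

Lemma g_Sym (x : P) : sb g (Sym pt R x) = Sym pt R (sb g x).
Proof.
rewrite /Sym rmorph_sum; apply: eq_bigr => sg hs /=; rewrite !sb_comp.
by apply: sb_eq => a /=; rewrite to_head_comm.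
Qed.

(** For every element of the string but the last, the only value below it is that of
    the next element. So the zeros of the kernel due to dn cancel the poles due to
    equal values, except for the values below the last element. *)
Lemma dn_telescope b :
  (\sum_(a <- t :: s) dn (pt a) (pt b) = \sum_(a <- s) (pt a == pt b) + below (last t s) b)%N.
Proof.
elim: s t hp => [|a r IH] t' /=; first by rewrite big_seq1 big_nil.
move=> /andP[hd /IH {}IH]; rewrite big_cons IH [in RHS]big_cons addnA; congr (_ + _ + _)%N.
congr nat_of_bool; apply/idP/eqP => [h|<-]; last exact: hd.
exact: (dn_fun ls hd h).
Qed.

(** The upward order on the string is the one for which the ordered product does
    not vanish on gluing. *)
Lemma ordprod_string w' : perm_eq w' R ->
  sb g (ordprod local_kernel (before (rev (t :: s) ++ w')) ((t :: s) ++ R)) = pole_prod * D * next_prod * ordprod local_kernel (before w') R.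
Proof.
move=> pw; set bf := before _; rewrite ordprod_cat.
have bsR a b : a \in t :: s -> b \in R -> bf a b.
  move=> ha hb; rewrite /bf /before !index_cat !mem_rev ha (negbTE (dis hb)).
  by rewrite ltn_addr // index_mem mem_rev.
have bRs a b : a \in t :: s -> b \in R -> bf b a = false.
  by move=> ha hb; apply/negbTE; rewrite /bf /before -leqNgt ltnW //; apply: bsR.
have -> : ordprod local_kernel bf (t :: s) = 1.
  rewrite /ordprod big_seq big1 // => a ha; rewrite big_seq_cond big1 // => b /andP[hb].
  rewrite /bf /before !index_cat !mem_rev ha hb => lt.
  have rkab : (rk (pt a) < rk (pt b))%N.
    have so : sorted (fun x y => (rk (pt x) < rk (pt y))%N) (rev (t :: s)).
      by rewrite rev_sorted; apply: (string_rk ls hp).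
    apply: (sorted_ltn_index _ so) => //; rewrite ?mem_rev //.
    by move=> x y z; apply: ltn_trans.
  rewrite /local_kernel; have -> : (pt a == pt b) = false.
    by apply/negP => /eqP e; rewrite e ltnn in rkab.
  have -> : ar (pt a) (pt b) = 0%N.
    apply/eqP/negPn/negP => /(ar_ln ls).
    by rewrite (string_ln ls hp ha) (string_ln ls hp hb) eqxx.
  case h : (dn (pt a) (pt b)); last by rewrite mul1r.
  by have := dn_rk ls h; rewrite ltnNge ltnW.
have -> : ordprod local_kernel bf R = ordprod local_kernel (before w') R.
  rewrite /ordprod; apply: eq_big_seq => a ha; rewrite big_seq_cond [RHS]big_seq_cond.
  apply: eq_bigl => b; case hb: (b \in R) => //=.
  by rewrite /bf /before !index_cat !mem_rev (negbTE (dis ha)) (negbTE (dis hb)) ltn_add2l.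
rewrite mul1r rmorphM /= g_ordprod; last exact: g_local_kernel.
rewrite mulrC; congr (_ * _); rewrite /pole_prod /next_prod /head_div -!big_split rmorph_prod.
apply: eq_big_seq => b hb /=; rewrite [X in _ * X]big_seq_cond.
rewrite [X in _ * X]big1 ?mulr1 => [|a /andP[ha]]; last by rewrite bRs.
rewrite big_seq_cond (eq_bigl (mem (t :: s))) => [|a]; last first.
  by rewrite /=; case ha: (a \in t :: s) => //=; apply: bsR.
rewrite -big_seq rmorph_prod.
rewrite (eq_big_seq (fun a => ('X_t - 'X_b) ^+ (ar (pt a) (pt b)) *
   ('X_t - 'X_b) ^+ dn (pt a) (pt b) * ('X_b - 'X_t) ^+ (pt a == pt b))); last first.
  move=> a ha; rewrite /local_kernel rmorphM rmorphXn rmorphB /= !sbX (g_in ha) (g_R hb) exprD.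
  by congr (_ * _); case: ifP => _; rewrite ?rmorph1 // rmorphB /= !sbX (g_in ha) (g_R hb) expr1.
rewrite !big_split /= -!expr_sum dn_telescope exprD.
set A := _ ^+ (\sum_(i <- _) ar _ _); ring.
Qed.

Lemma Delta_string :
  sb g (Delta F pt (s ++ R) * \prod_(b <- s ++ R | pt b == pt t) ('X_b - 'X_t)) =
  Delta F pt R * pole_prod.
Proof.
have us := string_pt_inj ls hp.
have ins a : a \in s -> a \in t :: s by move=> h; rewrite inE h orbT.
have ut : t \notin s by have := string_uniq ls hp => /= /andP[].
have eD B : Delta F pt B =
  ordprod (fun a b => 'X_a - 'X_b) (fun a b => (b != a) && (pt b == pt a)) B by [].
have e1 : ordprod (fun a b => 'X_a - 'X_b) (fun a b => (b != a) && (pt b == pt a)) s = 1 :> P.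
  rewrite /ordprod big_seq big1 // => a ha; rewrite big_seq_cond big1 // => b /and3P[hb ne /eqP e].
  by case/eqP: ne; apply: us; rewrite ?ins.
rewrite eD ordprod_cat e1 -eD.
rewrite mul1r -mulrA rmorphM /= g_Delta; congr (_ * _).
rewrite big_cat /= [X in _ * (X * _)]big_seq_cond.
rewrite [X in _ * (X * _)]big_pred0 => [|b]; last first.
  apply/negP => /andP[hb /eqP e]; move: ut; rewrite -(us b t) ?hb ?mem_head //.
  exact: ins.
rewrite mul1r [X in _ * X]big_mkcond -big_split rmorph_prod; apply: eq_big_seq => b hb /=.
have nb a : a \in s -> (b != a) by move=> /ins ha; apply: contraTneq ha => <-; apply: dis.
rewrite !rmorphM /= !rmorph_prod big_cons addnC exprD mulrA !expr_sum; congr (_ * _ * _).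
- rewrite big_mkcond; apply: eq_big_seq => a ha; rewrite nb //= eq_sym.
  by case: eqP => _; rewrite ?expr0 // expr1 rmorphB /= !sbX (g_in (ins _ ha)) (g_R hb).
- rewrite big_mkcond; apply: eq_big_seq => a ha; rewrite eq_sym nb //=.
  by case: eqP => _; rewrite ?expr0 // expr1 rmorphB /= !sbX (g_in (ins _ ha)) (g_R hb).
- by rewrite eq_sym; case: eqP => _; rewrite ?rmorph1 ?expr0 // expr1 rmorphB /= !sbX gt g_R.
Qed.

End StringGluing.

(** * Induction on the string of a variable of maximal rank *)

Section StringStep.
Variables (F : fieldType) (n : nat) (V L : eqType) (pt : 'I_n -> V) (ln : V -> L).
Variables (dn : rel V) (ar : V -> V -> nat) (rk : V -> nat).
Hypothesis ls : local_structure ln dn ar rk.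
Hypothesis char0 : forall k, k.+1%:R != 0 :> F.
Notation P := {mpoly F[n]}.
Notation local_kernel := (local_kernel F pt dn ar).
Notation below := (dn_var pt dn).
Notation W := (inW pt).
Notation ok_strings := (ok_strings pt dn rk).
Notation strings_div := (strings_div F pt ar).
Notation Delta := (Delta F pt).
Notation string_cond := (string_cond pt dn ar rk).

Lemma Psi_Phi T (a b a' b' : 'I_n) (c c' : F) : Psi pt ln a b c -> Phi pt ln T a' b' c' ->
  ~ dv (lin a b c) (lin a' b' c').
Proof.
move=> [ne e _] h1 /lin_assoc -/(_ ne (Phi_ne h1)); case: h1 => _ _ /eqP h _.
by case=> -[ea [eb _]]; subst; apply: h.
Qed.

Lemma lin_opp (a b : 'I_n) (c : F) : lin a b c = - lin b a (- c).
Proof. by rewrite /lin rmorphN /=; ring. Qed.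

Lemma fprod_neq0 (Ph : 'I_n -> 'I_n -> F -> Prop) p :
  (forall a b c, Ph a b c -> a != b) -> fprod Ph p -> p != 0.
Proof.
move=> h [l [hl ->]]; rewrite prodf_seq_neq0; apply/allP => x hx /=.
by apply: lin_neq0; apply: h (hl x hx).
Qed.

Lemma before_tot (w : seq 'I_n) a b : a \in w -> b \in w -> a != b -> before w a b = ~~ before w b a.
Proof.
move=> ha hb ne; rewrite /before -leqNgt ltn_neqAle; case: eqP => //= e.
by case/eqP: ne; rewrite -(nth_index a ha) e nth_index.
Qed.

Lemma before_trans (w : seq 'I_n) : transitive (before w).
Proof. by move=> a b c; apply: ltn_trans. Qed.

Lemma head_div_perm t s R R' : perm_eq R R' -> head_div F pt ar t s R = head_div F pt ar t s R'.
Proof. exact: perm_big. Qed.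

Lemma to_head_singles (l : seq 'I_n) a : to_head [seq [:: b] | b <- l] a = a.
Proof.
elim: l => //= b l IH; rewrite /to_head /= -/(to_head _ a) IH inE.
by case: eqP => [->|].
Qed.

Lemma ok_strings_singles (l : seq 'I_n) : sorted (fun a b => (rk (pt b) <= rk (pt a))%N) l ->
  ok_strings [seq [:: b] | b <- l].
Proof.
elim: l => //= b l IH h; rewrite IH ?(path_sorted h) // andbT -[map _ l]/([seq [:: x] | x <- l]).
rewrite flatten_seq1; apply: order_path_min h.
by move=> x y z h1 h2; apply: leq_trans h2 h1.
Qed.

Variables (B : seq 'I_n) (t : 'I_n).
Hypotheses (uB : uniq B) (tB : t \in B).
Hypothesis tmax : forall b, b \in B -> (rk (pt b) <= rk (pt t))%N.
Let B' := rem t B.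

(** Symmetrization over the permutations that fix t produces each factor X_b - X_t once,
    not twice as in Delta, so only one order of each pair is kept. *)
Definition head_poles : P := \prod_(b <- B' | pt b == pt t) ('X_b - 'X_t).

(** The analogue of in_span for symmetrization over the permutations that fix t; the
    remaining symmetrization is restored at the end by interpolation. *)
Definition in_spanT (E : P) : Prop :=
  exists Ls : seq (seq 'I_n * P), (forall x, x \in Ls -> perm_eq x.1 B) /\
    Delta B' * head_poles * E = \sum_(x <- Ls) Sym pt B' (x.2 * ordprod local_kernel (before x.1) B).

(** The induction on the string of t only uses the families whose first string starts
    at t. *)
Definition string_condT (E : P) : Prop := forall s S, ok_strings ((t :: s) :: S) ->
  perm_eq (flatten ((t :: s) :: S)) B -> dv (strings_div ((t :: s) :: S)) (sb (to_head ((t :: s) :: S)) E).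
Definition sym_fixing (E : P) : Prop := forall s, W B' s -> sb s E = E.

Let uB' : uniq B'. Proof. exact: rem_uniq. Qed.
Let B'P b : (b \in B') = (b != t) && (b \in B). Proof. by rewrite mem_rem_uniq. Qed.
Let pBB' : perm_eq B (t :: B'). Proof. exact: perm_to_rem. Qed.
Let fix_t s : W B' s -> s t = t.
Proof. by move/inWP => [_]; apply; rewrite B'P eqxx. Qed.

Lemma head_poles_inv s : W B' s -> sb s head_poles = head_poles.
Proof.
move=> hs; rewrite /head_poles big_mkcond; apply: (prodR_inv uB' hs) => b.
have /inWP[h _] := hs; rewrite h; case: ifP => _; last by rewrite rmorph1.
by rewrite rmorphB /= !sbX fix_t.
Qed.

Lemma DeltaT_neq0 : Delta B' * head_poles != 0.
Proof.
rewrite mulf_neq0 ?Delta_neq0 // prodf_seq_neq0; apply/allP => b hb /=; apply/implyP => _.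
by rewrite linE lin_neq0 //; move: hb; rewrite B'P => /andP[].
Qed.

Lemma sb_ordprod_local w s : W B' s -> sb s (ordprod local_kernel (before w) B) = ordprod local_kernel (before (map s w)) B.
Proof.
move=> hs; apply: sb_ordprod => // [s' a b /inWP[h _]|]; first exact: sb_local_kernel.
by apply: inW_sub hs => b; rewrite B'P => /andP[].
Qed.

(** The image of Delta on gluing is a product of forms joining variables of the same
    line, and the divisor is a product of forms joining different lines, so Delta
    can be cancelled from the divisibility of the ordered products. *)
Lemma string_condT_Sym (Ls : seq (seq 'I_n * P)) E : (forall x, x \in Ls -> perm_eq x.1 B) ->
  Delta B' * head_poles * E = \sum_(x <- Ls) Sym pt B' (x.2 * ordprod local_kernel (before x.1) B) -> string_condT E.
Proof.
move=> hL eE s S hS pS; set S1 := (t :: s) :: S in hS pS *; set G := to_head S1.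
have uS : uniq (flatten S1) by rewrite (perm_uniq pS).
apply: (fprod_cancel (Ph := Phi pt ln (flatten S1)) (Ps := Psi pt ln)
         (M := sb G (Delta B' * head_poles))).
- exact: (fprod_strings_div F ls hS uS).
- rewrite rmorphM; apply: fprodM.
    rewrite rmorph_prod; apply: fprod_prod => a ha _; rewrite rmorph_prod.
    apply: fprod_prod => b hb /andP[ne /eqP e]; rewrite rmorphB /= !sbX linE.
    apply: fprod_lin; split; rewrite ?(to_head_ln ls) ?e //.
    by apply: contraNneq ne => e'; apply/eqP/esym/(to_head_inj_pt ls hS).
  rewrite rmorph_prod; apply: fprod_prod => b hb /eqP e; rewrite rmorphB /= !sbX linE.
  apply: fprod_lin; split; rewrite ?(to_head_ln ls) ?e //.
  move: hb; rewrite B'P => /andP[ne _].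
  by apply: contraNneq ne => e'; apply/eqP/(to_head_inj_pt ls hS).
- by move=> a b c; apply: Phi_ne.
- by move=> a b c a' b' c'; apply: Phi_Psi.
rewrite -rmorphM eE rmorph_sum big_seq; apply: dv_sum => x /hL px /=.
rewrite /Sym rmorph_sum; apply: dv_sum => sg hs /=; rewrite !rmorphM /=; apply: dv_mull.
rewrite sb_ordprod_local // -(ordprod_perm _ _ pS).
have hW : W B sg by apply: inW_sub hs => b; rewrite B'P => /andP[].
have pm : perm_eq (map sg x.1) B.
  by apply: perm_trans (inW_map uB hW); apply: perm_map.
have [||->|//] := @ordprod_dv F _ _ _ _ _ _ _ _ ls (before (map sg x.1)) S1 _ hS uS.
- exact: before_trans.
- by move=> a b; rewrite !(perm_mem pS) -!(perm_mem pm); apply: before_tot.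
exact: dv0.
Qed.

Lemma ordprod_factor w : perm_eq w B -> (forall b, b \in B' -> pt b = pt t -> before w t b) ->
  exists Z, ordprod local_kernel (before w) B = head_poles * Z /\
    forall a b, a \in B' -> b \in B' -> a != b -> pt a = pt b -> dv (lin a b 0) Z.
Proof.
move=> pw hw; have := ordprod_cat local_kernel (before w) [:: t] B'; rewrite -(ordprod_perm _ _ pBB') => ->.
have [q ->] : dv head_poles (\prod_(b <- B') (\prod_(a <- [:: t] | before w a b) local_kernel a b *
                           \prod_(a <- [:: t] | before w b a) local_kernel b a)).
  rewrite /head_poles big_mkcond; apply: dv_prod_seq => b hb; case: eqP => [e|_]; last exact: dv1.
  rewrite big_mkcond big_seq1 hw // /local_kernel e eqxx.
  exact/dv_mulr/dv_mull/dv_refl.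
exists (ordprod local_kernel (before w) [:: t] * ordprod local_kernel (before w) B' * q); split; first by ring.
move=> a b ha hb ne e; apply/dv_mulr/dv_mull.
have inB c : c \in B' -> c \in w by rewrite (perm_mem pw) B'P => /andP[].
have hz a' b' : a' \in B' -> b' \in B' -> before w a' b' -> pt a' = pt b' ->
    dv ('X_b' - 'X_a') (ordprod local_kernel (before w) B').
  move=> ha' hb' hbf e'; rewrite /ordprod (big_rem _ ha') /= (big_rem _ hb') /= hbf.
  by apply/dv_mulr/dv_mulr; rewrite /local_kernel e' eqxx; apply/dv_mull/dv_refl.
case h: (before w b a); first by rewrite -linE; apply: hz.
have [|q' ->] := hz a b ha hb _ e; first by rewrite before_tot ?inB // h.
by exists (- q'); rewrite -linE mulNr -mulrN opprB.
Qed.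

(** When t precedes all variables of its value, the factors X_b - X_t of the ordered
    product give head_poles, and the other same-value factors make the symmetrization
    divisible by Delta. *)
Lemma Sym_factor w p : perm_eq w B -> (forall b, b \in B' -> pt b = pt t -> before w t b) ->
  dv (Delta B' * head_poles) (Sym pt B' (p * ordprod local_kernel (before w) B)).
Proof.
move=> pw hw; have [Z [-> hZ]] := ordprod_factor pw hw.
rewrite mulrCA (SymM _ (@head_poles_inv)) mulrC; apply: dvM; first exact: dv_refl.
apply: Delta_dv_Sym => //.
by move=> a b ha hb ne e; apply/dv_mull/hZ.
Qed.

Section Step.
Hypothesis IH : forall R E, uniq R -> (size R < size B)%N ->
  (forall s, W R s -> sb s E = E) -> string_cond R E -> in_span pt local_kernel R E.
Variable s : seq 'I_n.
Hypotheses (hp : path below t s) (sB : {subset t :: s <= B}).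
Let R := [seq b <- B | b \notin t :: s].
Let g := to_head [:: t :: s].

Let uR : uniq R. Proof. exact: filter_uniq. Qed.
Let RP b : (b \in R) = (b \notin t :: s) && (b \in B). Proof. exact: mem_filter. Qed.
Let dis b : b \in R -> b \notin t :: s. Proof. by rewrite RP => /andP[]. Qed.
Let pB : perm_eq ((t :: s) ++ R) B.
Proof.
rewrite perm_sym -(perm_filterC (mem (t :: s)) B) perm_sym; apply: perm_cat => //.
apply: uniq_perm; [exact: (string_uniq ls hp) | exact: filter_uniq | move=> b].
by rewrite mem_filter /=; case h: (b \in t :: s) => //=; rewrite sB.
Qed.
Let pB' : perm_eq (s ++ R) B'.
Proof. by rewrite -(perm_cons t); apply: perm_trans pB _. Qed.
Let WRB' sg : W R sg -> W B' sg.
Proof. by apply: inW_sub => b hb; rewrite -(perm_mem pB') mem_cat hb orbT. Qed.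
Let tR : t \notin R. Proof. by rewrite RP mem_head. Qed.
Let szR : (size R < size B)%N.
Proof. by rewrite -(perm_size pB) size_cat /= addSn ltnS leq_addl. Qed.

Notation D := (head_div F pt ar t (t :: s) R).
Notation U := (next_prod F pt dn t s R).

Let ok_strings_cons S : ok_strings S -> perm_eq (flatten S) R -> ok_strings ((t :: s) :: S).
Proof.
move=> hS pS /=; rewrite hp hS /= andbT; apply/allP => b; rewrite (perm_mem pS) RP.
by case/andP=> _; apply: tmax.
Qed.

Let string_condT_cons E S : string_condT E -> ok_strings S -> perm_eq (flatten S) R ->
  dv (sb (to_head S) D * strings_div S) (sb (to_head S) (sb g E)).
Proof.
move=> hE hS pS; have p1 : perm_eq (flatten ((t :: s) :: S)) B.
  by apply: perm_trans pB; rewrite [flatten _]/= -cat_cons perm_cat2l.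
have := hE s S (ok_strings_cons hS pS) p1; rewrite sb_to_head_cons ?(perm_uniq p1) //=.
by rewrite (head_div_perm _ _ pS).
Qed.

Let D_Phi : fprod (Phi pt ln B) D.
Proof.
apply: fprod_prod => b hb _; apply: fprodX => h; rewrite linE; apply: fprod_lin; split=> //.
- by move: hb; rewrite RP => /andP[].
- exact: (ar_sum_ln ls hp h).
Qed.

Let U_Psi : fprod (Psi pt ln) U.
Proof.
apply: fprod_prod => b hb _; apply: fprodX => h; rewrite linE; apply: fprod_lin; split=> //.
  by apply: contraNneq tR => ->.
by move: h; rewrite eqb0 negbK => /(dn_ln ls) <-; apply/esym/(string_ln ls hp)/mem_last.
Qed.

(** Vanishing on the longer string means vanishing on the hyperplane X_t = X_b after
    gluing the shorter one. *)
Lemma dvd_by_vanishing E : (forall b, b \in B -> below (last t s) b ->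
  sb (to_head [:: t :: rcons s b]) E = 0) -> dv U (sb g E).
Proof.
move=> hE; pose l := [seq (t, b, 0 : F) | b <- R & below (last t s) b].
have -> : U = \prod_(x <- l) lin x.1.1 x.1.2 x.2 ^+ 1.
  rewrite /l big_map big_filter /next_prod [RHS]big_mkcond; apply: eq_bigr => b _ /=.
  by case: ifP => _; rewrite ?expr0 // linE.
have lP x : x \in l -> exists b, [/\ x = (t, b, 0), b \in R, t != b & below (last t s) b].
  move=> /mapP[b + ->]; rewrite mem_filter => /andP[h hb]; exists b; split=> //.
  by apply: contraNneq tR => ->.
apply: dv_prod_lin.
- by move=> x /lP[b [-> _ ne _]].
- have ul : uniq l.
    by rewrite map_inj_uniq ?filter_uniq // => ? ? [].
  move: ul; rewrite uniq_pairwise; apply: (@sub_in_pairwise _ (mem l)); last exact/allP.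
  move=> x x' /lP[b [-> _ nb _]] /lP[b' [-> _ nb' _]] /=.
  rewrite eq_sym => /negbTE ->; apply/eqP => -[? ?]; subst.
  by rewrite eqxx in nb'.
move=> x /lP[b [-> hb ne hd]] /=; rewrite expr1.
have ne' : b != t by rewrite eq_sym.
have [q eq] : dv (lin b t 0) (sb g E).
  apply/(lin_dvP _ _ ne'); rewrite ev_sb -[RHS](hE b) //; last first.
    by move: hb; rewrite RP => /andP[].
  apply: ev_eq => a /=; rewrite /lin_red mpolyC0 addr0 /to_head /= !inE mem_rcons inE.
  case ha: (a \in t :: s); rewrite /g ?(to_head1_in ha) ?(to_head1_out (negbT ha)).
    move: ha; rewrite inE => /orP[->|->]; last by rewrite !orbT; case: ifP.
    by case: ifP.
  move: ha; rewrite inE.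
  by case: (a == t) => //=; case: (a \in s) => //= _; rewrite orbF; case: eqP.
by exists (- q); rewrite eq lin_opp oppr0 mulrN mulNr.
Qed.

(** After gluing the string to t, the string conditions give the arrow factors D, and
    the vanishing on longer strings gives the factors U. The quotient Q no longer
    involves the variables under t, and it inherits the string conditions for the
    variables outside the string because the forms in U join t to those variables. *)
Lemma quotient_exists E : sym_fixing E -> string_condT E ->
  (forall b, b \in B -> below (last t s) b -> sb (to_head [:: t :: rcons s b]) E = 0) ->
  exists Q, [/\ sb g E = D * U * Q, sb g Q = Q, forall sg, W R sg -> sb sg Q = Q & string_cond R Q].
Proof.
move=> iE cE vE; have [Q0 eQ0] : dv (D * U) (sb g E).
  have [x ex] : dv D (sb g E).
    pose l := sort (fun a b => rk (pt b) <= rk (pt a))%N R.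
    have pl : perm_eq (flatten [seq [:: b] | b <- l]) R by rewrite flatten_seq1 perm_sort.
    have hS : ok_strings [seq [:: b] | b <- l].
      by apply/ok_strings_singles/sort_sorted => a b; apply: leq_total.
    have := string_condT_cons cE hS pl; rewrite !(sb_id _ (@to_head_singles l)) => -[q ->].
    by exists (q * strings_div [seq [:: b] | b <- l]); rewrite -mulrA [strings_div _ * _]mulrC.
  have [y ey] : dv U x.
    apply: (fprod_cancel U_Psi D_Phi) => [a b c []//||].
      by move=> a b c a' b' c'; apply: Psi_Phi.
    by rewrite mulrC -ex; apply: dvd_by_vanishing.
  by exists y; rewrite ex ey; ring.
have nzDU : D * U != 0.
  rewrite mulf_neq0 //; first by apply: fprod_neq0 D_Phi => a b c; apply: Phi_ne.
  by apply: fprod_neq0 U_Psi => a b c [].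
have gDU : sb g (D * U) = D * U by rewrite rmorphM /= (g_D F pt ar dis) (g_U F pt dn dis).
have eQ : sb g E = D * U * sb g Q0.
  rewrite mulrC -gDU -rmorphM /= -eQ0 sb_comp; apply: sb_eq => a /=.
  exact/esym/to_head_idem.
exists (sb g Q0); split=> //.
- by rewrite sb_comp; apply: sb_eq => a /=; exact: to_head_idem.
- move=> sg hs; apply: (mulfI nzDU); rewrite -eQ.
  have -> : D * U = sb sg (D * U).
    by rewrite rmorphM /= (D_inv F ar uR dis hs) (U_inv F dn uR dis hs).
  rewrite -rmorphM -eQ /= -[in RHS](iE sg (WRB' hs)) !sb_comp.
  by apply: sb_eq => a /=; exact/esym/(to_head_comm dis _ hs).
move=> S hS pS; have uS : uniq (flatten S) by rewrite (perm_uniq pS).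
have [q] := string_condT_cons cE hS pS; rewrite eQ !rmorphM /=.
set A := sb (to_head S) D; set Q := sb (to_head S) _ => e.
have nzA : A != 0.
  rewrite /A rmorph_prod prodf_seq_neq0; apply/allP => b hb /=; rewrite rmorphXn expf_neq0 //.
  rewrite rmorphB /= !sbX linE lin_neq0 // [to_head S t]to_head_out ?(perm_mem pS) //.
  by apply: contraNneq tR => ->; rewrite -(perm_mem pS) to_head_mem ?(perm_mem pS).
apply: (fprod_cancel (Ph := Phi pt ln (flatten S)) (Ps := fun a b c => [/\ a = t, b \in R & c = 0])
         (M := sb (to_head S) U)).
- exact: (fprod_strings_div F ls hS uS).
- rewrite rmorph_prod; apply: fprod_prod => b hb _; rewrite rmorphXn; apply: fprodX => _.
  rewrite rmorphB /= !sbX linE; apply: fprod_lin; split=> //.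
    by rewrite to_head_out ?(perm_mem pS).
  by rewrite -(perm_mem pS) to_head_mem ?(perm_mem pS).
- by move=> a b c; apply: Phi_ne.
- move=> a b c a' b' c' hab [-> hb' _] /lin_assoc -/(_ (Phi_ne hab)).
  have [ha hb _ _] := hab; rewrite !(perm_mem pS) in ha hb.
  have nt : t != b' by apply: contraNneq tR => ->.
  by case/(_ nt) => -[et _]; move: tR; rewrite et ?ha ?hb.
exists q; apply: (mulfI nzA); rewrite mulrA e.
by ring.
Qed.

End Step.

End StringStep.

Section StringInduction.
Variables (F : fieldType) (n : nat) (V L : eqType) (pt : 'I_n -> V) (ln : V -> L).
Variables (dn : rel V) (ar : V -> V -> nat) (rk : V -> nat).
Hypothesis ls : local_structure ln dn ar rk.
Hypothesis char0 : forall k, k.+1%:R != 0 :> F.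
Notation P := {mpoly F[n]}.
Notation local_kernel := (local_kernel F pt dn ar).
Notation below := (dn_var pt dn).
Notation W := (inW pt).
Notation ok_strings := (ok_strings pt dn rk).
Notation strings_div := (strings_div F pt ar).
Notation Delta := (Delta F pt).
Notation string_cond := (string_cond pt dn ar rk).
Notation head_poles := (head_poles F pt).
Notation in_spanT := (in_spanT pt dn ar).
Notation string_condT := (string_condT pt dn ar rk).
Notation sym_fixing := (sym_fixing pt).

Lemma dv_sub (R : comNzRingType) (p q r : R) : dv p q -> dv p r -> dv p (q - r).
Proof. by move=> [x ->] [y ->]; exists (x - y); rewrite mulrBl. Qed.

Lemma fixed_or_moved (sg : {perm 'I_n}) t s : path below t s -> sg t = t ->
  (forall a, a \in t :: s -> sg a = a) \/
  exists a a', [/\ a \in t :: s, a' \in t :: s, below a a', sg a = a & sg a' != a'].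
Proof.
elim: s t => [|b s IH] t /=; first by move=> _ e; left=> a; rewrite inE => /eqP ->.
move=> /andP[hd hp] et; have [eb|nb] := eqVneq (sg b) b; last first.
  by right; exists t, b; split; rewrite ?inE ?eqxx ?orbT.
case: (IH b hp eb) => [h|[a [a' [h1 h2 h3 h4 h5]]]]; [left|right].
  by move=> a; rewrite inE => /orP[/eqP->//|/h].
by exists a, a'; split; rewrite // inE ?h1 ?h2 orbT.
Qed.

Lemma in_spanT_add B t (E E' : P) : in_spanT B t E -> in_spanT B t E' -> in_spanT B t (E + E').
Proof.
move=> [l [hl el]] [l' [hl' el']]; exists (l ++ l'); split=> [x|].
  by rewrite mem_cat => /orP[/hl|/hl'].
by rewrite mulrDr el el' big_cat.
Qed.

Section Step.
Variables (B : seq 'I_n) (t : 'I_n).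
Hypotheses (uB : uniq B) (tB : t \in B).
Hypothesis tmax : forall b, b \in B -> (rk (pt b) <= rk (pt t))%N.
Hypothesis IH : forall R (E : P), uniq R -> (size R < size B)%N ->
  (forall s, W R s -> sb s E = E) -> string_cond R E -> in_span pt local_kernel R E.
Let B' := rem t B.
Let uB' : uniq B'. Proof. exact: rem_uniq. Qed.
Let B'P b : (b \in B') = (b != t) && (b \in B). Proof. by rewrite mem_rem_uniq. Qed.
Let pBB' : perm_eq B (t :: B'). Proof. exact: perm_to_rem. Qed.

(** By induction Q is a combination of symmetrized ordered products in the variables
    outside the string. Putting the string, listed upwards, in front of the orders
    gives E0: on gluing, only the permutations that fix the string contribute, and
    the factors D, U and the cancelled poles come out as for E. *)
Lemma string_step s (E : P) : path below t s -> {subset t :: s <= B} ->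
  sym_fixing B t E -> string_condT B t E ->
  (forall b, b \in B -> below (last t s) b -> sb (to_head [:: t :: rcons s b]) E = 0) ->
  exists E0, [/\ in_spanT B t E0, sym_fixing B t E0, string_condT B t E0 &
                 sb (to_head [:: t :: s]) E0 = sb (to_head [:: t :: s]) E].
Proof.
move=> hp sB iE cE vE; set g := to_head [:: t :: s].
pose R := [seq b <- B | b \notin t :: s].
have [Q [eQ gQ iQ cQ]] := quotient_exists ls uB tB tmax hp sB iE cE vE.
have uR : uniq R by exact: filter_uniq.
have RP b : (b \in R) = (b \notin t :: s) && (b \in B) by exact: mem_filter.
have dis b : b \in R -> b \notin t :: s by rewrite RP => /andP[].
have pB : perm_eq ((t :: s) ++ R) B.
  rewrite perm_sym -(perm_filterC (mem (t :: s)) B) perm_sym; apply: perm_cat => //.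
  apply: uniq_perm; [exact: (string_uniq ls hp) | exact: filter_uniq | move=> b].
  by rewrite mem_filter /=; case h: (b \in t :: s) => //=; rewrite sB.
have pB' : perm_eq (s ++ R) B' by rewrite -(perm_cons t); apply: perm_trans pB _.
have WRB' sg : W R sg -> W B' sg.
  by apply: inW_sub => b hb; rewrite -(perm_mem pB') mem_cat hb orbT.
have tR : t \notin R by rewrite RP mem_head.
have szR : (size R < size B)%N by rewrite -(perm_size pB) size_cat /= addSn ltnS leq_addl.
have [Ls [hL eL]] := IH uR szR iQ cQ.
pose L0 := [seq (rev (t :: s) ++ x.1, x.2) | x <- Ls].
have hL0 x : x \in L0 -> perm_eq x.1 B.
  move=> /mapP[y /hL py ->] /=; apply: perm_trans pB; apply: perm_cat => //.
  by rewrite perm_rev.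
have ptt b : b \in B' -> pt b = pt t -> b \in R.
  move=> hb e; move: hb; rewrite B'P RP => /andP[ne ->]; rewrite andbT.
  by apply: contra ne => h; apply/eqP/(string_pt_inj ls hp h); rewrite ?mem_head.
have [E0 eE0] : dv (Delta B' * head_poles B t) (\sum_(x <- L0) Sym pt B' (x.2 * ordprod local_kernel (before x.1) B)).
  rewrite big_map big_seq; apply: dv_sum => x hx /=.
  apply: Sym_factor => //.
    by apply: (hL0 (rev (t :: s) ++ x.1, x.2)); apply/mapP; exists x.
  move=> b hb e; have hR := ptt b hb e.
  rewrite /before !index_cat !mem_rev mem_head (negbTE (dis _ hR)).
  by rewrite ltn_addr // index_mem mem_rev mem_head.
have {}eE0 : Delta B' * head_poles B t * E0 = \sum_(x <- L0) Sym pt B' (x.2 * ordprod local_kernel (before x.1) B).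
  by rewrite eE0 mulrC.
have nz := DeltaT_neq0 F pt t uB.
exists E0; split.
- by exists L0.
- move=> sg hs; apply: (mulfI nz); rewrite [RHS]eE0.
  have -> : Delta B' * head_poles B t = sb sg (Delta B' * head_poles B t).
    by rewrite rmorphM /= sb_Delta // head_poles_inv.
  rewrite -rmorphM eE0 rmorph_sum /=; apply: eq_bigr => x _.
  by apply: sb_Sym.
- exact: (string_condT_Sym ls uB hL0 eE0).
have gDc : sb g (Delta B' * head_poles B t) = Delta R * pole_prod F pt t s R.
  rewrite -(Delta_string F ls hp dis) (Delta_perm _ _ pB') /head_poles.
  by rewrite (perm_big _ pB').
have nz1 : Delta R * pole_prod F pt t s R != 0.
  rewrite mulf_neq0 ?Delta_neq0 // prodf_seq_neq0; apply/allP => b hb /=.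
  have ne : t != b by apply: contraNneq tR => ->.
  by rewrite mulf_neq0 // expf_neq0 // linE lin_neq0 // eq_sym.
apply: (mulfI nz1); rewrite -{1}gDc -rmorphM /= eE0 rmorph_sum /=.
set D := head_div F pt ar t (t :: s) R in eQ; set U := next_prod F pt dn t s R in eQ.
set C := pole_prod F pt t s R.
have step x : x \in Ls -> sb g (Sym pt B' (x.2 * ordprod local_kernel (before (rev (t :: s) ++ x.1)) B)) =
    C * D * U * Sym pt R (sb g x.2 * ordprod local_kernel (before x.1) R).
  move=> hx; set w := rev _ ++ _.
  have pw : perm_eq w B by apply: (hL0 (w, x.2)); apply/mapP; exists x.
  rewrite {1}/Sym rmorph_sum (bigID (W R)) /= addrC big1 ?add0r; last first.
    move=> sg /andP[hs nR]; rewrite !rmorphM /= (sb_ordprod_local _ _ _ uB _ hs).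
    have /inWP[hpt hout] := hs.
    have et : sg t = t by apply: hout; rewrite B'P eqxx.
    (* If sg fixes a and moves the next element a' of the string, then a' is the
       image of a variable outside the string, which comes after a: the order
       moved by sg does not list the string upwards. *)
    case: (fixed_or_moved hp et) => [hfix|[a [a' [ha ha' hd ea na]]]].
      case/negP: nR; apply/inWP; split=> // b; rewrite RP negb_and negbK => /orP[/hfix //|nb].
      by apply: hout; rewrite B'P (negbTE nb) andbF.
    rewrite (_ : sb g (ordprod _ _ _) = 0) ?mulr0 //.
    apply: (@ordprod_zero _ _ _ _ _ _ _ _ _ a a'); rewrite ?sB //; last by rewrite /g !to_head1_in.
    have hW : W B sg by apply: inW_sub hs => b; rewrite B'P => /andP[].
    pose y := sg^-1%g a'; have ey : sg y = a' by rewrite permKV.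
    have ptey : pt y = pt a' by rewrite -ey hpt.
    have yB : y \in B by rewrite -(inW_mem _ hW) ey sB.
    have yR : y \in R.
      rewrite RP yB andbT; apply/negP => yts; case/eqP: na.
      by rewrite -{2}ey (string_pt_inj ls hp yts ha' ptey).
    rewrite -ea -ey before_map /before /w !index_cat !mem_rev ha (negbTE (dis _ yR)).
    by rewrite ltn_addr // index_mem mem_rev.
  rewrite (eq_bigl (W R)) => [|sg]; last first.
    by apply/andP/idP => [[]|h] //; split=> //; apply: WRB'.
  have -> : \sum_(i | W R i) sb g (sb i (x.2 * ordprod local_kernel (before w) B)) =
            Sym pt R (sb g (x.2 * ordprod local_kernel (before w) B)).
    apply: eq_bigr => sg hs; rewrite !sb_comp; apply: sb_eq => a /=.
    exact: (to_head_comm dis _ hs).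
  rewrite -(ordprod_perm local_kernel _ pB) rmorphM /= (ordprod_string F ls hp dis) ?hL //.
  rewrite [X in Sym pt R X = _]mulrCA [LHS]SymM // => sg hs.
  by rewrite !rmorphM /= (C_inv F uR dis hs) (D_inv F ar uR dis hs) (U_inv F dn uR dis hs).
rewrite big_map (eq_big_seq _ step) -mulr_sumr eQ.
have -> : \sum_(x <- Ls) Sym pt R (sb g x.2 * ordprod local_kernel (before x.1) R) = Delta R * Q.
  rewrite -{1}gQ -(g_Delta F pt dis) -rmorphM eL rmorph_sum /=; apply: eq_big_seq => x hx.
  rewrite (g_Sym _ dis) rmorphM /= (g_ordprod (R := R)) //; exact: (g_local_kernel _ _ _ _ dis).
by rewrite -/C; ring.
Qed.

(** Subtracting E0 makes E vanish on the string itself, hence, by symmetry, on every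
    string that differs from it in the last element; this is the hypothesis for
    the string without its last element. At the trivial string, E = E0. *)
Lemma string_induction s (E : P) : path below t s -> {subset t :: s <= B} ->
  sym_fixing B t E -> string_condT B t E ->
  (forall b, b \in B -> below (last t s) b -> sb (to_head [:: t :: rcons s b]) E = 0) -> in_spanT B t E.
Proof.
elim/last_ind: s E => [|s a IHs] E hp sB iE cE vE.
  have [E0 [h1 _ _ e]] := string_step hp sB iE cE vE; move: e h1.
  have gid : to_head [:: [:: t]] =1 id.
    by move=> b; rewrite /to_head /= inE; case: eqP => [->|].
  by rewrite !(sb_id _ gid) => ->.
have [E0 [h1 h2 h3 e]] := string_step hp sB iE cE vE.
rewrite -[E](subrK E0); apply: in_spanT_add => //.
move: hp; rewrite rcons_path => /andP[hp hd].
have aB : a \in B by apply: sB; rewrite inE mem_rcons mem_head orbT.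
apply: IHs => //.
- by move=> b hb; apply: sB; move: hb; rewrite !inE mem_rcons inE => /orP[->|->]; rewrite ?orbT.
- by move=> sg hs; rewrite rmorphB /= iE ?h2.
- by move=> s' S hS pS; rewrite rmorphB; apply: dv_sub; [apply: cE | apply: h3].
have ea : sb (to_head [:: t :: rcons s a]) (E - E0) = 0 by rewrite rmorphB /= e subrr.
move=> b bB hb; have [->//|nab] := eqVneq b a.
have eptab : pt a = pt b by apply: (dn_fun ls hd hb).
have notin c : pt c = pt a -> c \notin t :: s.
  move=> ec; have hpa : path below t (rcons s a) by rewrite rcons_path hp.
  have := string_uniq_pt ls hpa.
  rewrite -rcons_cons map_rcons rcons_uniq => /andP[+ _].
  by apply: contra => hc; rewrite -ec map_f.
have inB' c : pt c = pt a -> c \in B -> c \in B'.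
  move=> ec hc; rewrite B'P hc andbT; apply: contraNneq (notin c ec) => ->.
  exact: mem_head.
have hW : W B' (tperm a b) by apply: inW_tperm => //; apply: inB'.
have iEE : sb (tperm a b) (E - E0) = E - E0 by rewrite rmorphB /= iE ?h2.
transitivity (sb (tperm a b) (sb (to_head [:: t :: rcons s a]) (E - E0))); last by rewrite ea rmorph0.
rewrite -[in LHS]iEE !sb_comp; apply: sb_eq => c /=.
have [na nb] := (notin a erefl, notin b (esym eptab)).
have hh x y : x \in t :: rcons s y = (x \in t :: s) || (x == y).
  by rewrite !inE mem_rcons inE; case: (x == t); case: (x == y); rewrite ?orbT ?orbF.
have ne : (a == b) = false by rewrite eq_sym (negbTE nab).
have ett : tperm a b t = t.
  rewrite tpermD //; first by apply: contraNneq na => ->; apply: mem_head.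
  by apply: contraNneq nb => ->; apply: mem_head.
case: tpermP => [->|->|/eqP nca /eqP ncb].
- by rewrite /to_head !hh (negbTE nb) !eqxx !orbT /= ett.
- by rewrite /to_head !hh (negbTE na) (negbTE nb) ne [b == a]eq_sym ne /= tpermR.
rewrite /to_head !hh (negbTE nca) (negbTE ncb) !orbF.
case hc: (c \in t :: s); rewrite /= ?ett //.
by rewrite tpermD // eq_sym.
Qed.

Lemma maximal_string m t0 : (rk (pt t0) < m)%N ->
  exists s, [/\ path below t0 s, {subset s <= B} & forall b, b \in B -> ~~ below (last t0 s) b].
Proof.
elim: m t0 => // m IHm t0 lt; case h: (has (below t0) B); last first.
  by exists [::]; split=> // b bB /=; apply/negP => hb; case/negP: (negbT h); apply/hasP; exists b.
case/hasP: h => b bB hb; have [|s [h1 h2 h3]] := IHm b.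
  by apply: leq_trans (dn_rk ls hb) _; rewrite -ltnS.
exists (b :: s); split=> //=; first by rewrite hb.
by move=> x; rewrite inE => /orP[/eqP -> //|/h2].
Qed.

(** For a string that cannot be extended, the vanishing hypothesis of
    string_induction is empty. *)
Lemma string_condT_in_spanT (E : P) : sym_fixing B t E -> string_condT B t E -> in_spanT B t E.
Proof.
move=> iE cE; have [s [h1 h2 h3]] := maximal_string (ltnSn (rk (pt t))).
apply: (string_induction h1) => // [b|b bB hb]; last by case/negP: (h3 b bB).
by rewrite inE => /orP[/eqP -> //|/h2].
Qed.
End Step.
End StringInduction.

(** * From one variable to full symmetry *)

(** Lagrange interpolation of X^(m-1) at m points, read on the leading coefficient. *)
Lemma lagrange_leading (K : fieldType) (l : seq K) : uniq l -> (0 < size l)%N ->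
  \sum_(c <- l) c ^+ (size l).-1 / \prod_(b <- l | b != c) (c - b) = 1.
Proof.
move=> ul sl; pose q c := \prod_(b <- rem c l) ('X - b%:P).
pose w c := c ^+ (size l).-1 / \prod_(b <- l | b != c) (c - b).
pose f : {poly K} := \sum_(c <- l) w c *: q c - 'X^((size l).-1).
have prE (R : comNzRingType) c (h : K -> R) : c \in l ->
    \prod_(b <- l | b != c) h b = \prod_(b <- rem c l) h b.
  by move=> hc; rewrite rem_filter // big_filter.
have szq c : c \in l -> size (q c) = size l.
  by move=> hc; rewrite size_prod_XsubC size_rem // prednK.
have f0 : f = 0.
  apply: (@roots_geq_poly_eq0 _ f l) => //; last first.
    rewrite (leq_trans (size_polyD _ _)) // size_polyN size_polyXn prednK // geq_max leqnn andbT.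
    rewrite big_seq; elim/big_ind: _ => [|p1 p2 h1 h2|c hc]; first by rewrite size_poly0.
      by rewrite (leq_trans (size_polyD _ _)) // geq_max h1.
    by rewrite (leq_trans (size_scale_leq _ _)) // szq.
  apply/allP => c hc; rewrite /root hornerD hornerN hornerXn horner_sum (bigD1_seq c) //=.
  rewrite [X in _ + X - _]big1_seq => [|d /andP[dc hd]]; last first.
    have hcr : c \in rem d l by rewrite mem_rem_uniq // inE eq_sym dc.
    by rewrite hornerZ horner_prod (big_rem _ hcr) /= hornerXsubC subrr mul0r mulr0.
  rewrite addr0 hornerZ horner_prod /w prE //.
  under [X in _ * X]eq_bigr => b _ do rewrite hornerXsubC.
  rewrite mulfVK ?subrr // prodf_seq_neq0; apply/allP => b hb /=.
  by rewrite subr_eq0; move: hb; rewrite mem_rem_uniq // inE eq_sym => /andP[].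
have /eqP := congr1 (fun p : {poly K} => p`_(size l).-1) f0.
rewrite coefB coefXn eqxx coef0 subr_eq0 => /eqP e; rewrite -[RHS]/(true%:R : K) -e coef_sum.
apply: eq_big_seq => c hc; rewrite coefZ -[X in _ * _`_(X.-1)](szq c hc) -lead_coefE.
by rewrite (monicP (monic_prod_XsubC _ _ _)) mulr1.
Qed.

Section LocalTheorem.
Variables (F : fieldType) (n : nat) (V L : eqType) (pt : 'I_n -> V) (ln : V -> L).
Variables (dn : rel V) (ar : V -> V -> nat) (rk : V -> nat).
Hypothesis ls : local_structure ln dn ar rk.
Hypothesis char0 : forall k, k.+1%:R != 0 :> F.
Notation P := {mpoly F[n]}.
Notation local_kernel := (local_kernel F pt dn ar).
Notation W := (inW pt).
Notation Delta := (Delta F pt).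
Notation string_cond := (string_cond pt dn ar rk).
Notation head_poles := (head_poles F pt).

Lemma Sym_Sym (B B' : seq 'I_n) (x : P) : {subset B' <= B} ->
  Sym pt B (Sym pt B' x) = #|[pred s | W B' s]|%:R * Sym pt B x.
Proof.
move=> sB; rewrite [in LHS]/Sym -[LHS]/(Sym pt B (\sum_(s | W B' s) sb s x)).
rewrite (big_morph (Sym pt B) (SymD pt B) (Sym0 _ pt B)).
rewrite (eq_bigr (fun=> Sym pt B x)) => [|s hs]; last first.
  by apply: Sym_sb; apply: inW_sub hs.
by rewrite sumr_const mulr_natl.
Qed.

Lemma Delta_rem B t : uniq B -> t \in B -> Delta B =
  Delta (rem t B) * head_poles B t * \prod_(b <- [seq b <- B | pt b == pt t] | b != t) ('X_t - 'X_b).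
Proof.
move=> uB tB; rewrite (Delta_perm _ _ (perm_to_rem tB)).
rewrite [in LHS]/Delta big_cons; set B' := rem t B.
have tB' : t \notin B' by rewrite mem_rem_uniq // inE eqxx.
have -> : \prod_(b <- t :: B' | (b != t) && (pt b == pt t)) ('X_t - 'X_b) =
          \prod_(b <- [seq b <- B | pt b == pt t] | b != t) ('X_t - 'X_b) :> P.
  rewrite big_filter_cond (perm_big _ (perm_to_rem tB)) /=.
  by apply: eq_bigl => b; rewrite andbC.
rewrite mulrC; congr (_ * _); rewrite (eq_big_seq (fun a =>
  (if pt a == pt t then 'X_a - 'X_t else 1) *
  \prod_(b <- B' | (b != a) && (pt b == pt a)) ('X_a - 'X_b))); last first.
  move=> a ha; rewrite big_cons; have -> : t != a by apply: contraNneq tB' => ->.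
  by rewrite [pt t == _]eq_sym /=; case: ifP => _; rewrite ?mul1r.
by rewrite big_split /= -big_mkcond mulrC.
Qed.

(** The factor t^(m-1), where m is the number of variables with the value of t, turns
    symmetrization into Lagrange interpolation: the sum over all t' of the same value
    of X_t'^(m-1) divided by the product of the X_t' - X_b equals 1. *)
Lemma Sym_leading B t : uniq B -> t \in B ->
  exists k : F, k != 0 /\
  Sym pt B ('X_t ^+ (size [seq b <- B | pt b == pt t]).-1 * (Delta (rem t B) * head_poles B t)) =
  k *: Delta B.
Proof.
move=> uB tB; set l := [seq b <- B | pt b == pt t]; set m := size l.
have tl : t \in l by rewrite mem_filter eqxx.
have ul : uniq l by apply: filter_uniq.
have m0 : (0 < m)%N by rewrite /m; case: (l) tl.
pose T := @FracField.tofrac P; pose y a := T 'X_a.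
have yinj : injective y.
  move=> a b /eqP; rewrite tofrac_eq => /eqP e; apply/eqP/negPn/negP => ne.
  by have := lin_neq0 (0 : F) ne; rewrite -linE e subrr eqxx.
pose ph a := y a ^+ m.-1 / \prod_(b <- l | b != a) (y a - y b).
have lE a : (\prod_(b <- map y l | b != y a) (y a - b)) = \prod_(b <- l | b != a) (y a - y b).
  by rewrite big_map; apply: eq_bigl => b; rewrite (inj_eq yinj).
have sum1 : \sum_(a <- l) ph a = 1.
  have := @lagrange_leading _ (map y l); rewrite (map_inj_uniq yinj) size_map => /(_ ul m0) <-.
  by rewrite big_map; apply: eq_bigr => a _; rewrite /ph lE.
have Wl s : W B s -> perm_eq (map s l) l.
  move=> hs; apply: uniq_perm => //; first by rewrite map_inj_uniq //; apply: perm_inj.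
  move=> b; rewrite -[b](permKV s) mem_map; last exact: perm_inj.
  by rewrite !mem_filter (inW_mem _ hs); have /inWP[h _] := hs; rewrite h.
set x := 'X_t ^+ m.-1 * _.
have nzl a : \prod_(b <- l | b != a) (y a - y b) != 0.
  rewrite prodf_seq_neq0; apply/allP => b _; apply/implyP => ne.
  by rewrite subr_eq0 (inj_eq yinj) eq_sym.
have Tx s : W B s -> T (sb s x) = T (Delta B) * ph (s t).
  move=> hs; rewrite /ph mulrCA; apply: (mulIf (nzl (s t))).
  rewrite -!mulrA mulVf ?mulr1 // /x rmorphM rmorphXn /= sbX.
  have -> : \prod_(b <- l | b != s t) (y (s t) - y b) =
      T (sb s (\prod_(b <- l | b != t) ('X_t - 'X_b))).
    rewrite -[LHS](perm_big _ (Wl s hs)) big_map rmorph_prod /T rmorph_prod; apply: eq_big => b /=.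
      by rewrite (inj_eq perm_inj).
    by move=> _; rewrite !rmorphB /= !sbX.
  rewrite /T rmorphM rmorphXn /= -mulrA -rmorphM -rmorphM /=.
  by rewrite -Delta_rem // sb_Delta // mulrC.
have TS : T (Sym pt B x) = T (Delta B) * \sum_(s | W B s) ph (s t).
  by rewrite /Sym /T rmorph_sum mulr_sumr; apply: eq_bigr => s hs; apply: Tx.
have count : m%:R * \sum_(s | W B s) ph (s t) = #|[pred s | W B s]|%:R.
  have -> : m%:R * \sum_(s | W B s) ph (s t) = \sum_(c <- l) \sum_(s | W B s) ph (s c).
    rewrite mulr_natl /m -[size l](count_predT l) -iter_addr_0 -big_const_seq.
    apply: eq_big_seq => c; rewrite mem_filter => /andP[/eqP e hc].
    rewrite (reindex_inj (mulgI (tperm t c))) /=; apply: eq_big => s.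
      by rewrite inWMl // inW_tperm.
    by move=> _; rewrite permM tpermL.
  rewrite exchange_big /= (eq_bigr (fun=> 1)) => [|s hs]; last first.
    by rewrite -[RHS]sum1 -[RHS](perm_big _ (Wl s hs)) big_map.
  by rewrite sumr_const.
set N := #|_| in count; have N0 : (0 < N)%N by apply: inW_card_gt0.
have nat_neq0 k : (0 < k)%N -> k%:R != 0 :> F by case: k => // k _; apply: char0.
exists (N%:R / m%:R); split; first by rewrite mulf_neq0 ?invr_eq0 ?nat_neq0.
have mP : (m%:R : P) != 0.
  by rewrite -(rmorph_nat (@mpolyC n F)) mpolyC_eq0 nat_neq0.
have e2 : m%:R * Sym pt B x = N%:R * Delta B.
  apply/eqP; rewrite -tofrac_eq; apply/eqP; rewrite !tofracM !rmorph_nat -/T.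
  by rewrite TS mulrCA count mulrC.
apply: (mulfI mP); rewrite e2 -mul_mpolyC mulrA; congr (_ * _).
by rewrite -!(rmorph_nat (@mpolyC n F)) -mpolyCM mulrC divfK // nat_neq0.
Qed.

(** E is invariant under all permutations, so multiplying by t^(m-1) and symmetrizing
    recovers E up to a nonzero constant. *)
Lemma in_spanT_in_span B t E : uniq B -> t \in B -> (forall s, W B s -> sb s E = E) ->
  in_spanT pt dn ar B t E -> in_span pt local_kernel B E.
Proof.
move=> uB tB iE [Ls [hL eL]]; have [k [nzk ek]] := Sym_leading uB tB.
set x := 'X_t ^+ _ in ek; set N1 := #|[pred s | W (rem t B) s]|.
exists [seq (y.1, (k^-1 * N1%:R) *: (x * y.2)) | y <- Ls]; split=> [z /mapP[y hy ->]|].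
  exact: (hL y).
have sB : {subset rem t B <= B} by apply: mem_rem.
have key : \sum_(y <- Ls) N1%:R * Sym pt B (x * (y.2 * ordprod local_kernel (before y.1) B)) = k *: (Delta B * E).
  rewrite scalerAl -ek [RHS]mulrC -SymM //.
  rewrite (_ : E * (x * _) = x * (Delta (rem t B) * head_poles B t * E)); last by ring.
  rewrite eL mulr_sumr Sym_sum; apply: eq_bigr => y _.
  rewrite -Sym_Sym //; congr (Sym _ _ _); rewrite SymM // => s /inWP[_ hs].
  by rewrite /x rmorphXn /= sbX hs // mem_rem_uniq // inE eqxx.
rewrite big_map /=; apply: (scalerI nzk); rewrite -key scaler_sumr; apply: eq_bigr => y _.
have SymZ c (z : P) : Sym pt B (c *: z) = c *: Sym pt B z.
  by rewrite -!mul_mpolyC SymM // => s _; rewrite sbC.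
rewrite -scalerAl SymZ scalerA [k * _]mulrA mulfV // mul1r -mulrA -mul_mpolyC.
by rewrite (rmorph_nat (@mpolyC n F)).
Qed.

(** By induction on the number of variables: a variable t of maximal rank may head the
    first string of a family, so that string_condT_in_spanT applies, and interpolation restores
    the symmetry. *)
Theorem local_theorem B (E : P) : uniq B -> (forall s, W B s -> sb s E = E) ->
  string_cond B E -> in_span pt local_kernel B E.
Proof.
have [N] := ubnP (size B); elim: N B E => // N IH B E szB uB iE cE.
have IHB R (E' : P) : uniq R -> (size R < size B)%N ->
    (forall s, W R s -> sb s E' = E') -> string_cond R E' -> in_span pt local_kernel R E'.
  by move=> uR szR; apply: IH => //; apply: leq_trans szR _; rewrite -ltnS.
have [eB|nB] := eqVneq B [::].
  rewrite eB in iE *; exists [:: ([::], E)]; split=> [x|]; first by rewrite inE => /eqP ->.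
  rewrite big_seq1 /Delta /ordprod !big_nil mul1r mulr1 /Sym (big_pred1 1%g).
    by rewrite sb_id // => a; rewrite perm1.
  move=> s; apply/idP/eqP => [/inWP[_ h]|->]; last exact: inW1.
  by apply/permP => a; rewrite perm1 h.
have [t [tB tmax]] : exists t, t \in B /\ forall b, b \in B -> (rk (pt b) <= rk (pt t))%N.
  elim: B nB {IH IHB szB uB iE cE} => // a B IHl _; have [->|nB] := eqVneq B [::].
    by exists a; rewrite inE eqxx; split=> // b; rewrite inE => /eqP ->.
  have [t [tB ht]] := IHl nB; case: (leqP (rk (pt a)) (rk (pt t))) => h.
    by exists t; rewrite inE tB orbT; split=> // b; rewrite inE => /orP[/eqP->//|/ht].
  exists a; rewrite inE eqxx; split=> // b; rewrite inE => /orP[/eqP->//|/ht h'].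
  by apply: leq_trans h' _; apply: ltnW.
apply: (in_spanT_in_span uB tB iE); apply: (string_condT_in_spanT ls char0 uB tB tmax IHB).
  by move=> s hs; apply: iE; apply: inW_sub hs => b; apply: mem_rem.
by move=> s S hS pS; apply: cE.
Qed.
End LocalTheorem.

(** * Local structure at a proper ideal *)

Section Decide.
Variable R : comNzRingType.

(** The elements are treated one by one: if adding x to the ideal gives 1, then x is
    already invertible modulo the ideal; otherwise x is added. *)
Lemma ideal_decide (l : seq R) (J : R -> Prop) : ideal J -> ~ J 1 ->
  exists H : R -> Prop, [/\ ideal H, forall x, J x -> H x, ~ H 1 &
    forall x, x \in l -> H x \/ inv_mod H x].
Proof.
elim: l J => [|x l IH] J idJ nJ; first by exists J.
pose J1 z := exists r j, J j /\ z = r * x + j.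
have idJ1 : ideal J1.
  split=> [|a b [r [j [hj ->]]] [r' [j' [hj' ->]]]|a b [r [j [hj ->]]]].
  - by exists 0, 0; split; [exact: ideal0 | ring].
  - by exists (r + r'), (j + j'); split; [exact: idealD | ring].
  - by exists (a * r), (a * j); split; [exact: idealM | ring].
have [[r [j [hj e1]]]|nJ1] := excluded_middle_informative (J1 1).
  have [H [idH sub nH dec]] := IH J idJ nJ; exists H; split=> // y.
  rewrite inE => /orP[/eqP -> |/dec //]; right; exists r.
  have -> : x * r - 1 = - j by rewrite e1; ring.
  by apply: idealN => //; apply: sub.
have [H [idH sub nH dec]] := IH J1 idJ1 nJ1; exists H; split=> //.
  by move=> y hy; apply: sub; exists 0, y; split=> //; rewrite mul0r add0r.
move=> y; rewrite inE => /orP[/eqP -> |/dec //]; left; apply: sub.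
by exists 1, 0; split; [exact: ideal0 | rewrite mul1r addr0].
Qed.
End Decide.

Definition truth (Pr : Prop) : bool := if excluded_middle_informative Pr then true else false.
Lemma truthP (Pr : Prop) : reflect Pr (truth Pr).
Proof. by rewrite /truth; case: excluded_middle_informative => h; constructor. Qed.

Section Representative.
Variables (T : finType) (e : T -> T -> Prop).
Hypotheses (erefl : forall x, e x x) (esym : forall x y, e x y -> e y x).
Hypothesis etrans : forall x y z, e x y -> e y z -> e x z.

Definition repr x : T := odflt x [pick y | truth (e x y)].
Lemma repr_rel x : e x (repr x).
Proof. by rewrite /repr; case: pickP => [y /truthP //|_] /=. Qed.
Lemma repr_eq x y : e x y -> repr x = repr y.
Proof.
move=> h; rewrite /repr.
have -> : [pick z | truth (e x z)] = [pick z | truth (e y z)].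
  apply: eq_pick => z; apply/truthP/truthP; apply: etrans => //; exact: esym.
by case: pickP => // /(_ y) /truthP; case.
Qed.
Lemma repr_inj x y : repr x = repr y -> e x y.
Proof. by move=> h; apply: etrans (repr_rel x) _; rewrite h; apply/esym/repr_rel. Qed.
End Representative.

Section GlobalKernel.
Variables (Q : quiver) (F : fieldType) (hbar : F) (u : arrow Q -> F).
Notation I := (vert Q).

(** Nonnegative, nonzero combinations of hbar and of the arrow weights. *)
Inductive cone : F -> Prop :=
| cone_hbar : cone hbar
| cone_arrow g : cone (u g)
| cone_opp g : cone (hbar - u g)
| cone_add x y : cone x -> cone y -> cone (x + y).

Variables (n : nat) (col : 'I_n -> I).
Notation P := {mpoly F[n]}.

(** The kernel zeta_(col a, col b)(X_a - X_b), with its pole X_a - X_b replaced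
    by the factor X_b - X_a of Delta. *)
Definition zeta_kernel (a b : 'I_n) : P :=
  (if col a == col b then lin a b hbar * lin b a 0 else 1) *
  (\prod_(g | (src g == col a) && (tgt g == col b)) lin b a (u g) *
   \prod_(g | (tgt g == col a) && (src g == col b)) lin b a (hbar - u g)).

Definition weight (c : F) : Prop :=
  [\/ c = 0, c = hbar, exists g, c = u g | exists g, c = hbar - u g].

Section LocalStructure.
Variable H : P -> Prop.
Hypotheses (idH : ideal H) (properH : ~ H 1).
Hypothesis dec : forall a b c, weight c -> H (lin a b c) \/ inv_mod H (lin a b c).
Hypothesis cone_neq0 : forall c, cone c -> c != 0.
Hypothesis char0 : forall k, k.+1%:R != 0 :> F.

Lemma linD a b c (x y : F) : H (lin a b x) -> H (lin b c y) -> H (lin a c (x + y)).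
Proof.
move=> h1 h2; have -> : lin a c (x + y) = lin a b x + lin b c y.
  by rewrite /lin rmorphD /=; ring.
exact: idealD.
Qed.
Lemma linN a b (x : F) : H (lin a b x) -> H (lin b a (- x)).
Proof.
move=> h; have -> : lin b a (- x) = - lin a b x by rewrite /lin rmorphN /=; ring.
exact: idealN.
Qed.
Lemma lin0 a : H (lin a a 0).
Proof. by rewrite /lin mpolyC0 subrr subr0; apply: ideal0. Qed.

Lemma constH c : H c%:MP -> c = 0.
Proof.
move=> h; apply/eqP/negPn/negP => nz; apply: properH.
have -> : (1 : P) = c^-1%:MP * c%:MP by rewrite -mpolyCM mulVf.
exact: idealM.
Qed.

Lemma linH_uniq a b x y : H (lin a b x) -> H (lin a b y) -> x = y.
Proof.
move=> h1 h2; apply/eqP; rewrite -subr_eq0; apply/eqP/constH.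
have -> : (x - y)%:MP = lin a b y - lin a b x by rewrite /lin rmorphB /=; ring.
exact: idealB.
Qed.

Definition samept a b := col a = col b /\ H (lin a b 0).
Definition sameline a b := col a = col b /\ exists m : int, H (lin a b (hbar *~ m)).
Definition linked a b := exists c, H (lin a b c).

Lemma samept_refl a : samept a a. Proof. by split=> //; apply: lin0. Qed.
Lemma samept_sym a b : samept a b -> samept b a.
Proof. by case=> e /linN; rewrite oppr0. Qed.
Lemma samept_trans a b c : samept a b -> samept b c -> samept a c.
Proof. by move=> [e h] [e' h']; split; rewrite ?e //; have := linD h h'; rewrite addr0. Qed.
Lemma sameline_refl a : sameline a a.
Proof. by split=> //; exists 0; rewrite mulr0z; apply: lin0. Qed.
Lemma sameline_sym a b : sameline a b -> sameline b a.
Proof. by case=> e [m /linN h]; split=> //; exists (- m); rewrite mulrNz. Qed.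
Lemma sameline_trans a b c : sameline a b -> sameline b c -> sameline a c.
Proof.
move=> [e [m h]] [e' [m' h']]; split; rewrite ?e //; exists (m + m').
by rewrite mulrzDr; apply: linD h h'.
Qed.
Lemma linked_refl a : linked a a. Proof. by exists 0; apply: lin0. Qed.
Lemma linked_sym a b : linked a b -> linked b a.
Proof. by case=> c /linN h; exists (- c). Qed.
Lemma linked_trans a b c : linked a b -> linked b c -> linked a c.
Proof. by move=> [x h] [y h']; exists (x + y); apply: linD h h'. Qed.

Definition pt := repr samept.
Definition ln := repr sameline.

Lemma ptE a b : pt a = pt b <-> samept a b.
Proof.
split; first exact: (repr_inj samept_refl samept_sym samept_trans).
exact: (repr_eq samept_refl samept_sym samept_trans).
Qed.
Lemma ptP a : samept a (pt a). Proof. exact: repr_rel samept_refl _. Qed.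
Lemma pt_idem a : pt (pt a) = pt a.
Proof. exact/ptE/samept_sym/ptP. Qed.
Lemma pt_col a : col (pt a) = col a. Proof. by have [-> _] := ptP a. Qed.
Lemma lnE a b : ln a = ln b <-> sameline a b.
Proof.
split; first exact: (repr_inj sameline_refl sameline_sym sameline_trans).
exact: (repr_eq sameline_refl sameline_sym sameline_trans).
Qed.

(** A proper ideal H plays the role of a point whose coordinates need not be known:
    only the differences of the coordinates that are constant modulo H matter. They
    are recorded as the distances to a chosen representative of each class of
    linked variables. *)
Definition off a : F := epsilon (inhabits 0) (fun c => H (lin a (repr linked a) c)).

Lemma offP a : H (lin a (repr linked a) (off a)).
Proof. exact: (epsilon_spec (inhabits 0) _ (repr_rel linked_refl a)). Qed.

Lemma off_eq a b c : H (lin a b c) -> off a - off b = c.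
Proof.
move=> h; have e := repr_eq linked_refl linked_sym linked_trans (ex_intro _ c h : linked a b).
have hb := linN (offP b); rewrite -e in hb.
exact: linH_uniq (linD (offP a) hb) h.
Qed.

Lemma lin_congl a a' b c : samept a a' -> H (lin a b c) -> H (lin a' b c).
Proof. by move=> /samept_sym [_ h] /(linD h); rewrite add0r. Qed.
Lemma lin_congr a b b' c : samept b b' -> H (lin a b c) -> H (lin a b' c).
Proof. by move=> [_ h] h'; have := linD h' h; rewrite addr0. Qed.
Lemma lin_pt a b c : H (lin (pt a) (pt b) c) <-> H (lin a b c).
Proof.
split=> h; first by apply: lin_congl (samept_sym (ptP a)) (lin_congr (samept_sym (ptP b)) h).
exact: lin_congl (ptP a) (lin_congr (ptP b) h).
Qed.

Definition ldn : rel 'I_n := fun v w =>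
  [&& pt v == v, pt w == w & truth (col v = col w /\ H (lin v w hbar))].
Definition lar (v w : 'I_n) : nat :=
  (\sum_(g | (src g == col v) && (tgt g == col w)) truth (H (lin w v (u g))) +
   \sum_(g | (tgt g == col v) && (src g == col w)) truth (H (lin w v (hbar - u g))))%N.
Definition llt (v w : 'I_n) : Prop := exists c, cone c /\ H (lin w v c).
Definition lrk (v : 'I_n) : nat := #|[pred w | truth (llt w v)]|.

Lemma ldnE a b : ldn (pt a) (pt b) = truth (col a = col b /\ H (lin a b hbar)).
Proof. by rewrite /ldn !pt_idem !eqxx /= !pt_col; apply/truthP/truthP; rewrite lin_pt. Qed.
Lemma larE a b : lar (pt a) (pt b) =
  (\sum_(g | (src g == col a) && (tgt g == col b)) truth (H (lin b a (u g))) +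
   \sum_(g | (tgt g == col a) && (src g == col b)) truth (H (lin b a (hbar - u g))))%N.
Proof.
rewrite /lar !pt_col; congr (_ + _)%N; apply: eq_bigr => g _; congr nat_of_bool;
  by apply/truthP/truthP; rewrite lin_pt.
Qed.

Lemma llt_irr v : ~ llt v v.
Proof.
move=> [c [hc h]]; have := linH_uniq h (lin0 v) => e.
by have := cone_neq0 hc; rewrite e eqxx.
Qed.
Lemma llt_trans v w x : llt v w -> llt w x -> llt v x.
Proof.
move=> [c [hc h]] [c' [hc' h']]; exists (c' + c); split; first exact: cone_add.
exact: linD h' h.
Qed.
Lemma llt_rk v w : llt v w -> (lrk v < lrk w)%N.
Proof.
move=> h; apply: proper_card; apply/properP; split.
  by apply/subsetP => x; rewrite !inE => /truthP h'; apply/truthP/(llt_trans h' h).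
by exists v; rewrite !inE; [apply/truthP | apply/truthP/llt_irr].
Qed.

Lemma lar_lt v w : lar v w != 0%N -> exists c, (exists g, c = u g \/ c = hbar - u g) /\ H (lin w v c).
Proof.
rewrite /lar addn_eq0 negb_and => /orP[]; rewrite sum_nat_seq_neq0 => /hasP[g _ /andP[_]];
  rewrite eqb0 negbK => /truthP h.
- by exists (u g); split=> //; exists g; left.
- by exists (hbar - u g); split=> //; exists g; right.
Qed.

Lemma cone_add_nat x k : cone x -> cone (x + hbar *+ k).
Proof.
move=> hx; elim: k => [|k IH]; first by rewrite mulr0n addr0.
rewrite mulrSr addrA; apply: cone_add => //; exact: cone_hbar.
Qed.

(** Otherwise 0 is one of u + k hbar and (hbar - u) + k hbar with k >= 0. *)
Lemma weight_not_multiple g (m : int) : u g <> hbar *~ m.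
Proof.
case: m => [[|k]|k] e.
- by have := cone_neq0 (cone_arrow g); rewrite e mulr0z eqxx.
- have := cone_neq0 (cone_add_nat k (cone_opp g)); rewrite e -pmulrn mulrSr.
  by rewrite opprD addrCA subrr addr0 addNr eqxx.
have := cone_neq0 (cone_add_nat k.+1 (cone_arrow g)).
by rewrite e NegzE mulrNz -pmulrn addNr eqxx.
Qed.

(** Positivity of the cone makes llt a strict order, and the number of predecessors
    is a rank. An arrow cannot stay on a line because no weight is a multiple of
    hbar. *)
Lemma local_structureP : local_structure ln ldn lar lrk.
Proof.
split.
- move=> v w w' /and3P[_ /eqP ew /truthP[e h]] /and3P[_ /eqP ew' /truthP[e' h']].
  rewrite -ew -ew'; apply/ptE; split; first by rewrite -e -e'.
  by have := linD (linN h) h'; rewrite addNr.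
- move=> v w /and3P[_ _ /truthP[e h]]; apply: llt_rk; exists hbar; split=> //.
  exact: cone_hbar.
- move=> v w /and3P[_ _ /truthP[e h]]; apply/lnE; split=> //; exists 1.
  by rewrite mulr1z.
- move=> v w /lar_lt [c [[g hg] h]]; apply: llt_rk; exists c; split=> //.
  by case: hg => ->; [exact: cone_arrow | exact: cone_opp].
- move=> v w /lar_lt [c [[g hg] h]]; apply/eqP => /lnE /sameline_sym [_ [m hm]].
  have ec := linH_uniq h hm; case: hg => eg; rewrite eg in ec.
    exact: (@weight_not_multiple g m).
  apply: (@weight_not_multiple g (1 - m)); rewrite mulrzBr mulr1z -ec.
  by rewrite opprB addrC subrK.
move=> v' v w /and3P[_ _ /truthP[e h]]; rewrite /lar e addnC; congr (_ + _)%N.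
- apply: eq_big => [g|g _]; first by rewrite andbC.
  congr nat_of_bool; apply/truthP/truthP => h'.
    by have := linD h (linN h'); rewrite opprB addrC subrK.
  have := linD (linN h') h; rewrite addrC => h''; exact: h''.
apply: eq_big => [g|g _]; first by rewrite andbC.
congr nat_of_bool; apply/truthP/truthP => h'.
  exact: linD h (linN h').
by have := linD (linN h') h; rewrite opprB subrK.
Qed.

Definition center : P -> P := ev (fun k => 'X_k - (off k)%:MP).
Definition uncenter : P -> P := ev (fun k => 'X_k + (off k)%:MP).
HB.instance Definition _ := GRing.RMorphism.copy center (ev (fun k => 'X_k - (off k)%:MP)).
HB.instance Definition _ := GRing.RMorphism.copy uncenter (ev (fun k => 'X_k + (off k)%:MP)).

Lemma shX k : center 'X_k = 'X_k - (off k)%:MP. Proof. exact: evX. Qed.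
Lemma unshK p : center (uncenter p) = p.
Proof.
rewrite /center /uncenter ev_comp -[RHS]ev_id; apply: ev_eq => k.
by rewrite rmorphD /= evX evC subrK.
Qed.

Lemma lin_sh a b c : H (lin a b c) -> lin a b c = center ('X_a - 'X_b).
Proof. by move=> /off_eq <-; rewrite rmorphB /= !shX /lin rmorphB /=; ring. Qed.

Lemma prod_lin_sh (C : pred (arrow Q)) (c : arrow Q -> F) a b :
  (forall g, weight (c g)) ->
  exists r, inv_mod H r /\ \prod_(g | C g) lin b a (c g) =
    center ('X_a - 'X_b) ^+ (\sum_(g | C g) truth (H (lin b a (c g)))) * r.
Proof.
move=> hc; exists (\prod_(g | C g) (if truth (H (lin b a (c g))) then - 1 else lin b a (c g))); split.
  apply: inv_mod_prod => // g _; case: truthP => [_|nh]; first exact/inv_modN/inv_mod1.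
  by case: (dec b a (hc g)).
rewrite expr_sum -big_split; apply: eq_bigr => g _ /=; case: truthP => [h|_].
  by rewrite expr1 (lin_sh h) mulrN1 !rmorphB /= opprB.
by rewrite expr0 mul1r.
Qed.

Fact mul_regroup (R : comNzRingType) (a b x y r0 r1 r2 : R) :
  a * b * r0 * (x * r1 * (y * r2)) = x * y * a * b * (r0 * (r1 * r2)).
Proof. by ring. Qed.

(** Modulo H each linear factor of the kernel is zero, and then it is a difference
    of centred coordinates, or invertible. *)
Lemma zeta_kernel_factor a b : exists r, inv_mod H r /\ zeta_kernel a b = center (local_kernel F pt ldn lar a b) * r.
Proof.
have [|r1 [i1 e1]] := @prod_lin_sh (fun g => (src g == col a) && (tgt g == col b)) u a b _.
  by move=> g; apply: Or43; exists g.
have [|r2 [i2 e2]] :=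
  @prod_lin_sh (fun g => (tgt g == col a) && (src g == col b)) (fun g => hbar - u g) a b _.
  by move=> g; apply: Or44; exists g.
suff [r0 [i0 e0]] : exists r, inv_mod H r /\
    (if col a == col b then lin a b hbar * lin b a 0 else 1) =
    center ('X_a - 'X_b) ^+ ldn (pt a) (pt b) * center (if pt a == pt b then 'X_b - 'X_a else 1) * r.
  exists (r0 * (r1 * r2)); split; first by do 2?apply: inv_modM.
  rewrite /zeta_kernel e0 e1 e2 /local_kernel rmorphM rmorphXn /= larE !exprD.
  exact: mul_regroup.
rewrite ldnE; case: eqP => [ec|nc]; last first.
  exists 1; split; first exact: inv_mod1.
  case: truthP => [[]//|_]; case: eqP => [/ptE[]//|_].
  by rewrite expr0 rmorph1 !mul1r.
exists ((if truth (H (lin a b hbar)) then 1 else lin a b hbar) *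
        (if pt a == pt b then 1 else lin b a 0)); split.
  apply: inv_modM => //.
    case: truthP => [_|nh]; first exact: inv_mod1.
    by case: (dec a b (Or42 _ _ _ (erefl hbar))).
  case: eqP => [_|npt]; first exact: inv_mod1.
  case: (dec b a (Or41 _ _ _ (erefl 0))) => // h; case: npt; apply/ptE.
  by apply/samept_sym; split.
have -> : truth (col a = col b /\ H (lin a b hbar)) = truth (H (lin a b hbar)).
  by apply/truthP/truthP; [case | split].
case: truthP => [h|_]; rewrite ?expr1 ?expr0 ?mul1r ?(lin_sh h);
  case: eqP => [/ptE/samept_sym[_ h']|_]; rewrite ?rmorph1 ?mulr1 ?mul1r ?(lin_sh h') //.
by rewrite mulrC.
Qed.

End LocalStructure.
End GlobalKernel.

(** * Divisibility at strings *)

Arguments to_head : simpl never.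

Section Counting.

Lemma count_eq (k : nat) (v : int) :
  (\sum_(j < k) (j%:Z == v) = ((0 <= v)%R && (v < k%:Z)%R))%N.
Proof. by elim: k => [|k IH]; rewrite ?big_ord0 ?big_ord_recr /= ?IH; lia. Qed.

Lemma count_interval (k : nat) (lo hi : int) (N : int) : 0 <= N -> hi - lo <= N ->
  (\sum_(j < k) ((lo <= j%:Z)%R && (j%:Z < hi)%R) <= absz N)%N.
Proof.
move=> N0 hN; suff : (\sum_(j < k) ((lo <= j%:Z)%R && (j%:Z < hi)%R))%N%:Z <=
    Num.max 0 (Num.min hi k%:Z - lo) by lia.
elim: k => [|k IH]; first by rewrite big_ord0; lia.
by rewrite big_ord_recr /=; move: IH; move: (\sum_(_ < k) _)%N => S; lia.
Qed.

(** j and j' number two strings downwards. Each j has at most one partner j', and the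
    conditions on j define an interval of length at most chi; the head j = 0 is left
    out because no arrow leaves it. *)
Lemma chi_count_down (K K' : nat) (c : int) :
  (\sum_(j < K.+1) \sum_(j' < K'.+1)
     ((0 < j)%N && (K'%:Z - j'%:Z - (K%:Z - j%:Z) == c)%R) <= chi K.+1 K'.+1 c)%N.
Proof.
apply: (@leq_trans (\sum_(j < K.+1)
   ((Num.max 1 (K%:Z - K'%:Z + c) <= j%:Z)%R && (j%:Z < Num.min K%:Z (K%:Z + c) + 1)%R))%N).
  apply: leq_sum => j _; case: (posnP j) => [->|j0] /=; first by rewrite big1.
  rewrite (eq_bigr (fun j' : 'I_K'.+1 => nat_of_bool (j'%:Z == K'%:Z - K%:Z + j%:Z - c))).
    by rewrite count_eq; have := ltn_ord j; lia.
  by move=> j' _; congr nat_of_bool; lia.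
by rewrite /chi; apply: count_interval; lia.
Qed.

Lemma chi_count_up (K K' : nat) (c : int) :
  (\sum_(j < K.+1) \sum_(j' < K'.+1)
     ((0 < j)%N && (K%:Z - j%:Z - (K'%:Z - j'%:Z) + 1 == c)%R) <= chi K'.+1 K.+1 c)%N.
Proof.
apply: (@leq_trans (\sum_(j < K.+1)
   ((Num.max 1 (K%:Z - K'%:Z + 1 - c) <= j%:Z)%R && (j%:Z < Num.min K%:Z (K%:Z + 1 - c) + 1)%R))%N).
  apply: leq_sum => j _; case: (posnP j) => [->|j0] /=; first by rewrite big1.
  rewrite (eq_bigr (fun j' : 'I_K'.+1 => nat_of_bool (j'%:Z == c - 1 - K%:Z + j%:Z + K'%:Z))).
    by rewrite count_eq; have := ltn_ord j; lia.
  by move=> j' _; congr nat_of_bool; lia.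
by rewrite /chi; apply: count_interval; lia.
Qed.
End Counting.

(** Ring identities, isolated so that the terms they are applied to need not be
    normalized. *)
Fact shift_regroup (R : zmodType) (a b o o' d w : R) :
  a + o' - (b + o) + (d - w) = a - b + (o' - o + d - w).
Proof. by rewrite opprD !addrA; congr (_ - _); rewrite -!addrA; congr (_ + _);
  rewrite addrCA; congr (_ + _); rewrite addrCA. Qed.

Fact shift_regroup2 (R : comNzRingType) (a b o o' : R) :
  a - b = o' + a - (o + b) - (o' - o).
Proof. by ring. Qed.
Fact shift_regroup3 (R : comNzRingType) (o o' c w : R) :
  - (w - (o' - o) - c) = o' - o + c - w.
Proof. by ring. Qed.

Fact shift_regroup4 (R : comNzRingType) (a b o o' : R) :
  o' - o + (a - b) - (o' + a - (o + b)) = 0.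
Proof. by ring. Qed.
Fact shift_regroup5 (R : comNzRingType) (a b o o' h : R) :
  o - o' + (b - a + h) - (h - (o' + a - (o + b))) = 0.
Proof. by ring. Qed.
Fact shift_regroup6 (R : comNzRingType) (a b o o' h : R) :
  b - a + h = h - (o' + a - (o + b)) - (o - o').
Proof. by ring. Qed.

Section StringConditions.
Variables (Q : quiver) (F : fieldType) (hbar : F) (u : arrow Q -> F).
Notation I := (vert Q).
Variables (n : nat) (col : 'I_n -> I).
Notation P := {mpoly F[n]}.

Definition scol (i : I) (s : seq 'I_n) : bool := if s is a :: _ then col a == i else false.

Definition arrow_factor (g : arrow Q) (k k' : nat) (x : P) : P :=
  \prod_(t < (k + k').+1) (x + (hbar *~ (t%:Z - k%:Z) - u g)%:MP) ^+ chi k k' (t%:Z - k%:Z).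

(** x gives the position of the first element of each string, from which the string
    goes up by steps of hbar. *)
Definition family_div (S : seq (seq 'I_n)) (x : seq 'I_n -> P) : P :=
  \prod_(g : arrow Q) \prod_(s <- S | scol (src g) s) \prod_(s' <- S | scol (tgt g) s')
    arrow_factor g (size s) (size s') (x s' - x s).

Fixpoint sval (S : seq (seq 'I_n)) (x : seq 'I_n -> P) (k : 'I_n) : P :=
  if S is s :: S' then (if k \in s then x s + (hbar *+ index k s)%:MP else sval S' x k) else 0.

Definition monochrome (s : seq 'I_n) : bool :=
  if s is a :: s' then all (fun b => col b == col a) s' else false.

Definition string_divisible (E : P) : Prop := forall S x,
  perm_eq (flatten S) (enum 'I_n) -> all monochrome S -> dv (family_div S x) (ev (sval S x) E).

Definition arrow_factor_if (g : arrow Q) (s s' : seq 'I_n) (x : P) : P :=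
  if scol (src g) s && scol (tgt g) s' then arrow_factor g (size s) (size s') x else 1.

Lemma family_div_cons s S x :
  dv (\prod_(s' <- S) \prod_(g : arrow Q)
        (arrow_factor_if g s s' (x s' - x s) * arrow_factor_if g s' s (x s - x s')) * family_div S x) (family_div (s :: S) x).
Proof.
rewrite exchange_big -big_split /=; apply: dv_prod => g _.
rewrite big_split big_cons.
pose A := \prod_(s' <- S) arrow_factor_if g s s' (x s' - x s).
pose B := \prod_(s' <- S) arrow_factor_if g s' s (x s - x s').
pose C := \prod_(s1 <- S | scol (src g) s1) \prod_(s' <- S | scol (tgt g) s')
  arrow_factor g (size s1) (size s') (x s' - x s1).
rewrite -/A -/B -/C.
have eA : A = (if scol (src g) s then
    \prod_(s' <- S | scol (tgt g) s') arrow_factor g (size s) (size s') (x s' - x s) else 1).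
  rewrite /A /arrow_factor_if; case: (scol _ s) => /=; last by rewrite big1.
  by rewrite -big_mkcond.
have -> : \prod_(j <- S | scol (src g) j)
     \prod_(s' <- s :: S | scol (tgt g) s') arrow_factor g (size j) (size s') (x s' - x j) = B * C.
  rewrite /B /C [in LHS]big_mkcond [X in _ = _ * X]big_mkcond -big_split.
  apply: eq_bigr => s1 _.
  rewrite big_cons /arrow_factor_if; case: (scol _ s1); case: (scol (tgt g) s) => /=;
  by rewrite ?mul1r ?mulr1.
rewrite -[A * B * C]mulrA eA; case: (scol (src g) s); last by rewrite mul1r; apply: dv_refl.
apply: dvM; last exact: dv_refl.
rewrite big_cons; case: (scol (tgt g) s); last exact: dv_refl.
exact/dv_mull/dv_refl.
Qed.

Section Localize.
Variable H : P -> Prop.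
Hypotheses (idH : ideal H) (properH : ~ H 1).
Hypothesis dec : forall a b c, weight hbar u c -> H (lin a b c) \/ inv_mod H (lin a b c).
Hypothesis cone_neq0 : forall c, cone hbar u c -> c != 0.
Hypothesis char0 : forall k, k.+1%:R != 0 :> F.
Notation pt := (pt col H).
Notation ln := (ln hbar col H).
Notation ldn := (ldn hbar col H).
Notation lar := (lar hbar u col H).
Notation lrk := (lrk hbar u H).
Notation off := (off H).
Notation below := (dn_var pt ldn).
Notation ls := (local_structureP col idH properH cone_neq0).

Lemma below_col a b : below a b -> col a = col b.
Proof. by rewrite /dn_var ldnE // => /truthP[]. Qed.
Lemma below_off a b : below a b -> off a = off b + hbar.
Proof.
by rewrite /dn_var ldnE // => /truthP[_ /(off_eq idH properH)] <-; rewrite addrC subrK.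
Qed.

Lemma string_col t s a : path below t s -> a \in t :: s -> col a = col t.
Proof.
elim: s t => [|b s IH] t /=; first by rewrite inE => _ /eqP ->.
move=> /andP[h /IH {}IH]; rewrite inE => /orP[/eqP -> //|/IH ->].
by rewrite (below_col h).
Qed.

Lemma string_off t s j : path below t s -> (j <= size s)%N ->
  off (nth t (t :: s) j) = off (last t s) + hbar *+ (size s - j).
Proof.
elim: s t j => [|b s IH] t j /=; first by rewrite leqn0 => _ /eqP ->; rewrite mulr0n addr0.
move=> /andP[h hp]; case: j => [|j] /= hj.
  by rewrite (below_off h) (IH b 0%N hp) // subn0 subn0 mulrSr addrA.
rewrite (set_nth_default b) ?ltnS // IH // subSS.
Qed.

Lemma hbar_inj (c c' : int) : hbar *~ c = hbar *~ c' -> c = c'.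
Proof.
move=> e; apply/eqP; rewrite -subr_eq0; apply/negPn/negP => nz.
have h0 : hbar != 0 by apply: cone_neq0; apply: cone_hbar.
have : hbar *~ (c - c') = 0 by rewrite mulrzBr e subrr.
case: (c - c') nz => -[|k] // _ /eqP.
  by rewrite -pmulrn -mulr_natl mulf_eq0 (negbTE (char0 k)) (negbTE h0).
  by rewrite NegzE mulrNz -pmulrn oppr_eq0 -mulr_natl mulf_eq0 (negbTE (char0 0)) (negbTE h0).
by rewrite NegzE mulrNz -pmulrn oppr_eq0 -mulr_natl mulf_eq0 (negbTE (char0 k.+1)) (negbTE h0).
Qed.

Section Pair.
Variables (t t' : 'I_n) (s s' : seq 'I_n).
Hypotheses (hp : path below t s) (hp' : path below t' s').
Hypothesis no_arrow : forall b, b \in t' :: s' -> lar (pt t) (pt b) = 0%N.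
Let o := off (last t s).
Let o' := off (last t' s').

Lemma pair_sum (f : 'I_n -> 'I_n -> nat) :
  (\sum_(b <- t' :: s') \sum_(a <- t :: s) f a b =
   \sum_(j < (size s).+1) \sum_(j' < (size s').+1) f (nth t (t :: s) j) (nth t' (t' :: s') j'))%N.
Proof.
rewrite exchange_big /= (big_nth t) big_mkord; apply: eq_bigr => j _.
by rewrite (big_nth t') big_mkord.
Qed.

Let scol_rev v w a : path below v w -> a \in v :: w -> scol (col a) (rev (v :: w)).
Proof.
move=> hvw /(string_col hvw) ->; have := mem_rev (v :: w).
case: (rev _) => [|c r] h; first by have := h v; rewrite mem_head.
by rewrite /scol (string_col hvw) // -h mem_head.
Qed.
Let string_pos (v : 'I_n) w a : a \in v :: w -> exists j, (j <= size w)%N /\ a = nth v (v :: w) j.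
Proof. by move=> ha; exists (index a (v :: w)); rewrite nth_index // -ltnS index_mem. Qed.

(** The pairs of elements at the distance given by the weight of g, other than those
    with the head of the first string, are at most chi in number. *)
Lemma divisor_forward g :
  dv (('X_t - 'X_t') ^+ (\sum_(b <- t' :: s') \sum_(a <- t :: s)
        ((src g == col a) && (tgt g == col b) && truth (H (lin b a (u g))))))
     (arrow_factor_if g (rev (t :: s)) (rev (t' :: s'))
        ('X_t' + o'%:MP - ('X_t + o%:MP))).
Proof.
set A := (\sum_(b <- _) _)%N; have [->|A0] := eqVneq A 0%N; first by rewrite expr0; apply: dv1.
have [b0 [a0 [hb0 ha0 hsrc htgt hh]]] : exists b a, [/\ b \in t' :: s', a \in t :: s,
    src g = col a, tgt g = col b & H (lin b a (u g))].
  move: A0; rewrite sum_nat_seq_neq0 => /hasP[b hb /=]; rewrite sum_nat_seq_neq0 => /hasP[a ha /=].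
  by rewrite eqb0 negbK => /andP[/andP[/eqP h1 /eqP h2] /truthP h3]; exists b, a.
rewrite /arrow_factor_if hsrc htgt !scol_rev //= !size_rev /=.
have [j0 [lj0 ea0]] := string_pos ha0; have [j0' [lj0' eb0]] := string_pos hb0.
pose c : int := (size s' - j0')%N%:Z - (size s - j0)%N%:Z.
have ec : o' - o + hbar *~ c - u g = 0.
  have := off_eq idH properH hh; rewrite ea0 eb0 !string_off // -/o -/o' => <-.
  by rewrite /c mulrzBr -!pmulrn; exact: shift_regroup4.
have ltc : (absz (c + (size s).+1%:Z)%R < ((size s).+1 + (size s').+1).+1)%N by rewrite /c; lia.
have etc : (Ordinal ltc)%:Z - (size s).+1%:Z = c by rewrite /= /c; lia.
rewrite /arrow_factor (bigD1 (Ordinal ltc)) //= -[X in _ ^+ chi _ _ X]/((Ordinal ltc)%:Z - _).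
apply: dv_mulr; rewrite -[`|_|%N]/(nat_of_ord (Ordinal ltc)) etc.
have -> : 'X_t' + o'%:MP - ('X_t + o%:MP) + (hbar *~ c - u g)%:MP = 'X_t' - 'X_t :> P.
  rewrite -[RHS]addr0 -[in RHS](mpolyC0 n F) -ec !(rmorphB, rmorphD) /=.
  exact: shift_regroup.
have le : (A <= chi (size s).+1 (size s').+1 c)%N.
  apply: leq_trans (chi_count_down (size s) (size s') c); rewrite /A pair_sum.
  apply: leq_sum => j _; apply: leq_sum => j' _.
  case h: (_ && _) => //; have {h} /andP[/andP[/eqP h1 /eqP h2] /truthP h3] := h.
  rewrite lt0b; apply/andP; split.
    rewrite lt0n; apply/negP => /eqP ej; rewrite ej /= in h1 h3.
    have := @no_arrow (nth t' (t' :: s') j') _; rewrite mem_nth // => /(_ isT).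
    rewrite larE // => /eqP; rewrite addn_eq0 => /andP[/eqP h4 _].
    move: h4; rewrite (bigD1 g) /=; last by rewrite h1 h2 !eqxx.
    by case: truthP.
  apply/eqP/hbar_inj; have := off_eq idH properH h3.
  have lj : (j <= size s)%N by rewrite -ltnS.
  have lj' : (j' <= size s')%N by rewrite -ltnS.
  rewrite (string_off hp lj) (string_off hp' lj') -/o -/o' => e.
  have e2 : hbar *~ (size s' - j')%N - hbar *~ (size s - j)%N = u g - (o' - o).
    by rewrite -e -!pmulrn; exact: shift_regroup2.
  rewrite -!subzn // in e2; rewrite mulrzBr e2.
  by apply/eqP; rewrite -subr_eq0 -oppr_eq0 -ec; apply/eqP; exact: shift_regroup3.
apply: dv_trans (dvX _ le) _; exists ((-1) ^+ chi (size s).+1 (size s').+1 c).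
by rewrite -exprMn mulN1r opprB.
Qed.

Lemma divisor_backward g :
  dv (('X_t - 'X_t') ^+ (\sum_(b <- t' :: s') \sum_(a <- t :: s)
        ((tgt g == col a) && (src g == col b) && truth (H (lin b a (hbar - u g))))))
     (arrow_factor_if g (rev (t' :: s')) (rev (t :: s))
        ('X_t + o%:MP - ('X_t' + o'%:MP))).
Proof.
set A := (\sum_(b <- _) _)%N; have [->|A0] := eqVneq A 0%N; first by rewrite expr0; apply: dv1.
have [b0 [a0 [hb0 ha0 htgt hsrc hh]]] : exists b a, [/\ b \in t' :: s', a \in t :: s,
    tgt g = col a, src g = col b & H (lin b a (hbar - u g))].
  move: A0; rewrite sum_nat_seq_neq0 => /hasP[b hb /=]; rewrite sum_nat_seq_neq0 => /hasP[a ha /=].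
  by rewrite eqb0 negbK => /andP[/andP[/eqP h1 /eqP h2] /truthP h3]; exists b, a.
rewrite /arrow_factor_if hsrc htgt !scol_rev //= !size_rev /=.
have [j0 [lj0 ea0]] := string_pos ha0; have [j0' [lj0' eb0]] := string_pos hb0.
pose c : int := (size s - j0)%N%:Z - (size s' - j0')%N%:Z + 1.
have ec : o - o' + hbar *~ c - u g = 0.
  have := off_eq idH properH hh; rewrite ea0 eb0 !string_off // -/o -/o'.
  move/(congr1 (fun y => hbar - y)); rewrite subKr => <-.
  by rewrite /c mulrzDr mulr1z mulrzBr -!pmulrn; exact: shift_regroup5.
have ltc : (absz (c + (size s').+1%:Z)%R < ((size s').+1 + (size s).+1).+1)%N by rewrite /c; lia.
have etc : (Ordinal ltc)%:Z - (size s').+1%:Z = c by rewrite /= /c; lia.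
rewrite /arrow_factor (bigD1 (Ordinal ltc)) //= -[X in _ ^+ chi _ _ X]/((Ordinal ltc)%:Z - _).
apply: dv_mulr; rewrite -[`|_|%N]/(nat_of_ord (Ordinal ltc)) etc.
have -> : 'X_t + o%:MP - ('X_t' + o'%:MP) + (hbar *~ c - u g)%:MP = 'X_t - 'X_t' :> P.
  rewrite -[RHS]addr0 -[in RHS](mpolyC0 n F) -ec !(rmorphB, rmorphD) /=.
  exact: shift_regroup.
apply: dvX; apply: leq_trans (chi_count_up (size s) (size s') c); rewrite /A pair_sum.
apply: leq_sum => j _; apply: leq_sum => j' _.
case h: (_ && _) => //; have {h} /andP[/andP[/eqP h1 /eqP h2] /truthP h3] := h.
rewrite lt0b; apply/andP; split.
  rewrite lt0n; apply/negP => /eqP ej; rewrite ej /= in h1 h3.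
  have := @no_arrow (nth t' (t' :: s') j') _; rewrite mem_nth // => /(_ isT).
  rewrite larE // => /eqP; rewrite addn_eq0 => /andP[_ /eqP h4].
  move: h4; rewrite (bigD1 g) /=; last by rewrite h1 h2 !eqxx.
  by case: truthP.
apply/eqP/hbar_inj; have := off_eq idH properH h3.
have lj : (j <= size s)%N by rewrite -ltnS.
have lj' : (j' <= size s')%N by rewrite -ltnS.
rewrite (string_off hp lj) (string_off hp' lj') -/o -/o'.
move/(congr1 (fun y => hbar - y)); rewrite subKr => e.
have e2 : hbar *~ (size s - j)%N - hbar *~ (size s' - j')%N + hbar = u g - (o - o').
  by rewrite -e -!pmulrn; exact: shift_regroup6.
rewrite -!subzn // in e2; rewrite mulrzDr mulr1z mulrzBr e2.
by apply/eqP; rewrite -subr_eq0 -oppr_eq0 -ec; apply/eqP; exact: shift_regroup3.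
Qed.

End Pair.

Lemma path_mono t s : path below t s -> monochrome (rev (t :: s)).
Proof.
move=> hp; have := mem_rev (t :: s); case: (rev _) => [|c r] h.
  by have := h t; rewrite mem_head.
have hc : col c = col t by apply: (string_col hp); rewrite -h mem_head.
by apply/allP => b hb /=; rewrite hc (string_col hp) ?eqxx // -h inE hb orbT.
Qed.

(** Position of the first element of a string listed from bottom to top, all of
    whose elements are glued to the top one. *)
Definition glue_pos (s : seq 'I_n) : P :=
  if s is a :: r then 'X_(last a r) + (off a)%:MP else 0.

Lemma glue_pos_rev t s : glue_pos (rev (t :: s)) = 'X_t + (off (last t s))%:MP.
Proof.
rewrite rev_cons /glue_pos; case: (lastP s) => [|r b] //.
by rewrite rev_rcons last_rcons /= last_rcons.
Qed.

Lemma sval_glue S k : ok_strings pt ldn lrk S -> k \in flatten S ->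
  sval (map rev S) glue_pos k = 'X_(to_head S k) + (off k)%:MP.
Proof.
elim: S => // s S IH /=; case: s => [//|t s] /andP[/andP[hp _] hS].
rewrite mem_rev; case hk: (k \in t :: s) => /=; last first.
  rewrite -cat_cons mem_cat hk /= => hkS.
  by rewrite IH // /to_head hk.
move=> _; rewrite glue_pos_rev to_head_hd // -addrA -rmorphD /=; congr (_ + _%:MP).
have ul := string_uniq ls hp; set j := index k (t :: s).
have lj : (j <= size s)%N by rewrite -ltnS -[(size s).+1]/(size (t :: s)) index_mem.
have ek : k = nth t (t :: s) j by rewrite nth_index.
have -> : index k (rev (t :: s)) = (size s - j)%N.
  have lt : (size s - j < size (rev (t :: s)))%N by rewrite size_rev /= ltnS leq_subr.
  have <- : nth t (rev (t :: s)) (size s - j) = k.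
    by rewrite nth_rev ?size_rev //= ?ltnS ?leq_subr // subSS subKn // -ek.
  by rewrite index_uniq ?rev_uniq.
by rewrite [in RHS]ek string_off.
Qed.

(** When glued strings are placed at the point, the factors of the divisor that vanish
    there are differences of two glued coordinates, and divisor_forward and
    divisor_backward show that there are enough of them. *)
Lemma strings_div_dv S : ok_strings pt ldn lrk S -> uniq (flatten S) ->
  dv (strings_div F pt lar S) (family_div (map rev S) glue_pos).
Proof.
elim: S => [|s S IH] /=; first by move=> *; apply: dv1.
case: s => [//|t s] /andP[/andP[hp hall] hS] uS0.
have : uniq ((t :: s) ++ flatten S) by [].
rewrite cat_uniq => /and3P[_ disj uS].
apply: dv_trans (family_div_cons _ _ _); apply: dvM; last exact: IH.
rewrite big_map /head_div rmorph_prod /=.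
have glue_hd r x b : x :: r \in S -> b \in x :: r -> to_head S b = x.
  move=> hin hb; elim: S uS hin {IH hall hS disj uS0} => // s' S IHS /=.
  rewrite cat_uniq inE => /and3P[_ hd uS'] /orP[/eqP <-|hin]; first by rewrite to_head_hd.
  have nb : b \notin s'.
    apply/negP => h; case/hasP: hd; exists b => //.
    by apply/flattenP; exists (x :: r).
  by rewrite /to_head (negbTE nb); apply: IHS.
have flat (G : 'I_n -> P) : \prod_(b <- flatten S) G b = \prod_(s' <- S) \prod_(b <- s') G b.
  by elim: (S) => [|r S' IH']; rewrite ?big_nil //= big_cat big_cons IH'.
rewrite flat; apply: dv_prod_seq => s' hs'.
have okin : (if s' is t' :: r then path below t' r else false) = true.
  elim: S hs' hS {IH hall uS uS0 disj glue_hd flat} => // s1 S IHS; rewrite inE /=.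
  case/orP=> [/eqP ->|hin] /andP[h1 h2]; last exact: IHS.
  by case: s1 h1 => // t1 r /andP[].
case: s' hs' okin => // t' r hs' hp'.
have notS : to_head S t = t.
  by rewrite to_head_out //; apply: contra disj => h; apply/hasP; exists t; rewrite ?mem_head.
rewrite (eq_big_seq (fun b => ('X_t - 'X_t') ^+ (\sum_(a <- t :: s) lar (pt a) (pt b)))); last first.
  move=> b hb; rewrite rmorphXn rmorphB /= !sbX notS.
  by rewrite (glue_hd _ _ _ hs' hb).
have noar b : b \in t' :: r -> lar (pt t) (pt b) = 0%N.
  move=> hb; apply/eqP/negPn/negP => /(ar_rk ls); rewrite ltnNge => /negP[].
  by apply: (allP hall); apply/flattenP; exists (t' :: r).
have -> : \prod_(b <- t' :: r) ('X_t - 'X_t') ^+ (\sum_(a <- t :: s) lar (pt a) (pt b)) =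
  \prod_(g : arrow Q) (
    ('X_t - 'X_t') ^+ (\sum_(b <- t' :: r) \sum_(a <- t :: s)
        ((src g == col a) && (tgt g == col b) && truth (H (lin b a (u g))))) *
    ('X_t - 'X_t') ^+ (\sum_(b <- t' :: r) \sum_(a <- t :: s)
        ((tgt g == col a) && (src g == col b) && truth (H (lin b a (hbar - u g)))))) :> P.
  rewrite -expr_sum big_split /= -!expr_sum -exprD; congr (_ ^+ _).
  rewrite [X in (_ = X + _)%N]exchange_big [X in (_ = _ + X)%N]exchange_big -big_split /=.
  apply: eq_bigr => b _.
  rewrite [X in (_ = X + _)%N]exchange_big [X in (_ = _ + X)%N]exchange_big -big_split /=.
  apply: eq_bigr => a _; rewrite larE //; congr (_ + _)%N; rewrite big_mkcond /=;
    by apply: eq_bigr => g _; case: (_ && _).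
apply: dv_prod => g _; rewrite !glue_pos_rev; apply: dvM.
  exact: divisor_forward.
exact: divisor_backward.
Qed.

(** Substituting for each string its glued head, shifted to the point, turns the
    divisor at strings into a multiple of the local one. *)
Theorem string_divisible_cond E : string_divisible E ->
  string_cond pt ldn lar lrk (enum 'I_n) (uncenter H E).
Proof.
move=> hE S hS pS; have uS : uniq (flatten S) by rewrite (perm_uniq pS) enum_uniq.
apply: dv_trans (strings_div_dv hS uS) _.
have -> : sb (to_head S) (uncenter H E) = ev (sval (map rev S) glue_pos) E.
  rewrite /uncenter /sb ev_comp; apply: ev_eq => k.
  by rewrite rmorphD /= evX evC sval_glue // (perm_mem pS) mem_enum.
apply: hE; last first.
  elim: S hS {pS uS} => // s S IH /= /andP[hs /IH ->]; rewrite andbT.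
  by case: s hs => // t s /andP[hp _]; apply: path_mono.
apply: perm_trans pS; elim: (S) => //= s S' IH; apply: perm_cat => //.
by rewrite perm_rev.
Qed.

End Localize.
End StringConditions.

(** * From local to global *)

Fact mul_regroup4 (R : comNzRingType) (d e y v : R) : d * e * (y * v) = y * (d * v * e).
Proof. by ring. Qed.
Fact mul_regroup5 (R : comNzRingType) (d e x : R) : d * (x * e) = d * e * x.
Proof. by ring. Qed.
Fact mul_regroup6 (R : comNzRingType) (a y b p : R) : a * y * p - b * (y * p) = y * ((a - b) * p).
Proof. by ring. Qed.
Fact mul_regroup7 (R : comNzRingType) (a a' b x y : R) :
  (a - b) * x - (a' - b) * y = (a - a') * x + (a' - b) * (x - y).
Proof. by ring. Qed.

Fact mul_regroup2 (R : comNzRingType) (d q r p z : R) :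
  d * (q * r) * (p * z) = p * q * d * (z * r).
Proof. by ring. Qed.
Fact mul_regroup3 (R : comNzRingType) (a d v e : R) : a * d * v * e = d * v * (a * e).
Proof. by ring. Qed.

Section Patch.
Variables (Q : quiver) (F : fieldType) (hbar : F) (u : arrow Q -> F).
Notation I := (vert Q).
Variables (n : nat) (col : 'I_n -> I).
Notation P := {mpoly F[n]}.
Notation EN := (enum 'I_n).
Notation zeta_kernel := (zeta_kernel hbar u col).
Notation Wc := (inW col EN).
Hypothesis cone_neq0 : forall c, cone hbar u c -> c != 0.
Hypothesis char0 : forall k, k.+1%:R != 0 :> F.
Variable E : P.
Hypothesis symE : forall s, Wc s -> sb s E = E.
Hypothesis divE : string_divisible hbar u col E.

Let uEN : uniq EN. Proof. exact: enum_uniq. Qed.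

Section AtPoint.
Variable H : P -> Prop.
Hypotheses (idH : ideal H) (properH : ~ H 1).
Hypothesis dec : forall a b c, weight hbar u c -> H (lin a b c) \/ inv_mod H (lin a b c).
Notation pt := (pt col H).
Notation ldn := (ldn hbar col H).
Notation lar := (lar hbar u col H).
Notation W0 := (inW pt EN).
Notation local_kernel := (local_kernel F pt ldn lar).

Lemma W0_col s a : W0 s -> col (s a) = col a.
Proof.
move=> /inWP[h _]; rewrite -(pt_col col idH (s a)) h; exact: pt_col.
Qed.

Lemma W0_Wc s : W0 s -> Wc s.
Proof.
move=> hs; apply/inWP; split=> a; first exact: W0_col.
by rewrite mem_enum.
Qed.

Lemma W0_congr s x : W0 s -> H (sb s x - x).
Proof.
move=> /inWP[h _]; rewrite -{2}[x]ev_id; apply: ev_congr => // k.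
by have /(ptE col idH) [_] := h k; rewrite linE.
Qed.

Lemma W0_off s a : W0 s -> off H (s a) = off H a.
Proof.
move=> /inWP[h _]; have /(ptE col idH) [_ hh] := h a.
by apply/eqP; rewrite -subr_eq0 (off_eq idH properH hh).
Qed.

Lemma sh_sb s x : W0 s -> center H (sb s x) = sb s (center H x).
Proof.
move=> hs; rewrite /center /sb !ev_comp; apply: ev_eq => k.
by rewrite rmorphB /= !evX evC W0_off.
Qed.

Lemma unsh_sb s x : W0 s -> uncenter H (sb s x) = sb s (uncenter H x).
Proof.
move=> hs; rewrite /uncenter /sb !ev_comp; apply: ev_eq => k.
by rewrite rmorphD /= !evX evC W0_off.
Qed.

Lemma invH_sb s x : W0 s -> inv_mod H x -> inv_mod H (sb s x).
Proof.
move=> hs; apply: inv_mod_congr => //.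
by rewrite -opprB; apply: idealN => //; apply: W0_congr.
Qed.

Definition kernel_unit (a b : 'I_n) : P :=
  epsilon (inhabits 0) (fun r => inv_mod H r /\ zeta_kernel a b = center H (local_kernel a b) * r).
Lemma kernel_unitP a b : inv_mod H (kernel_unit a b) /\ zeta_kernel a b = center H (local_kernel a b) * kernel_unit a b.
Proof. exact: (epsilon_spec (inhabits 0) _ (zeta_kernel_factor col idH properH dec a b)). Qed.

Lemma ordprod_unit bf : exists r, inv_mod H r /\ ordprod zeta_kernel bf EN = center H (ordprod local_kernel bf EN) * r.
Proof.
exists (ordprod kernel_unit bf EN); split.
  by apply: inv_mod_prod => // a _; apply: inv_mod_prod => // b _; case: (kernel_unitP a b).
rewrite /ordprod rmorph_prod -big_split; apply: eq_bigr => a _ /=.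
rewrite rmorph_prod -big_split; apply: eq_bigr => b _ /=.
by case: (kernel_unitP a b).
Qed.

Definition Delta_unit : P := \prod_(a <- EN) \prod_(b <- EN |
  (b != a) && ((col b == col a) && (pt b != pt a))) ('X_a - 'X_b).

Lemma lin0_inv a b : col b = col a -> pt b != pt a -> inv_mod H ('X_a - 'X_b).
Proof.
move=> ec np; rewrite linE; case: (dec a b (Or41 _ _ _ (erefl 0))) => // h.
by case/eqP: np; apply/(ptE col idH)/samept_sym => //; split.
Qed.

Lemma Delta_factor : Delta F col EN = center H (Delta F pt EN) * Delta_unit.
Proof.
rewrite /Delta /Delta_unit rmorph_prod -big_split; apply: eq_bigr => a _ /=.
rewrite (bigID (fun b => pt b == pt a)) rmorph_prod /=; congr (_ * _); last first.
  by apply: eq_bigl => b; rewrite andbA.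
apply: eq_big => [b|b /andP[/andP[_ _] /eqP hb]].
  case h: (pt b == pt a); last by rewrite !andbF.
  by rewrite !andbT -(pt_col col idH b) (eqP h) (pt_col col idH) eqxx andbT.
have /(ptE col idH) [_ hab] := hb.
by rewrite -(lin_sh idH properH (linN idH hab)) oppr0 linE.
Qed.

Lemma sb_Delta_unit s : W0 s -> sb s Delta_unit = Delta_unit.
Proof.
move=> hs; apply: (prod2_inW (pt := pt) (z := fun a b => 'X_a - 'X_b)
  (c := fun a b => (b != a) && ((col b == col a) && (pt b != pt a)))) => // a b.
  by have /inWP[h _] := hs; rewrite (inj_eq perm_inj) !(W0_col _ hs) !h.
by rewrite rmorphB /= !sbX.
Qed.

(** The local theorem applies to E in centred coordinates. The units relating the
    two kernels depend on the order; v collects all of them, with their conjugates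
    under the permutations that preserve the point, so that it is invariant. *)
Lemma local_expansion : exists v (L : seq (seq 'I_n * P)),
  [/\ inv_mod H v, forall s, W0 s -> sb s v = v, forall x, x \in L -> perm_eq x.1 EN &
      Delta F col EN * v * E = \sum_(x <- L) Sym pt EN (x.2 * ordprod zeta_kernel (before x.1) EN)].
Proof.
have iE s : W0 s -> sb s (uncenter H E) = uncenter H E.
  by move=> hs; rewrite -unsh_sb // symE // W0_Wc.
have cE := string_divisible_cond idH properH cone_neq0 char0 divE.
have [L [hL eL]] := local_theorem (local_structureP col idH properH cone_neq0) char0 uEN iE cE.
have {}eL : center H (Delta F pt EN) * E =
    \sum_(x <- L) Sym pt EN (center H x.2 * center H (ordprod local_kernel (before x.1) EN)).
  have := congr1 (center H) eL; rewrite rmorphM /= unshK rmorph_sum => ->.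
  apply: eq_bigr => x _; rewrite /Sym rmorph_sum; apply: eq_bigr => s hs.
  by rewrite /= sh_sb // rmorphM.
pose V w := epsilon (inhabits 0)
  (fun r => inv_mod H r /\ ordprod zeta_kernel (before w) EN = center H (ordprod local_kernel (before w) EN) * r).
have VP w : inv_mod H (V w) /\ ordprod zeta_kernel (before w) EN = center H (ordprod local_kernel (before w) EN) * V w.
  exact: (epsilon_spec (inhabits 0) _ (ordprod_unit (before w))).
pose v : P := \prod_(x <- L) \prod_(s : {perm 'I_n} | W0 s) sb s (V x.1).
have iv : inv_mod H v.
  apply: inv_mod_prod => // x _; apply: inv_mod_prod => // s hs.
  by apply: invH_sb => //; case: (VP x.1).
have sv s : W0 s -> sb s v = v.
  move=> hs; rewrite /v rmorph_prod; apply: eq_bigr => x _ /=.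
  rewrite rmorph_prod [RHS](reindex_inj (mulIg s)) /=.
  by apply: eq_big => [t|t _]; rewrite ?inWMr // sb_perm_mul.
pose q w := epsilon (inhabits 0) (fun q => v = q * V w).
have qP x : x \in L -> v = q x.1 * V x.1.
  move=> hx; apply: (epsilon_spec (inhabits 0) (fun q => v = q * V x.1)).
  rewrite /v (big_rem _ hx) /= (bigD1 1%g) ?inW1 //= sb_id; last by move=> a; rewrite perm1.
  by eexists; rewrite -mulrA mulrC.
exists v, [seq (x.1, center H x.2 * q x.1 * Delta_unit) | x <- L]; split=> //.
  by move=> x /mapP[y hy ->]; apply: (hL y).
rewrite big_map Delta_factor.
rewrite (_ : center H _ * Delta_unit * v * E = (Delta_unit * v) * (center H (Delta F pt EN) * E)); last first.
  exact: mul_regroup3.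
rewrite eL mulr_sumr; apply: eq_big_seq => x hx /=.
rewrite -SymM => [|s hs]; last by rewrite rmorphM /= sb_Delta_unit // sv.
have [_ ->] := VP x.1; rewrite {1}(qP x hx); congr (Sym _ _ _).
exact: mul_regroup2.
Qed.

End AtPoint.

Definition multiplier (f : P) : Prop :=
  (forall s, Wc s -> sb s f = f) /\ in_span col zeta_kernel EN (f * E).

Definition multiplier_ideal (x : P) : Prop := exists l : seq (P * P),
  (forall y, y \in l -> multiplier y.1) /\ x = \sum_(y <- l) y.1 * y.2.

Lemma multiplier_ideal_ideal : ideal multiplier_ideal.
Proof.
split=> [|x x' [l [hl ->]] [l' [hl' ->]]|r x [l [hl ->]]].
- by exists [::]; rewrite big_nil.
- exists (l ++ l'); rewrite big_cat; split=> // y.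
  by rewrite mem_cat => /orP[/hl|/hl'].
exists [seq (y.1, r * y.2) | y <- l]; split=> [y /mapP[z hz ->]|]; first exact: (hl z).
by rewrite big_map mulr_sumr; apply: eq_bigr => y _; rewrite mulrCA.
Qed.

(** The multipliers are symmetric, so 1 = sum of f y becomes, on symmetrization, an
    expression of a nonzero integer with symmetric coefficients. *)
Lemma multiplier_ideal1 : multiplier_ideal 1 -> in_span col zeta_kernel EN E.
Proof.
move=> [l [hl e1]]; set N := #|[pred s | Wc s]|.
have nzN : N%:R != 0 :> F.
  by have := inW_card_gt0 col EN; rewrite -/N; case: N => // k _; apply: char0.
have eN : N%:R * E = \sum_(y <- l) Sym col EN y.2 * (y.1 * E).
  have <- : Sym col EN 1 = N%:R :> P.
    by rewrite Sym_inv ?mulr1 // => s _; rewrite rmorph1.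
  rewrite e1 Sym_sum mulr_suml; apply: eq_big_seq => y /hl [iy _].
  by rewrite SymM // mulrA [_ * y.1]mulrC.
have -> : E = N%:R^-1 *: (N%:R * E).
  rewrite -mul_mpolyC mulrA -(rmorph_nat (@mpolyC n F)) -mpolyCM mulVf //.
  by rewrite mul1r.
apply: in_spanZ; rewrite eN; apply: in_span_sum => y /hl [_ hy].
by apply: in_spanM => // s hs; apply: sb_Sym.
Qed.

(** If every multiplier vanished at some point, the expansion of E at that point
    would give a multiplier that does not vanish there. *)
Theorem string_divisible_in_span : in_span col zeta_kernel EN E.
Proof.
apply: multiplier_ideal1; apply: NNPP => n1.
pose cs : seq F := [:: 0; hbar] ++ [seq u g | g <- enum (arrow Q)] ++
                   [seq hbar - u g | g <- enum (arrow Q)].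
pose forms : seq P := [seq lin x.1 x.2 c | x <- enum {: 'I_n * 'I_n}, c <- cs].
have [H [idH sub nH dec0]] := ideal_decide forms multiplier_ideal_ideal n1.
have dec a b c : weight hbar u c -> H (lin a b c) \/ inv_mod H (lin a b c).
  move=> hc; apply: dec0; apply/allpairsP; exists ((a, b), c); rewrite mem_enum; split=> //=.
  rewrite !inE; case: hc => [->|->|[g ->]|[g ->]]; rewrite ?eqxx ?orbT //.
    by rewrite mem_cat map_f ?mem_enum ?orbT.
  by rewrite mem_cat (map_f (fun g => hbar - u g)) ?mem_enum ?orbT.
have [v [L [iv sv hL eL]]] := local_expansion idH nH dec.
set pt := pt col H in sv eL; set W0 := inW pt EN in sv.
have W0c s : W0 s -> Wc s by exact: W0_Wc.
have multS y : multiplier (Sym col EN (y * v)).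
  split=> [s hs|]; first exact: sb_Sym.
  exists [seq (x.1, (\sum_(s : {perm 'I_n} | W0 s) sb s^-1%g y) * x.2) | x <- L].
  split=> [x /mapP[z hz ->]|]; first exact: (hL z).
  have -> : Delta F col EN * (Sym col EN (y * v) * E) =
      Sym col EN (y * (Delta F col EN * v * E)).
    have iDE s : Wc s -> sb s (Delta F col EN * E) = Delta F col EN * E.
      by move=> hs; rewrite rmorphM /= sb_Delta // symE.
    by rewrite mul_regroup5 -SymM //; congr (Sym _ _ _); exact: mul_regroup4.
  rewrite eL mulr_sumr Sym_sum big_map; apply: eq_bigr => x _ /=.
  rewrite -mulrA [y * _]mulr_sumr mulr_suml.
  rewrite !(big_morph (Sym col EN) (SymD col EN) (Sym0 _ col EN)).
  apply: eq_bigr => s hs; rewrite -(Sym_sb (s := s^-1%g)) ?inWV ?W0c //.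
  by rewrite rmorphM /= sbK.
(* A product of differences s X_a - X_b, summed over s, stays in the ideal:
   each factor acts on a combination of symmetrizations. *)
have twist (l : seq ('I_n * 'I_n)) y : multiplier_ideal
    (\sum_(s : {perm 'I_n} | Wc s) sb s (y * v) * \prod_(p <- l) ('X_(s p.1) - 'X_p.2)).
  elim: l y => [|[a b] l IH] y.
    exists [:: (Sym col EN (y * v), 1)]; rewrite big_seq1 mulr1; split=> [x|].
      by rewrite inE => /eqP ->; apply: multS.
    by apply: eq_bigr => s _; rewrite big_nil mulr1.
  have := idealB multiplier_ideal_ideal (IH ('X_a * y))
            (idealM multiplier_ideal_ideal 'X_b (IH y)).
  rewrite mulr_sumr -sumrB; congr multiplier_ideal; apply: eq_bigr => s _.
  have -> : sb s ('X_a * y * v) = 'X_(s a) * sb s (y * v) by rewrite -mulrA rmorphM /= sbX.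
  by rewrite big_cons; apply: mul_regroup6.
(* A permutation that moves the point sends some a to a variable of the same colour
   and of another value; the factor at (a, s a) then vanishes. On the other
   permutations the product is invertible modulo H. *)
pose l := [seq p <- enum {: 'I_n * 'I_n} | (col p.1 == col p.2) && (pt p.1 != pt p.2)].
pose M : P := \prod_(p <- l) ('X_p.1 - 'X_p.2).
have iM : inv_mod H M.
  rewrite /M big_filter; apply: inv_mod_prod => // p /andP[/eqP h1 h2].
  by apply: (lin0_inv idH dec); [rewrite h1 | rewrite eq_sym].
have HS := sub _ (twist l 1); set T := \sum_(s | _) _ in HS.
have eT : H (T - #|[pred s | W0 s]|%:R * (v * M)).
  rewrite /T (bigID W0) /= [X in _ + X - _]big1 ?addr0; last first.
    move=> s /andP[hs]; rewrite /W0; case: inWP => // nW _.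
    have [a na] : exists a, pt (s a) != pt a.
      apply: NNPP => na; apply: nW; split=> a; last by rewrite mem_enum.
      by apply/eqP/negPn/negP => h; apply: na; exists a.
    have hl : (a, s a) \in l.
      have /inWP[hc _] := hs; rewrite mem_filter mem_enum /= hc eqxx /= andbT.
      by rewrite eq_sym na.
    by rewrite (big_rem _ hl) /= subrr mul0r mulr0.
  rewrite (eq_bigl W0) => [|s]; last by apply/andP/idP => [[]|h] //; rewrite W0c.
  rewrite -sumr_const mulr_suml -sumrB; apply: ideal_sum => // s hs.
  rewrite mul1r (sv s hs) mul1r -mulrBr; apply: idealM => //.
  rewrite /M; elim: (l) => [|p r IHr]; first by rewrite !big_nil subrr; apply: ideal0.
  rewrite !big_cons.
  have hp : H ('X_(s p.1) - 'X_p.1).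
    by have := W0_congr idH 'X_p.1 hs; rewrite sbX.
  rewrite (mul_regroup7 'X_(s p.1) 'X_p.1 'X_p.2).
  by apply: idealD => //; [apply: idealMr | apply: idealM].
apply: nH; apply: (@inv_mod_ideal _ _ idH (#|[pred s | W0 s]|%:R * (v * M))).
  apply: inv_modM => //; last exact: inv_modM.
  have := inW_card_gt0 pt EN; rewrite -/W0; case: #|_| => // k _.
  exists (k.+1%:R^-1)%:MP; rewrite -(rmorph_nat (@mpolyC n F)) -mpolyCM mulfV //.
  by rewrite subrr; apply: ideal0.
by rewrite -[X in H X](subKr T); apply: idealB.
Qed.

End Patch.

(** * Shuffle products of ordered products *)

Section Variables_.
Variable I : finType.
Implicit Types d : dimvec I.

Definition vcol d (k : 'I_(nvar d)) : I := tag (enum_val k : zvar d).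
Definition vnum d (k : 'I_(nvar d)) : nat := tagged (enum_val k : zvar d).
Definition vix d (i : I) (a : 'I_(d i)) : 'I_(nvar d) :=
  enum_rank (Tagged (fun j => 'I_(d j)) a : zvar d).

Lemma vcol_vix d i (a : 'I_(d i)) : vcol (vix a) = i.
Proof. by rewrite /vcol /vix enum_rankK. Qed.
Lemma vnum_vix d i (a : 'I_(d i)) : vnum (vix a) = a.
Proof. by rewrite /vnum /vix enum_rankK. Qed.
Lemma vnum_lt d (k : 'I_(nvar d)) : (vnum k < d (vcol k))%N.
Proof. exact: ltn_ord. Qed.
Lemma vixK d (k : 'I_(nvar d)) : vix (tagged (enum_val k : zvar d)) = k.
Proof. by rewrite /vix; apply: (canLR enum_valK); case: (enum_val k). Qed.
Lemma vix_ex d (k : 'I_(nvar d)) : exists i (a : 'I_(d i)), k = vix a.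
Proof. by exists (vcol k), (tagged (enum_val k : zvar d)); rewrite vixK. Qed.
Lemma var_inj d (k k' : 'I_(nvar d)) : vcol k = vcol k' -> vnum k = vnum k' -> k = k'.
Proof.
have [i [a ->]] := vix_ex k; have [j [b ->]] := vix_ex k'.
rewrite !vcol_vix !vnum_vix => e; subst j => e; congr vix; exact: val_inj.
Qed.

Lemma big_var (R : Type) (idx : R) (op : Monoid.com_law idx) d (G : I -> nat -> R) :
  \big[op/idx]_(k : 'I_(nvar d)) G (vcol k) (vnum k) =
  \big[op/idx]_i \big[op/idx]_(a < d i) G i a.
Proof.
rewrite (reindex_onto (@enum_rank (zvar d)) enum_val) => [|k _]; last by rewrite enum_valK.
rewrite sig_big_dep /=; apply: eq_big => [v|[i a] _]; first by rewrite enum_rankK eqxx.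
by rewrite /vcol /vnum enum_rankK.
Qed.

Definition cperm_fun d (s : colperm d) (k : 'I_(nvar d)) : 'I_(nvar d) :=
  vix (s (vcol k) (tagged (enum_val k : zvar d))).

Lemma cperm_fun_vix d (s : colperm d) i (a : 'I_(d i)) : cperm_fun s (vix a) = vix (s i a).
Proof. by rewrite /cperm_fun /vcol /vix enum_rankK. Qed.

Lemma cperm_inj_fun d (s : colperm d) : injective (cperm_fun s).
Proof.
move=> k k'; have [i [a ->]] := vix_ex k; have [j [b ->]] := vix_ex k'.
rewrite !cperm_fun_vix => e; have := congr1 (@vcol d) e; rewrite !vcol_vix => eij; subst j.
have := congr1 (@vnum d) e; rewrite !vnum_vix => /val_inj/perm_inj -> //.
Qed.

Definition cperm d (s : colperm d) : {perm 'I_(nvar d)} := perm (@cperm_inj_fun d s).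

Lemma cperm_vix d (s : colperm d) i (a : 'I_(d i)) : cperm s (vix a) = vix (s i a).
Proof. by rewrite permE cperm_fun_vix. Qed.

Lemma cperm_inj d : injective (@cperm d).
Proof.
move=> s s' e; apply/ffunP => i; apply/permP => a.
have := congr1 (fun p : {perm _} => p (vix a)) e; rewrite !cperm_vix.
by move/(congr1 (@vnum d)); rewrite !vnum_vix => /val_inj.
Qed.

Lemma inW_cperm d (s : {perm 'I_(nvar d)}) :
  inW (@vcol d) (enum 'I_(nvar d)) s = (s \in [set cperm c | c : colperm d]).
Proof.
apply/inWP/imsetP => [[hs _]|[c _ ->]]; last first.
  split=> [k|k]; last by rewrite mem_enum.
  by have [i [a ->]] := vix_ex k; rewrite cperm_vix !vcol_vix.
have lt i (a : 'I_(d i)) : (vnum (s (vix a)) < d i)%N.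
  by have := vnum_lt (s (vix a)); rewrite hs vcol_vix.
pose f i (a : 'I_(d i)) : 'I_(d i) := Ordinal (lt i a).
have fE i (a : 'I_(d i)) : vix (f i a) = s (vix a).
  by apply: var_inj; rewrite ?vnum_vix // hs !vcol_vix.
have finj i : injective (f i).
  move=> a b e; have := fE i a; rewrite e fE => /perm_inj.
  by move/(congr1 (@vnum d)); rewrite !vnum_vix => /val_inj.
exists [ffun i => perm (finj i)] => //; apply/permP => k.
by have [i [a ->]] := vix_ex k; rewrite cperm_vix ffunE permE fE.
Qed.

Lemma sum_colperm (R : nmodType) d (G : {perm 'I_(nvar d)} -> R) :
  \sum_(c : colperm d) G (cperm c) = \sum_(s | inW (@vcol d) (enum 'I_(nvar d)) s) G s.
Proof.
rewrite (eq_bigl _ _ (@inW_cperm d)) big_imset //= => c c' _ _; exact: cperm_inj.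
Qed.

End Variables_.

Section ColoredSubst.
Variables (I : finType) (F : fieldType).
Implicit Types d e : dimvec I.

Lemma zX_vix d i (a : 'I_(d i)) : zX F d i a = 'X_(vix a).
Proof. by rewrite /zX valK. Qed.

Lemma zsubst_ev d e (y : I -> nat -> zpoly F e) (p : zpoly F d) :
  zsubst y p = ev (fun k => y (vcol k) (vnum k)) p.
Proof. by []. Qed.

Lemma zsubst_permz d (s : colperm d) (p : zpoly F d) : zsubst (permz F s) p = sb (cperm s) p.
Proof.
rewrite zsubst_ev; apply: ev_eq => k; have [i [a ->]] := vix_ex k.
by rewrite vcol_vix vnum_vix cperm_vix permzE zX_vix.
Qed.

Lemma zsym_inW d (p : zpoly F d) : zsym p <->
  forall s, inW (@vcol _ d) (enum 'I_(nvar d)) s -> sb s p = p.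
Proof.
split=> [h s|h s]; last first.
  by rewrite zsubst_permz; apply: h; rewrite inW_cperm; apply: imset_f.
by rewrite inW_cperm => /imsetP[c _ ->]; rewrite -zsubst_permz.
Qed.
End ColoredSubst.

Section ShuffleExpansion.
Variables (Q : quiver) (F : fieldType) (hbar : F) (u : arrow Q -> F).
Hypothesis char0 : forall k, k.+1%:R != 0 :> F.
Notation I := (vert Q).
Notation EN d := (enum 'I_(nvar d)).
Notation kernel_ d := (zeta_kernel hbar u (@vcol _ d)).
Notation Wd d := (inW (@vcol _ d) (EN d)).
Notation Symd d := (Sym (@vcol _ d) (EN d)).
Notation Deltad d := (Delta F (@vcol _ d) (EN d)).

Definition in_dim_span (d : dimvec I) (E : zpoly F d) : Prop := in_span (@vcol _ d) (kernel_ d) (EN d) E.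

Variables m k l : dimvec I.
Hypothesis eqm : forall i, m i = (k i + l i)%N.

Let ltL i (a : 'I_(k i)) : (a < m i)%N.
Proof. by rewrite eqm; apply: leq_trans (ltn_ord a) (leq_addr _ _). Qed.
Let ltR i (b : 'I_(l i)) : (k i + b < m i)%N.
Proof. by rewrite eqm ltn_add2l. Qed.

Definition embL (x : 'I_(nvar k)) : 'I_(nvar m) :=
  vix (Ordinal (ltL (tagged (enum_val x : zvar k)))).
Definition embR (x : 'I_(nvar l)) : 'I_(nvar m) :=
  vix (Ordinal (ltR (tagged (enum_val x : zvar l)))).

Lemma embL_col x : vcol (embL x) = vcol x. Proof. exact: vcol_vix. Qed.
Lemma embR_col x : vcol (embR x) = vcol x. Proof. exact: vcol_vix. Qed.
Lemma embL_num x : vnum (embL x) = vnum x. Proof. exact: vnum_vix. Qed.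
Lemma embR_num x : vnum (embR x) = (k (vcol x) + vnum x)%N. Proof. exact: vnum_vix. Qed.

Lemma embL_inj : injective embL.
Proof.
by move=> x y e; apply: var_inj; rewrite -?embL_col -?embL_num e.
Qed.
Lemma embR_inj : injective embR.
Proof.
move=> x y e; have ec : vcol x = vcol y by rewrite -!embR_col e.
apply: var_inj => //; have := embR_num x; rewrite e embR_num ec.
by move/addnI.
Qed.
Lemma embLR x y : embL x != embR y.
Proof.
apply/eqP => e; have ec : vcol x = vcol y by rewrite -embL_col e embR_col.
have := vnum_lt x; rewrite -embL_num e embR_num ec.
by rewrite ltnNge leq_addr.
Qed.

Lemma embP z : (exists x, z = embL x) \/ (exists y, z = embR y).
Proof.
have [i [a ->]] := vix_ex z; have lt := ltn_ord a.
case: (ltnP a (k i)) => h; [left; exists (vix (Ordinal h)) | right].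
  by apply: var_inj; rewrite ?embL_col ?embL_num ?vcol_vix ?vnum_vix.
have h2 : (a - k i < l i)%N by rewrite ltn_subLR // -eqm.
exists (vix (Ordinal h2)); apply: var_inj; rewrite ?embR_col ?embR_num ?vcol_vix ?vnum_vix //=.
by rewrite subnKC.
Qed.

Lemma perm_emb w w' : perm_eq w (EN k) -> perm_eq w' (EN l) ->
  perm_eq (map embL w ++ map embR w') (EN m).
Proof.
move=> hw hw'; apply: uniq_perm; last 1 first.
- move=> z; rewrite mem_enum mem_cat; case: (embP z) => -[x ->].
    by rewrite mem_map ?(perm_mem hw) ?mem_enum //; apply: embL_inj.
  by rewrite [X in _ || X]mem_map ?(perm_mem hw') ?mem_enum ?orbT //; apply: embR_inj.
- rewrite cat_uniq !map_inj_uniq ?(perm_uniq hw) ?(perm_uniq hw') ?enum_uniq //; last 2 first.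
  + exact: embR_inj.
  + exact: embL_inj.
  rewrite /= andbT; apply/hasPn => z /mapP[y _ ->]; apply/negP => /mapP[x _ e].
  by have := embLR x y; rewrite e eqxx.
- exact: enum_uniq.
Qed.

Lemma ext_perm s t : Wd k s -> Wd l t -> exists r, [/\ Wd m r,
  forall x, r (embL x) = embL (s x) & forall y, r (embR y) = embR (t y)].
Proof.
move=> /inWP[hs _] /inWP[ht _].
pose f z := if [pick x | embL x == z] is Some x then embL (s x)
            else if [pick y | embR y == z] is Some y then embR (t y) else z.
have fL x : f (embL x) = embL (s x).
  rewrite /f; case: pickP => [x' /eqP/embL_inj -> //|/(_ x)].
  by rewrite eqxx.
have fR y : f (embR y) = embR (t y).
  rewrite /f; case: pickP => [x /eqP e|_]; first by have := embLR x y; rewrite e eqxx.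
  by case: pickP => [y' /eqP/embR_inj -> //|/(_ y)]; rewrite eqxx.
have finj : injective f.
  move=> z z'; case: (embP z) => -[x ->]; case: (embP z') => -[y ->]; rewrite ?fL ?fR.
  - by move/embL_inj/perm_inj ->.
  - by move=> e; have := embLR (s x) (t y); rewrite e eqxx.
  - by move=> e; have := embLR (s y) (t x); rewrite -e eqxx.
  - by move/embR_inj/perm_inj ->.
exists (perm finj); split=> [|x|y]; rewrite ?permE //.
apply/inWP; split=> z; last by rewrite mem_enum.
by rewrite permE; case: (embP z) => -[x ->]; rewrite ?fL ?fR ?embL_col ?embR_col.
Qed.

Lemma sb_zeta_kernel n n' (col : 'I_n -> I) (col' : 'I_n' -> I) (f : 'I_n -> 'I_n') a b :
  (forall x, col' (f x) = col x) -> sb f (zeta_kernel hbar u col a b) = zeta_kernel hbar u col' (f a) (f b).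
Proof.
move=> hf; have hl x y c : sb f (lin x y c) = lin (f x) (f y) c.
  by rewrite /lin !rmorphB /= !sbX sbC.
rewrite /zeta_kernel !hf !rmorphM /= !rmorph_prod; congr (_ * (_ * _)).
- by case: ifP => _; rewrite ?rmorph1 // rmorphM /= !hl.
- by apply: eq_bigr => g _; apply: hl.
- by apply: eq_bigr => g _; apply: hl.
Qed.

Definition cross (z : 'I_(nvar m) -> 'I_(nvar m) -> zpoly F m) : zpoly F m :=
  \prod_(x : 'I_(nvar k)) \prod_(y : 'I_(nvar l)) z (embL x) (embR y).

Definition pole (a b : 'I_(nvar m)) : zpoly F m :=
  if vcol a == vcol b then ('X_a - 'X_b) * ('X_b - 'X_a) else 1.

(** In the concatenated order, the pairs split into those of w, those of w', and all
    pairs with one variable on each side. *)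
Lemma ordprod_emb w w' : perm_eq w (EN k) -> perm_eq w' (EN l) ->
  ordprod (kernel_ m) (before (map embL w ++ map embR w')) (EN m) =
  sb embL (ordprod (kernel_ k) (before w) (EN k)) * sb embR (ordprod (kernel_ l) (before w') (EN l)) * cross (kernel_ m).
Proof.
move=> hw hw'; rewrite -(ordprod_perm _ _ (perm_emb (perm_refl _) (perm_refl _))) ordprod_cat.
have inw x : x \in w by rewrite (perm_mem hw) mem_enum.
have inw' x : x \in w' by rewrite (perm_mem hw') mem_enum.
have nL y : embR y \in map embL w = false.
  by apply/negP => /mapP[x _ e]; have := embLR x y; rewrite e eqxx.
have iL x : index (embL x) (map embL w ++ map embR w') = index x w.
  by rewrite index_cat map_f // index_map //; apply: embL_inj.
have iR y : index (embR y) (map embL w ++ map embR w') = (size w + index y w')%N.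
  by rewrite index_cat nL size_map index_map //; apply: embR_inj.
congr (_ * _ * _).
- rewrite /ordprod big_map rmorph_prod; apply: eq_bigr => a _; rewrite big_map rmorph_prod.
  apply: eq_big => [b|b _]; first by rewrite /before !iL.
  by rewrite /= (sb_zeta_kernel (col' := @vcol _ m)) //; apply: embL_col.
- rewrite /ordprod big_map rmorph_prod; apply: eq_bigr => a _; rewrite big_map rmorph_prod.
  apply: eq_big => [b|b _]; first by rewrite /before !iR ltn_add2l.
  by rewrite /= (sb_zeta_kernel (col' := @vcol _ m)) //; apply: embR_col.
have blt x y : before (map embL w ++ map embR w') (embL x) (embR y).
  by rewrite /before iL iR ltn_addr // index_mem.
rewrite /cross big_map exchange_big /= big_enum; apply: eq_bigr => y _.
rewrite [X in X * _]big_map [X in _ * X]big_map !big_enum_cond.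
rewrite [X in _ * X]big_pred0 ?mulr1 => [|x]; last first.
  by apply/negbTE; rewrite /before -leqNgt ltnW //; apply: blt.
by apply: eq_bigl => x; rewrite blt.
Qed.

Lemma Delta_emb : Deltad m = sb embL (Deltad k) * sb embR (Deltad l) * cross pole.
Proof.
have eD d B : Delta F (@vcol _ d) B =
  ordprod (fun a b => 'X_a - 'X_b) (fun a b => (b != a) && (vcol b == vcol a)) B by [].
rewrite -(Delta_perm _ _ (perm_emb (perm_refl _) (perm_refl _))) eD ordprod_cat.
congr (_ * _ * _).
- rewrite /ordprod big_map rmorph_prod; apply: eq_bigr => a _; rewrite big_map rmorph_prod.
  apply: eq_big => [b|b _]; first by rewrite (inj_eq embL_inj) !embL_col.
  by rewrite rmorphB /= !sbX.
- rewrite /ordprod big_map rmorph_prod; apply: eq_bigr => a _; rewrite big_map rmorph_prod.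
  apply: eq_big => [b|b _]; first by rewrite (inj_eq embR_inj) !embR_col.
  by rewrite rmorphB /= !sbX.
rewrite /cross big_map exchange_big /= big_enum; apply: eq_bigr => y _.
rewrite [X in X * _]big_map [X in _ * X]big_map !big_enum_cond.
rewrite [X in X * _]big_mkcond [X in _ * X]big_mkcond -big_split /=.
apply: eq_bigr => x _; rewrite /pole embLR.
have -> : embR y != embL x by rewrite eq_sym embLR.
by rewrite /= [vcol (embR y) == _]eq_sym; case: ifP; rewrite ?mulr1.
Qed.

End ShuffleExpansion.

Fact clear_two_den (K : fieldType) (n dk dl p a b z : K) : n != 0 ->
  n * (dk * dl * p * (a * b / n * z)) = dk * a * (dl * b) * (z * p).
Proof. by move=> nz; field. Qed.
Fact mul_regroup8 (R : comNzRingType) (a b c x y : R) : a * b * (x * y * c) = a * x * (b * y) * c.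
Proof. by ring. Qed.

Section ShuffleOfWords.
Variables (Q : quiver) (F : fieldType) (hbar : F) (u : arrow Q -> F).
Hypothesis char0 : forall k, k.+1%:R != 0 :> F.
Notation I := (vert Q).
Notation EN d := (enum 'I_(nvar d)).
Notation kernel_ d := (zeta_kernel hbar u (@vcol _ d)).
Notation Wd d := (inW (@vcol _ d) (EN d)).
Notation Symd d := (Sym (@vcol _ d) (EN d)).
Notation Deltad d := (Delta F (@vcol _ d) (EN d)).
Notation in_dim_span := (in_dim_span hbar u).

Variables m k l : dimvec I.
Hypothesis eqm : forall i, m i = (k i + l i)%N.
Notation T := (@FracField.tofrac (zpoly F m)).
Notation eL := (embL eqm).
Notation eR := (embR eqm).
Notation P := (zpoly F m).

Lemma scalE c : scal m c = T c%:MP. Proof. by []. Qed.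

Lemma tofrac_var_sub (a b : 'I_(nvar m)) c : T (lin b a c) = - (T 'X_a - T 'X_b) - scal m c.
Proof. by rewrite /lin !tofracB opprB scalE. Qed.

Lemma zeta_pole (a b : 'I_(nvar m)) : a != b ->
  zeta hbar u (vcol a) (vcol b) (T 'X_a - T 'X_b) * T (pole F a b) = T (kernel_ m a b).
Proof.
move=> ne; rewrite /zeta /zeta_kernel tofracM mulrAC; congr (_ * _); last first.
  rewrite big_sumType /= tofracM !rmorph_prod; congr (_ * _);
  by apply: eq_bigr => g _; rewrite /= tofrac_var_sub.
rewrite /pole; case: eqP => _; last by rewrite expr0 mul1r.
have nz : T 'X_a - T 'X_b != 0.
  by rewrite -tofracB tofrac_eq0 linE lin_neq0.
rewrite expr1 !tofracM mulrA -tofracB mulfVK; last by rewrite tofracB.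
by rewrite /lin !tofracB mpolyC0 tofrac0 subr0 scalE.
Qed.

Lemma permzL (s : colperm m) x : permz F s (vcol x) (vnum x) = 'X_(cperm s (eL x)).
Proof.
have [i [a ->]] := vix_ex x; rewrite vcol_vix vnum_vix.
have lt : (a < m i)%N by rewrite eqm; apply: leq_trans (ltn_ord a) (leq_addr _ _).
rewrite -[nat_of_ord a]/(nat_of_ord (Ordinal lt)) permzE zX_vix -cperm_vix.
by congr 'X_(cperm s _); apply: var_inj; rewrite ?embL_col ?embL_num ?vcol_vix ?vnum_vix.
Qed.

Lemma permzR (s : colperm m) y :
  permz F s (vcol y) (k (vcol y) + vnum y)%N = 'X_(cperm s (eR y)).
Proof.
have [i [b ->]] := vix_ex y; rewrite vcol_vix vnum_vix.
have lt : (k i + b < m i)%N by rewrite eqm ltn_add2l.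
rewrite -[(k i + b)%N]/(nat_of_ord (Ordinal lt)) permzE zX_vix -cperm_vix.
by congr 'X_(cperm s _); apply: var_inj; rewrite ?embR_col ?embR_num ?vcol_vix ?vnum_vix.
Qed.

Lemma big_cross (R : comNzRingType) (G : I -> nat -> I -> nat -> R) :
  \prod_i \prod_j \prod_(a < k i) \prod_(b < l j) G i a j b =
  \prod_(x : 'I_(nvar k)) \prod_(y : 'I_(nvar l)) G (vcol x) (vnum x) (vcol y) (vnum y).
Proof.
under [RHS]eq_bigr => x _ do rewrite (@big_var _ _ _ _ l (fun j b => G (vcol x) (vnum x) j b)).
rewrite (@big_var _ _ _ _ k (fun i a => \prod_j \prod_(b < l j) G i a j b)).
by apply: eq_bigr => i _; rewrite exchange_big.
Qed.

(** Delta in dimension k + l is the product of the two smaller ones and of the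
    factors (X_a - X_b)(X_b - X_a) across, and these clear the poles of zeta. *)
Lemma shuffle_Delta (E : zpoly F k) (E' : zpoly F l) :
  (dimfact k * dimfact l)%:R * (Deltad m * shuffle hbar u m E E') =
  Symd m (sb eL (Deltad k * E) * sb eR (Deltad l * E') * cross eqm (kernel_ m)).
Proof.
apply/eqP; rewrite -tofrac_eq; apply/eqP; rewrite !tofracM shuffleP //.
rewrite rmorph_nat /shuffle_frac /Sym rmorph_sum -sum_colperm [X in _ * X = _]mulr_sumr mulr_sumr.
apply: eq_bigr => s _ /=.
have hW : Wd m (cperm s) by rewrite inW_cperm; apply: imset_f.
set ss := cperm s in hW *; set N := _%:R.
have nzN : N != 0 :> {fraction P}.
  rewrite /N -(rmorph_nat T) -(rmorph_nat (@mpolyC (nvar m) F)) tofrac_eq0 mpolyC_eq0.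
  have : (0 < dimfact k * dimfact l)%N.
    by rewrite muln_gt0; apply/andP; split; apply: prodn_gt0 => i; apply: fact_gt0.
  by case: (_ * _)%N => // j _; apply: char0.
have -> : zsubst (permz F s) E = sb ss (sb eL E).
  by rewrite zsubst_ev sb_comp; apply: ev_eq => x; apply: permzL.
have -> : zsubst (fun i b => permz F s i (k i + b)%N) E' = sb ss (sb eR E').
  by rewrite zsubst_ev sb_comp; apply: ev_eq => x; apply: permzR.
rewrite (big_cross (fun i a j b => zeta hbar u i j
   (T (permz F s i a) - T (permz F s j (k j + b)%N)))).
rewrite (eq_bigr (fun x => \prod_(y : 'I_(nvar l))
   zeta hbar u (vcol x) (vcol y) (T 'X_(ss (eL x)) - T 'X_(ss (eR y))))); last first.
  by move=> x _; apply: eq_bigr => y _; rewrite permzL permzR.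
set ze := \prod_x _.
have e1 : ze * T (sb ss (cross eqm (pole F (m:=m)))) = T (sb ss (cross eqm (kernel_ m))).
  rewrite /ze /cross !rmorph_prod -big_split; apply: eq_bigr => x _.
  rewrite !rmorph_prod -big_split; apply: eq_bigr => y _ /=.
  have colss z : vcol (ss z) = vcol z by have /inWP[h _] := hW; rewrite h.
  rewrite (sb_zeta_kernel hbar u (col' := @vcol _ m)) // -zeta_pole; last by rewrite (inj_eq perm_inj) embLR.
  rewrite !colss embL_col embR_col; congr (_ * T _).
  by rewrite /pole !colss; case: ifP => _; rewrite ?rmorph1 // rmorphM !rmorphB /= !sbX.
have -> : T (Deltad m) = T (sb ss (Deltad m)) by rewrite sb_Delta ?enum_uniq.
rewrite (Delta_emb F eqm) !rmorphM /= -e1.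
exact: (clear_two_den _ _ _ _ _ _ nzN).
Qed.

(** Inner symmetrizations are absorbed in the outer one, because a pair of
    permutations of the two blocks extends to all variables and preserves the
    cross factors. *)
Lemma shuffle_words : exists2 c : F, c != 0 & forall (E : zpoly F k) (E' : zpoly F l) L L',
  (forall x, x \in L -> perm_eq x.1 (EN k)) -> (forall x, x \in L' -> perm_eq x.1 (EN l)) ->
  Deltad k * E = \sum_(x <- L) Symd k (x.2 * ordprod (kernel_ k) (before x.1) (EN k)) ->
  Deltad l * E' = \sum_(x <- L') Symd l (x.2 * ordprod (kernel_ l) (before x.1) (EN l)) ->
  Deltad m * shuffle hbar u m E E' = c *: \sum_(x <- L) \sum_(y <- L')
    Symd m (sb eL x.2 * sb eR y.2 * ordprod (kernel_ m) (before (map eL x.1 ++ map eR y.1)) (EN m)).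
Proof.
pose N := (dimfact k * dimfact l)%N.
pose Nk := #|[pred s | Wd k s]|; pose Nl := #|[pred s | Wd l s]|.
have nat_neq0 j : (0 < j)%N -> j%:R != 0 :> F by case: j => // j _; apply: char0.
have nzN : N%:R != 0 :> F.
  rewrite nat_neq0 // muln_gt0.
  by apply/andP; split; apply: prodn_gt0 => i; apply: fact_gt0.
exists ((Nk * Nl)%:R / N%:R).
  by rewrite mulf_neq0 ?invr_eq0 // nat_neq0 // muln_gt0 !inW_card_gt0.
move=> E E' L L' hL hL' eE eE'.
have key x y : x \in L -> y \in L' ->
    Symd m (sb eL (Symd k (x.2 * ordprod (kernel_ k) (before x.1) (EN k))) *
            sb eR (Symd l (y.2 * ordprod (kernel_ l) (before y.1) (EN l))) * cross eqm (kernel_ m)) =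
    (Nk * Nl)%:R * Symd m (sb eL x.2 * sb eR y.2 *
       ordprod (kernel_ m) (before (map eL x.1 ++ map eR y.1)) (EN m)).
  move=> /hL px /hL' py; rewrite (ordprod_emb hbar u eqm px py).
  set X := x.2 * _; set Y := y.2 * _.
  have -> : sb eL x.2 * sb eR y.2 * (sb eL (ordprod (kernel_ k) (before x.1) (EN k)) *
      sb eR (ordprod (kernel_ l) (before y.1) (EN l)) * cross eqm (kernel_ m)) =
      sb eL X * sb eR Y * cross eqm (kernel_ m).
    by rewrite /X /Y !rmorphM /=; exact: mul_regroup8.
  have expand : sb eL (Symd k X) * sb eR (Symd l Y) * cross eqm (kernel_ m) =
      \sum_(s | Wd k s) \sum_(t | Wd l t) sb eL (sb s X) * sb eR (sb t Y) * cross eqm (kernel_ m).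
    rewrite /Sym !rmorph_sum mulr_suml mulr_suml; apply: eq_bigr => s _.
    by rewrite mulr_sumr mulr_suml.
  rewrite expand (big_morph (Symd m) (SymD _ _) (Sym0 _ _ _)).
  rewrite (eq_bigr (fun=> Nl%:R * Symd m (sb eL X * sb eR Y * cross eqm (kernel_ m)))).
    by rewrite sumr_const -[LHS]mulr_natl mulrA natrM.
  move=> s hs; rewrite (big_morph (Symd m) (SymD _ _) (Sym0 _ _ _)).
  rewrite (eq_bigr (fun=> Symd m (sb eL X * sb eR Y * cross eqm (kernel_ m)))).
    by rewrite sumr_const -[LHS]mulr_natl.
  move=> t ht; have [r [hr rL rR]] := ext_perm eqm hs ht.
  rewrite -[RHS](Sym_sb _ hr); congr (Sym _ _ _).
  have rM p q : sb r (p * q) = sb r p * sb r q by rewrite rmorphM.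
  have -> : sb eL (sb s X) = sb r (sb eL X).
    by rewrite !sb_comp; apply: sb_eq => a /=; rewrite rL.
  have -> : sb eR (sb t Y) = sb r (sb eR Y).
    by rewrite !sb_comp; apply: sb_eq => a /=; rewrite rR.
  rewrite 2!rM; congr (_ * _).
  have crossE : sb r (cross eqm (kernel_ m)) =
      \prod_(x : 'I_(nvar k)) \prod_(y : 'I_(nvar l)) kernel_ m (eL (s x)) (eR (t y)).
    rewrite /cross rmorph_prod; apply: eq_bigr => a _; rewrite rmorph_prod.
    apply: eq_bigr => b _ /=; rewrite (sb_zeta_kernel hbar u (col' := @vcol _ m)) ?rL ?rR // => z.
    by have /inWP[h _] := hr; rewrite h.
  rewrite crossE /cross (reindex_inj (@perm_inj _ s)); apply: eq_bigr => a _ /=.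
  by rewrite (reindex_inj (@perm_inj _ t)).
have nzNP : N%:R != 0 :> P by rewrite -(rmorph_nat (@mpolyC _ F)) mpolyC_eq0.
apply: (mulfI nzNP); rewrite shuffle_Delta eE eE' !rmorph_sum.
rewrite mulr_suml mulr_suml Sym_sum -mul_mpolyC mulrA.
have -> : N%:R * ((Nk * Nl)%:R / N%:R)%:MP = (Nk * Nl)%:R :> P.
  by rewrite -!(rmorph_nat (@mpolyC _ F)) -mpolyCM mulrC divfK.
rewrite mulr_sumr; apply: eq_big_seq => x hx; rewrite mulr_sumr mulr_suml Sym_sum mulr_sumr.
by apply: eq_big_seq => y hy; apply: key.
Qed.

Lemma in_dim_span_shuffle (E : zpoly F k) (E' : zpoly F l) : in_dim_span E -> in_dim_span E' -> in_dim_span (shuffle hbar u m E E' : P).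
Proof.
move=> [L [hL eE]] [L' [hL' eE']]; have [c _ /(_ _ _ _ _ hL hL' eE eE') e] := shuffle_words.
exists [seq (map eL x.1 ++ map eR y.1, c *: (sb eL x.2 * sb eR y.2)) | x <- L, y <- L'].
split=> [z /allpairsP[[x y] /= [hx hy ->]]|].
  by apply: perm_emb; [apply: hL | apply: hL'].
rewrite e big_allpairs_dep scaler_sumr; apply: eq_bigr => x _; rewrite scaler_sumr.
apply: eq_bigr => y _ /=; rewrite -!mul_mpolyC -SymM => [|s _]; last by rewrite sbC.
by rewrite [in LHS]mulrA.
Qed.

Lemma shuffle0l (E' : zpoly F l) : shuffle hbar u m (0 : zpoly F k) E' = 0.
Proof.
apply/eqP; rewrite -tofrac_eq0 shuffleP //.
rewrite /shuffle_frac big1 // => s _ /=.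
have -> : zsubst (permz F s) (0 : zpoly F k) = 0 by rewrite zsubst_ev rmorph0.
by rewrite tofrac0 !mul0r.
Qed.
Lemma shuffle0r (E : zpoly F k) : shuffle hbar u m E (0 : zpoly F l) = 0.
Proof.
apply/eqP; rewrite -tofrac_eq0 shuffleP //.
rewrite /shuffle_frac big1 // => s _ /=.
have -> : zsubst (fun i b => permz F s i (k i + b)%N) (0 : zpoly F l) = 0.
  by rewrite zsubst_ev rmorph0.
by rewrite tofrac0 mulr0 !mul0r.
Qed.

End ShuffleOfWords.

(** * The generated subalgebra *)

Lemma ord_small n (a b : 'I_n) : (n <= 1)%N -> a = b.
Proof. by move=> le; apply: val_inj; have := ltn_ord a; have := ltn_ord b; move=> /=; lia. Qed.

Section GeneratedAlgebra.
Variables (Q : quiver) (F : fieldType) (hbar : F) (u : arrow Q -> F).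
Hypothesis char0 : forall k, k.+1%:R != 0 :> F.
Notation I := (vert Q).
Notation EN d := (enum 'I_(nvar d)).
Notation kernel_ d := (zeta_kernel hbar u (@vcol _ d)).
Notation Wd d := (inW (@vcol _ d) (EN d)).
Notation Symd d := (Sym (@vcol _ d) (EN d)).
Notation Deltad d := (Delta F (@vcol _ d) (EN d)).
Notation in_dim_span := (in_dim_span hbar u).
Implicit Types d m k l : dimvec I.

Definition delta (i : I) : dimvec I := [ffun j => (j == i) : nat].

Lemma nvarE d : nvar d = (\sum_i d i)%N.
Proof.
rewrite /nvar card_tagged sumnE big_map big_enum; apply: eq_bigr => i _.
by rewrite card_ord.
Qed.

Lemma nvar_delta i : nvar (delta i) = 1%N.
Proof.
rewrite nvarE (bigD1 i) //= big1 ?addn0 => [|j /negbTE nj]; rewrite ffunE ?eqxx //.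
by rewrite nj.
Qed.

Lemma small_Sym d (E : zpoly F d) w : (nvar d <= 1)%N ->
  Deltad d * E = Symd d (E * ordprod (kernel_ d) (before w) (EN d)).
Proof.
move=> le; have all_eq (a b : 'I_(nvar d)) : a = b by apply: ord_small.
rewrite {1}/Delta big1 => [|a _]; last first.
  by rewrite big_pred0 // => b; rewrite (all_eq b a) eqxx.
rewrite mul1r /ordprod [X in _ * X]big1 => [|a _]; last first.
  by rewrite big_pred0 // => b; rewrite (all_eq b a) /before ltnn.
rewrite mulr1 /Sym (big_pred1 1%g); first by rewrite sb_id // => a; rewrite perm1.
move=> s; apply/idP/eqP => [_|->]; last exact: inW1.
by apply/permP => a; apply: all_eq.
Qed.

Lemma in_dim_span_small d (E : zpoly F d) : (nvar d <= 1)%N -> in_dim_span E.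
Proof.
move=> le; exists [:: (EN d, E)]; rewrite big_seq1; split; last exact: small_Sym.
by move=> x; rewrite inE => /eqP ->.
Qed.

Definition in_span_fam (X : vfamily I F) : Prop :=
  (exists s : seq (dimvec I), forall d, d \notin s -> X d = 0) /\ forall d, in_dim_span (X d).

Lemma split_dim m (f : {dffun forall i : I, 'I_(m i).+1}) i :
  m i = (([ffun i => f i : nat] : dimvec I) i + ([ffun i => (m i - f i)%N] : dimvec I) i)%N.
Proof. by rewrite !ffunE subnKC // -ltnS. Qed.

Lemma in_span_fam_subalgebra : subalgebra hbar u in_span_fam.
Proof.
split.
- split=> [|d].
    by exists [:: [ffun=> 0%N]] => d; rewrite inE /fam_one; case: ifP.
  rewrite /fam_one; case: eqP => [->|_]; last exact: in_span0.
  by apply: in_dim_span_small; rewrite nvarE big1 // => i _; rewrite ffunE.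
- move=> X Y [[s hs] hX] [[s' hs'] hY]; split=> [|d]; last exact: (in_spanD (hX d) (hY d)).
  exists (s ++ s') => d; rewrite mem_cat negb_or => /andP[h h'].
  by rewrite /fam_add hs ?hs' ?addr0.
- move=> c X [[s hs] hX]; split=> [|d]; last exact: (in_spanZ c (hX d)).
  by exists s => d /hs; rewrite /fam_scale => ->; rewrite scaler0.
move=> X Y [[s hs] hX] [[s' hs'] hY]; split=> [|m]; last first.
  rewrite /fam_mul; apply: in_span_sum => f _.
  by apply: in_dim_span_shuffle => // i; apply: split_dim.
exists [seq [ffun i => (d i + d' i)%N] | d <- s, d' <- s'] => m nm.
rewrite /fam_mul big1 // => f _ /=.
set k := [ffun i => f i : nat]; set l := [ffun i => (m i - f i)%N].
have eqm i : m i = (k i + l i)%N by apply: split_dim.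
have [hk|nk] := boolP (k \in s); last by rewrite (hs k nk) (shuffle0l _ _ _ eqm).
have [hl|nl] := boolP (l \in s'); last by rewrite (hs' l nl) (shuffle0r _ _ _ eqm).
case/negP: nm; apply/allpairsP; exists (k, l); split=> //=.
by apply/ffunP => i; rewrite ffunE eqm.
Qed.

Lemma in_span_fam_e i j : in_span_fam (e_ F i j).
Proof.
split=> [|d].
  by exists [:: delta i] => d; rewrite inE /e_ /delta; case: ifP.
rewrite /e_; case: eqP => [e|_]; last exact: in_span0.
by apply: in_dim_span_small; rewrite e -/(delta i) nvar_delta.
Qed.

Section Generate.
Variable Pr : vfamily I F -> Prop.
Hypothesis subPr : subalgebra hbar u Pr.
Hypothesis PrE : forall i j, Pr (e_ F i j).

Definition reach d (E : zpoly F d) : Prop :=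
  exists Y : vfamily I F, [/\ Pr Y, Y d = E & forall d', d' != d -> Y d' = 0].

Lemma reachD d (E E' : zpoly F d) : reach E -> reach E' -> reach (E + E').
Proof.
case: subPr => _ hD _ _ [Y [h1 h2 h3]] [Y' [h1' h2' h3']].
exists (fam_add Y Y'); split; first exact: hD.
  by rewrite /fam_add h2 h2'.
by move=> d' nd; rewrite /fam_add h3 ?h3' ?addr0.
Qed.

Lemma reachZ d c (E : zpoly F d) : reach E -> reach (c *: E).
Proof.
case: subPr => _ _ hZ _ [Y [h1 h2 h3]].
exists (fam_scale c Y); split; first exact: hZ.
  by rewrite /fam_scale h2.
by move=> d' nd; rewrite /fam_scale h3 ?scaler0.
Qed.

Lemma reach0 d : reach (0 : zpoly F d).
Proof.
case: subPr => h1 _ hZ _; exists (fam_scale 0 (fam_one I F)); split; first exact: hZ.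
  by rewrite /fam_scale scale0r.
by move=> d' _; rewrite /fam_scale scale0r.
Qed.

Lemma reach_shuffle m k l (E : zpoly F k) (E' : zpoly F l) :
  (forall i, m i = (k i + l i)%N) -> reach E -> reach E' -> reach (shuffle hbar u m E E').
Proof.
move=> eqm; case: subPr => _ _ _ hM [Y [h1 h2 h3]] [Y' [h1' h2' h3']].
exists (fam_mul hbar u Y Y'); split; first exact: hM.
  have ltk i : (k i < (m i).+1)%N by rewrite ltnS eqm leq_addr.
  pose f0 : {dffun forall i : I, 'I_(m i).+1} := [ffun i => Ordinal (ltk i)].
  rewrite /fam_mul (bigD1 f0) //= big1 ?addr0.
    have -> : [ffun i => f0 i : nat] = k by apply/ffunP => i; rewrite !ffunE.
    have -> : [ffun i => (m i - f0 i)%N] = l.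
      by apply/ffunP => i; rewrite !ffunE /= eqm addKn.
    by rewrite h2 h2'.
  move=> f nf; have nk : [ffun i => f i : nat] != k.
    apply: contra nf => /eqP e; apply/eqP/ffunP => i; rewrite ffunE; apply: val_inj.
    by have := congr1 (fun g : dimvec I => g i) e; rewrite ffunE.
  by rewrite (h3 _ nk) (shuffle0l _ _ _ (split_dim f)).
move=> m' nm; rewrite /fam_mul big1 // => f _ /=.
set k' := [ffun i => f i : nat]; set l' := [ffun i => (m' i - f i)%N].
have eqm' i : m' i = (k' i + l' i)%N by apply: split_dim.
have [ek|nk] := eqVneq k' k; last by rewrite (h3 _ nk) (shuffle0l _ _ _ eqm').
have [el|nl] := eqVneq l' l; last by rewrite (h3' _ nl) (shuffle0r _ _ _ eqm').
by case/eqP: nm; apply/ffunP => i; rewrite eqm' eqm ek el.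
Qed.

Lemma reach_letter i (p : zpoly F (delta i)) : reach p.
Proof.
have all_eq (a b : 'I_(nvar (delta i))) : a = b by apply: ord_small; rewrite nvar_delta.
have lt0 : (0 < delta i i)%N by rewrite ffunE eqxx.
elim/mpolyind: p => [|c m p _ _ IH]; first exact: reach0.
apply: reachD => //; apply: reachZ; exists (e_ F i (m (vix (Ordinal lt0)))); split=> //.
  rewrite /e_ -/(delta i) eqxx -[0%N]/(nat_of_ord (Ordinal lt0)) zX_vix [RHS]mpolyXE_id.
  by rewrite [RHS](bigD1 (vix (Ordinal lt0))) //= [X in _ * X]big1 ?mulr1 // => j; rewrite (all_eq j (vix (Ordinal lt0))) eqxx.
by move=> d' /negbTE nd; rewrite /e_ -/(delta i) nd.
Qed.

Lemma split_poly m k l (eqm : forall i, m i = (k i + l i)%N) (p : zpoly F m) :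
  exists r : seq (zpoly F k * zpoly F l), p = \sum_(x <- r) sb (embL eqm) x.1 * sb (embR eqm) x.2.
Proof.
elim/mpoly_gen_ind: p => [c|x|p q [r ->] [r' ->]|p q [r ->] [r' ->]].
- by exists [:: (c%:MP, 1)]; rewrite big_seq1 rmorph1 mulr1 sbC.
- case: (embP eqm x) => -[y ->]; [exists [:: ('X_y, 1)] | exists [:: (1, 'X_y)]];
  by rewrite big_seq1 rmorph1 sbX ?mulr1 ?mul1r.
- by exists (r ++ r'); rewrite big_cat.
exists [seq (x.1 * y.1, x.2 * y.2) | x <- r, y <- r'].
rewrite big_allpairs_dep mulr_suml; apply: eq_bigr => x _; rewrite mulr_sumr.
apply: eq_bigr => y _ /=.
have mL (f g : zpoly F k) : sb (embL eqm) (f * g) = sb (embL eqm) f * sb (embL eqm) g.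
  by rewrite rmorphM.
have mR (f g : zpoly F l) : sb (embR eqm) (f * g) = sb (embR eqm) f * sb (embR eqm) g.
  by rewrite rmorphM.
by rewrite mL mR mulrACA.
Qed.

(** An ordered product splits off its first variable as a polynomial in one variable:
    first a transposition makes that variable the left block, then the coefficient is
    expanded into products of polynomials in the two blocks. *)
Lemma reach_word N d w p : nvar d = N -> perm_eq w (EN d) ->
  exists E, reach E /\ Deltad d * E = Symd d (p * ordprod (kernel_ d) (before w) (EN d)).
Proof.
elim: N d w p => [|N IH] d w p eN pw.
  exists p; split; last by apply: small_Sym; rewrite eN.
  have [c ->] : exists c, p = c%:MP.
    elim/mpoly_gen_ind: p => [c|x|p q [c ->] [c' ->]|p q [c ->] [c' ->]].
    - by exists c.
    - by have := leq_trans (ltn_ord x) (eq_leq eN).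
    - by exists (c + c'); rewrite mpolyCD.
    - by exists (c * c'); rewrite mpolyCM.
  have -> : c%:MP = c *: (1 : zpoly F d) by rewrite -mul_mpolyC mulr1.
  apply: reachZ; exists (fam_one I F); case: subPr => h1 _ _ _.
  have d0 : d = [ffun=> 0%N].
    apply/ffunP => i; rewrite ffunE; move: eN; rewrite nvarE (bigD1 i) //=.
    by move/eqP; rewrite addn_eq0 => /andP[/eqP].
  by split; rewrite // /fam_one -?d0 ?eqxx // => d' /negbTE ->.
case: w pw => [|x w1] pw; first by have sz := perm_size pw; rewrite size_enum_ord eN in sz.
set i := vcol x; have di : (0 < d i)%N by apply: leq_ltn_trans (vnum_lt x).
pose l : dimvec I := [ffun j => (d j - (j == i))%N].
have eqm j : d j = (delta i j + l j)%N.
  by rewrite !ffunE; case: eqP => [->|_]; rewrite ?add0n ?subn0 // subnKC.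
have lt0 : (0 < delta i i)%N by rewrite ffunE eqxx.
pose z0 := embL eqm (vix (Ordinal lt0)).
have hL y : embL eqm y = z0 by congr embL; apply: ord_small; rewrite nvar_delta.
have hW : Wd d (tperm x z0).
  by apply: inW_tperm; rewrite ?mem_enum // /z0 embL_col vcol_vix.
set pi := tperm x z0 in hW *.
have pw2 : perm_eq (map pi (x :: w1)) (EN d).
  by apply: perm_trans (inW_map (enum_uniq _) hW); apply: perm_map.
rewrite /= tpermL in pw2; set w2 := map pi w1 in pw2.
have u2 : uniq (z0 :: w2) by rewrite (perm_uniq pw2) enum_uniq.
have [w' ew'] : exists w', w2 = map (embR eqm) w'.
  have : forall y, y \in w2 -> exists y', y = embR eqm y'.
    move=> y hy; case: (embP eqm y) => -[y' e]; last by exists y'.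
    by move: u2; rewrite /= -(hL y') -e hy.
  elim: (w2) => [|y r IHr] h; first by exists [::].
  have [y' ->] := h y (mem_head _ _); have [z hz|r' ->] := IHr.
    by apply: h; rewrite inE hz orbT.
  by exists (y' :: r').
have pw' : perm_eq w' (EN l).
  apply: uniq_perm; last 1 first.
  - move=> y; rewrite mem_enum; have : embR eqm y \in z0 :: w2.
      by rewrite (perm_mem pw2) mem_enum.
    rewrite inE ew' mem_map; last exact: embR_inj.
    by case/orP=> // /eqP e; have := embLR eqm (vix (Ordinal lt0)) y; rewrite e eqxx.
  - by move: u2 => /andP[_]; rewrite ew' => /map_uniq.
  - exact: enum_uniq.
have eNl : nvar l = N.
  have sz := perm_size pw2; rewrite /= ew' size_map size_enum_ord eN in sz.
  by have := perm_size pw'; rewrite size_enum_ord => <-; case: sz.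
have [r er] := split_poly eqm (sb pi p).
have -> : Symd d (p * ordprod (kernel_ d) (before (x :: w1)) (EN d)) =
    \sum_(y <- r) Symd d (sb (embL eqm) y.1 * sb (embR eqm) y.2 *
       ordprod (kernel_ d) (before (map (embL eqm) [:: vix (Ordinal lt0)] ++ map (embR eqm) w')) (EN d)).
  rewrite -[LHS](Sym_sb _ hW) -Sym_sum -mulr_suml -er; congr (Sym _ _ _).
  have mP f g : sb pi (f * g) = sb pi f * sb pi g by rewrite rmorphM.
  rewrite mP; congr (_ * _); rewrite (sb_ordprod (x :: w1) _ (enum_uniq _) hW); last first.
    by move=> s a b /inWP[hs _]; apply: sb_zeta_kernel.
  by rewrite /= tpermL -ew' /z0.
have [c nzc hc] := shuffle_words hbar u char0 eqm.
have one y : exists E, reach E /\ Deltad d * E =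
    Symd d (sb (embL eqm) y.1 * sb (embR eqm) y.2 *
       ordprod (kernel_ d) (before (map (embL eqm) [:: vix (Ordinal lt0)] ++ map (embR eqm) w')) (EN d)).
  have [E2 [hE2 e2]] := IH l w' y.2 eNl pw'.
  exists (c^-1 *: shuffle hbar u d y.1 E2); split.
    by apply: reachZ; apply: reach_shuffle => //; apply: reach_letter.
  have pk : perm_eq [:: vix (Ordinal lt0)] (EN (delta i)).
    apply: uniq_perm; rewrite ?enum_uniq // => a; rewrite mem_enum inE.
    by apply/eqP/ord_small; rewrite nvar_delta.
  have := hc y.1 E2 [:: ([:: vix (Ordinal lt0)], y.1)] [:: (w', y.2)].
  rewrite !big_seq1 /= => h; rewrite -scalerAr h ?scalerA ?mulVf ?scale1r //.
  - by move=> a; rewrite inE => /eqP ->.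
  - by move=> a; rewrite inE => /eqP ->.
  - by apply: small_Sym; rewrite nvar_delta.
elim: (r) => [|y r' [E [hE eE]]].
  by exists 0; rewrite big_nil mulr0; split=> //; apply: reach0.
have [E1 [hE1 eE1]] := one y; exists (E1 + E); split; first exact: reachD.
by rewrite mulrDr eE1 eE big_cons.
Qed.

Lemma in_dim_span_reach d (E : zpoly F d) : in_dim_span E -> reach E.
Proof.
move=> [L [hL eE]].
suff [E' [hE' eE']] : exists E', reach E' /\ Deltad d * E' =
    \sum_(x <- L) Symd d (x.2 * ordprod (kernel_ d) (before x.1) (EN d)).
  by have -> : E = E' by apply: (mulfI (Delta_neq0 F _ (EN d))); apply: etrans eE (esym eE').
elim: L hL {E eE} => [|x L IH] hL.
  by exists 0; rewrite big_nil mulr0; split=> //; apply: reach0.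
have [y hy|E [hE eE]] := IH; first by apply: hL; rewrite inE hy orbT.
have [E1 [hE1 eE1]] := reach_word x.2 (erefl (nvar d)) (hL x (mem_head _ _)).
exists (E1 + E); split; first exact: reachD.
by rewrite mulrDr eE1 eE big_cons.
Qed.

Lemma in_span_fam_sub X : in_span_fam X -> Pr X.
Proof.
case=> [[s hs] hX]; case: subPr => h1 hD hZ _.
suff [Y [hY eY]] : exists Y, Pr Y /\ forall d, Y d = if d \in s then X d else 0.
  have -> // : X = Y.
  apply: functional_extensionality_dep => d; rewrite eY; case: ifP => // /negbT.
  exact: hs.
elim: s {hs} => [|d r [Y [hY eY]]].
  exists (fam_scale 0 (fam_one I F)); split; first exact: hZ.
  by move=> d; rewrite /fam_scale scale0r.
have [dr|nr] := boolP (d \in r).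
  by exists Y; split=> // d'; rewrite eY inE; case: eqP => [->|]; rewrite ?dr.
have [Z [hZ1 hZ2 hZ3]] := in_dim_span_reach (hX d).
exists (fam_add Z Y); split=> [|d']; first exact: hD.
rewrite /fam_add eY inE; have [->|nd] := eqVneq d' d.
  by rewrite hZ2 (negbTE nr) addr0.
by rewrite hZ3 // add0r.
Qed.

End Generate.

(** Letters lie in the family and the family is closed under shuffle products; the
    converse builds each ordered product letter by letter. *)
Theorem generated_in_span_fam X :
  Defs.generated hbar u (fun Y => exists i j, Y = e_ F i j) X <-> in_span_fam X.
Proof.
split=> [h|h P sP gP]; last by apply: (in_span_fam_sub sP) => // i j; apply: gP; exists i, j.
by apply: h; [exact: in_span_fam_subalgebra | move=> Y [i [j ->]]; apply: in_span_fam_e].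
Qed.
End GeneratedAlgebra.

(** * Specializing ordered products at strings *)

Section CountingPairs.

Lemma sum_ltn (K h : nat) : (\sum_(j < K) (j < h))%N = minn K h.
Proof. by elim: K => [|K IH]; rewrite ?big_ord0 ?big_ord_recr /= ?IH; lia. Qed.

Lemma sum_nat_gt0 (K : nat) (f : 'I_K -> nat) (j : nat) (lt : (j < K)%N) :
  (0 < f (Ordinal lt))%N -> (0 < \sum_(i < K) f i)%N.
Proof. by move=> h; rewrite (bigD1 (Ordinal lt)) //= addn_gt0 h. Qed.

(** e j j' tells whether the j'-th element of the second string comes before the
    j-th element of the first one in an order that lists both strings upwards.
    For fixed j, the values of j' + e j j' leave out no integer between 1 and
    K' - 1; for fixed j', the values of j - e j j' leave out no integer between
    0 and K - 2. *)
Lemma chi_le_count (K K' : nat) (e : nat -> nat -> bool) (c : int) :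
  (forall j j', (j.+1 < K)%N -> (j' < K')%N -> e j j' -> e j.+1 j') ->
  (forall j j', (j < K)%N -> (j'.+1 < K')%N -> e j j'.+1 -> e j j') ->
  (chi K K' c <= \sum_(j < K) \sum_(j' < K') (j'%:Z - j%:Z + (e j j')%:Z == c)%R)%N.
Proof.
move=> e1 e2; have [c1|c0] := boolP (0 < c).
  have -> : chi K K' c = (\sum_(j < K) (j < absz (Num.max 0 (K'%:Z - c))%R))%N.
    by rewrite sum_ltn /chi; lia.
  apply: leq_sum => j _; case: ssrnat.ltnP => // hj; pose v := absz (c + j%:Z).
  have hv : (v < K')%N by rewrite /v; lia.
  have hv' : (v.-1 < K')%N by rewrite /v; lia.
  case ev: (e j v).
    have ev' : e j v.-1 by apply: e2; rewrite ?prednK ?ev //; rewrite /v; lia.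
    by apply: (@sum_nat_gt0 _ _ _ hv'); rewrite /= ev' /v; lia.
  by apply: (@sum_nat_gt0 _ _ _ hv); rewrite /= ev /v; lia.
have -> : chi K K' c = (\sum_(j' < K') (j' < absz (Num.max 0 (K%:Z - 1 + c))%R))%N.
  by rewrite sum_ltn /chi; lia.
rewrite exchange_big; apply: leq_sum => j' _; case hj: (_ < _)%N => //; move: hj => hj.
pose v := absz (j'%:Z - c).
have hv : (v < K)%N by rewrite /v; lia.
have hv' : (v.+1 < K)%N by rewrite /v; lia.
case ev: (e v j').
  have ev' : e v.+1 j' by apply: e1.
  by apply: (@sum_nat_gt0 _ _ _ hv'); rewrite /= ev' /v; lia.
by apply: (@sum_nat_gt0 _ _ _ hv); rewrite /= ev /v; lia.
Qed.

Lemma dv_prod_counts (R : comNzRingType) (J : finType) (N : nat) (v : J -> 'I_N)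
    (y : 'I_N -> R) (m : 'I_N -> nat) :
  (forall t, (m t <= \sum_j (v j == t))%N) ->
  dv (\prod_(t < N) y t ^+ m t) (\prod_j y (v j)).
Proof.
move=> h; rewrite (partition_big v xpredT) //=; apply: dv_prod => t _.
rewrite (eq_bigr (fun=> y t ^+ 1)) => [|j /eqP -> //]; rewrite -expr_sum big_mkcond.
by apply: dvX; apply: leq_trans (h t) _; apply: leq_sum => j _; case: eqP.
Qed.
End CountingPairs.

Section StringSpecialization.
Variables (Q : quiver) (F : fieldType) (hbar : F) (u : arrow Q -> F).
Hypothesis cone_neq0 : forall c, cone hbar u c -> c != 0.
Hypothesis char0 : forall k, k.+1%:R != 0 :> F.
Notation I := (vert Q).
Variables (n m : nat) (col : 'I_n -> I) (scl : 'I_m -> I) (len : 'I_m -> nat).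
Variables (str : 'I_n -> 'I_m) (pos : 'I_n -> nat).
Hypothesis str_col : forall k, scl (str k) = col k.
Hypothesis pos_lt : forall k, (pos k < len (str k))%N.
Hypothesis str_inj : forall k k', str k = str k' -> pos k = pos k' -> k = k'.
Hypothesis str_surj : forall q j, (j < len q)%N -> exists k, str k = q /\ pos k = j.
Notation P := {mpoly F[n]}.
Notation P' := {mpoly F[m]}.
Notation EN := (enum 'I_n).

Definition string_point (k : 'I_n) : P' := 'X_(str k) + (hbar *+ pos k)%:MP.

Definition comp_div : P' :=
  \prod_(g : arrow Q) \prod_(p | scl p == src g) \prod_(q | scl q == tgt g)
    arrow_factor hbar u g (len p) (len q) ('X_q - 'X_p).

(** The factors for a pair of equal strings are nonzero constants, because no weight is
    a multiple of hbar. *)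
Definition off_diagonal : P' :=
  \prod_(g : arrow Q) \prod_(p | scl p == src g) \prod_(q | (scl q == tgt g) && (q != p))
    arrow_factor hbar u g (len p) (len q) ('X_q - 'X_p).

Lemma ev_string_point_lin a b c :
  ev string_point (lin a b c) = lin (str a) (str b) (c - hbar *~ ((pos a)%:Z - (pos b)%:Z)).
Proof.
rewrite !rmorphB /= !evX evC /string_point /lin mulrzBr -!pmulrn !rmorphB /=.
by move: 'X_(str a) 'X_(str b) _%:MP _%:MP _%:MP => A B x y z; ring.
Qed.

Definition form g k k' (e : bool) : P' :=
  lin (str k') (str k) (u g - hbar *~ ((pos k')%:Z - (pos k)%:Z + e%:Z)).

Lemma ev_string_point_forward g a b : ev string_point (lin b a (u g)) = form g a b false.
Proof. by rewrite ev_string_point_lin /form addr0. Qed.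

Lemma ev_string_point_backward g a b : ev string_point (lin b a (hbar - u g)) = - form g b a true.
Proof.
rewrite ev_string_point_lin /form lin_opp; congr (- lin _ _ _).
by rewrite !mulrzDr !mulrNz mulr1z; move: (hbar *~ _) (hbar *~ _) => x y; ring.
Qed.

Lemma zeta_kernel_forms a b :
  dv (\prod_g (if (src g == col a) && (tgt g == col b) then form g a b false else 1) *
      \prod_g (if (tgt g == col a) && (src g == col b) then form g b a true else 1))
     (ev string_point (zeta_kernel hbar u col a b)).
Proof.
rewrite /zeta_kernel rmorphM /=; apply: dv_mull; rewrite rmorphM !rmorph_prod /=; apply: dvM.
  by rewrite [in X in dv _ X]big_mkcond; apply: dv_prod => g _; case: ifP => _;
    rewrite ?ev_string_point_forward; [apply: dv_refl | apply: dv1].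
rewrite [in X in dv _ X]big_mkcond; apply: dv_prod => g _; case: ifP => _; last exact: dv1.
by exists (-1); rewrite ev_string_point_backward mulN1r.
Qed.

Lemma prod_string (p : 'I_m) : exists el : 'I_(len p) -> 'I_n,
  (forall j, str (el j) = p /\ pos (el j) = j) /\
  forall G : 'I_n -> P', \prod_(a | str a == p) G a = \prod_j G (el j).
Proof.
have [el hel] : exists el : 'I_(len p) -> 'I_n, forall j, str (el j) = p /\ pos (el j) = j.
  apply: (@fin_all_exists 'I_(len p) (fun=> 'I_n) (fun (j : 'I_(len p)) a => str a = p /\ pos a = j)) => j.
  by case: (str_surj (ltn_ord j)) => a ha; exists a.
exists el; split=> // G; rewrite -(big_imset (h := el) (A := predT) G) /=; last first.
  move=> j j' _ _ e; apply: val_inj => /=.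
  by rewrite -(proj2 (hel j)) -(proj2 (hel j')) e.
apply: eq_bigl => a; apply/eqP/imsetP => [ea|[j _ ->]]; last exact: (proj1 (hel j)).
have lt : (pos a < len p)%N by rewrite -ea.
exists (Ordinal lt) => //; have [h1 h2] := hel (Ordinal lt).
by apply: str_inj; rewrite ?h1 ?h2.
Qed.

Section Word.
Variable w : seq 'I_n.
Hypothesis pw : perm_eq w EN.
Notation bf := (before w).

Let inw a : a \in w. Proof. by rewrite (perm_mem pw) mem_enum. Qed.

Let ordprod_all : ordprod (zeta_kernel hbar u col) bf EN = \prod_a \prod_(b | bf a b) zeta_kernel hbar u col a b.
Proof. by rewrite /ordprod big_enum; apply: eq_bigr => a _; rewrite big_enum_cond. Qed.

(** An ordered pair of variables (a, b) joined by g contributes the forward factor of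
    g if a comes first, and otherwise the factor of the opposite of g. *)
Lemma ordprod_forms :
  dv (\prod_(g : arrow Q) \prod_(a | src g == col a)
        \prod_(b | (tgt g == col b) && (str b != str a)) form g a b (bf b a))
     (ev string_point (ordprod (zeta_kernel hbar u col) bf EN)).
Proof.
rewrite ordprod_all.
pose L a b := \prod_g (if (src g == col a) && (tgt g == col b) then form g a b false else 1).
pose R a b := \prod_g (if (tgt g == col a) && (src g == col b) then form g b a true else 1).
apply: (@dv_trans _ (\prod_a \prod_b (if bf a b then L a b * R a b else 1))); last first.
  rewrite rmorph_prod; apply: dv_prod => a _; rewrite [in X in dv _ X]rmorph_prod /=.
  rewrite [in X in dv _ X]big_mkcond; apply: dv_prod => b _.
  by case: ifP => _; [apply: zeta_kernel_forms | apply: dv1].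
have -> : \prod_a \prod_b (if bf a b then L a b * R a b else 1) =
    \prod_a \prod_b ((if bf a b then L a b else 1) * (if bf b a then R b a else 1)).
  transitivity (\prod_a \prod_b (if bf a b then L a b else 1) *
                \prod_a \prod_b (if bf a b then R a b else 1)).
    rewrite -big_split; apply: eq_bigr => a _; rewrite -big_split; apply: eq_bigr => b _.
    by case: ifP => //=; rewrite mulr1.
  rewrite [X in _ * X]exchange_big -big_split; apply: eq_bigr => a _.
  by rewrite -big_split.
have -> : \prod_(g : arrow Q) \prod_(a | src g == col a)
      \prod_(b | (tgt g == col b) && (str b != str a)) form g a b (bf b a) =
    \prod_a \prod_b \prod_(g : arrow Q)
      (if [&& src g == col a, tgt g == col b & str b != str a] then form g a b (bf b a) else 1).
  under [RHS]eq_bigr => a _ do rewrite exchange_big.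
  rewrite [RHS]exchange_big; apply: eq_bigr => g _; rewrite big_mkcond.
  apply: eq_bigr => a _; case: (src g == col a) => /=; last by rewrite big1.
  by rewrite big_mkcond.
apply: dv_prod => a _; apply: dv_prod => b _.
have [eab|nab] := eqVneq (str b) (str a).
  by rewrite big1 => [|g _]; [apply: dv1 | rewrite !andbF].
have ne : b != a by apply: contra nab => /eqP ->.
rewrite (before_tot (inw b) (inw a) ne); case: (bf a b) => /=.
  by rewrite mulr1; apply: dv_prod => g _; rewrite andbT; apply: dv_refl.
by rewrite mul1r; apply: dv_prod => g _; rewrite andbT andbC; apply: dv_refl.
Qed.

Section Upward.
Hypothesis upward : forall a b, str a = str b -> pos b = (pos a).+1 -> bf a b.

(** Both strings are listed upwards, so chi_le_count applies to the relation that
    records which element comes first. *)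
Lemma arrow_factor_dv_forms g p q :
  dv (arrow_factor hbar u g (len p) (len q) ('X_q - 'X_p))
     (\prod_(a | str a == p) \prod_(b | str b == q) form g a b (bf b a)).
Proof.
have [el [hel ->]] := prod_string p; have [el' [hel' eG]] := prod_string q.
under eq_bigr => j _ do rewrite eG.
pose e (j j' : nat) := [exists a, [exists b,
   [&& str a == p, pos a == j, str b == q, pos b == j' & bf b a]]].
have eE j j' : bf (el' j') (el j) = e j j'.
  apply/idP/existsP => [h|[a /existsP[b /and5P[/eqP h1 /eqP h2 /eqP h3 /eqP h4]]]].
    by exists (el j); apply/existsP; exists (el' j'); have [-> ->] := hel j;
      have [-> ->] := hel' j'; rewrite !eqxx.
  have [h1' h2'] := hel j; have [h3' h4'] := hel' j'.
  rewrite (str_inj (k := a) (k' := el j)) ?h1' ?h2' //.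
  by rewrite (str_inj (k := b) (k' := el' j')) ?h3' ?h4'.
have e1 j j' : (j.+1 < len p)%N -> (j' < len q)%N -> e j j' -> e j.+1 j'.
  move=> lt _ /existsP[a /existsP[b /and5P[/eqP h1 /eqP h2 h3 h4 h5]]].
  have [a' [h1' h2']] := str_surj lt; apply/existsP; exists a'; apply/existsP; exists b.
  rewrite h1' h2' h3 h4 !eqxx; apply: before_trans h5 _; apply: upward; rewrite ?h1 ?h2 //.
have e2 j j' : (j < len p)%N -> (j'.+1 < len q)%N -> e j j'.+1 -> e j j'.
  move=> _ lt /existsP[a /existsP[b /and5P[h1 h2 /eqP h3 /eqP h4 h5]]].
  have [b' [h3' h4']] := str_surj (ltnW lt); apply/existsP; exists a; apply/existsP; exists b'.
  rewrite h1 h2 h3' h4' !eqxx; apply: before_trans _ h5; apply: upward; rewrite ?h3 ?h4 ?h4' //.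
pose y (t : 'I_(len p + len q).+1) : P' := 'X_q - 'X_p + (hbar *~ (t%:Z - (len p)%:Z) - u g)%:MP.
pose v (x : 'I_(len p) * 'I_(len q)) : 'I_(len p + len q).+1 :=
  inord (absz (x.2%:Z - x.1%:Z + (e x.1 x.2)%:Z + (len p)%:Z)).
have vE x : (v x)%:Z = x.2%:Z - x.1%:Z + (e x.1 x.2)%:Z + (len p)%:Z.
  by rewrite /v inordK; have := ltn_ord x.1; have := ltn_ord x.2; case: (e _ _); lia.
rewrite (eq_bigr (fun j => \prod_j' y (v (j, j')))) => [|j _]; last first.
  apply: eq_bigr => j' _; rewrite eE /form /y vE /= addrK.
  have [-> ->] := hel j; have [-> ->] := hel' j'.
  by rewrite /lin -rmorphN opprB.
rewrite pair_big /= /arrow_factor.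
have -> : \prod_(x : 'I_(len p) * 'I_(len q)) y (v (x.1, x.2)) = \prod_x y (v x).
  by apply: eq_bigr => -[].
apply: dv_prod_counts => t; apply: leq_trans (chi_le_count _ e1 e2) _.
rewrite pair_big /=; apply: leq_sum => x _; have := vE x; move: (v x) => vx hvx.
by case: eqP => //= ex; rewrite lt0b; apply/eqP/val_inj => /=; move: hvx ex; lia.
Qed.

Lemma off_diagonal_dv_upward : dv off_diagonal (ev string_point (ordprod (zeta_kernel hbar u col) bf EN)).
Proof.
apply: dv_trans ordprod_forms; apply: dv_prod => g _.
rewrite [in X in dv _ X](partition_big str (fun p => scl p == src g)) /=; last first.
  by move=> a /eqP ->; rewrite str_col.
apply: dv_prod => p /eqP ep.
have -> : \prod_(a | (src g == col a) && (str a == p))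
     \prod_(b | (tgt g == col b) && (str b != str a)) form g a b (bf b a) =
   \prod_(q | (scl q == tgt g) && (q != p))
     \prod_(a | str a == p) \prod_(b | str b == q) form g a b (bf b a).
  rewrite exchange_big; apply: eq_big => [a|a /andP[_ /eqP ea]].
    by case: (str a =P p) => [ea|]; rewrite ?andbF // -ep -str_col ea eqxx.
  rewrite ea (partition_big str (fun q => (scl q == tgt g) && (q != p))) /=; last first.
    by move=> b /andP[/eqP -> ->]; rewrite str_col eqxx.
  apply: eq_bigr => q /andP[/eqP eq nq]; apply: eq_bigl => b.
  by case: (str b =P q) => [ebq|]; rewrite ?andbF // ebq nq -str_col ebq eq eqxx.
by apply: dv_prod => q _; apply: arrow_factor_dv_forms.
Qed.
End Upward.

(** If an element of a string comes before the one under it, the factor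
    X_a - X_b - hbar of the kernel vanishes on specialization. *)
Lemma off_diagonal_dv_ordprod : dv off_diagonal (ev string_point (ordprod (zeta_kernel hbar u col) bf EN)).
Proof.
pose desc (x : 'I_n * 'I_n) := [&& str x.1 == str x.2, pos x.2 == (pos x.1).+1 & ~~ bf x.1 x.2].
case: (pickP desc) => [[a b]|none]; last first.
  apply: off_diagonal_dv_upward => a b es ep; apply/negPn/negP => h.
  by have := none (a, b); rewrite /desc /= es ep h !eqxx.
case/and3P => /= /eqP es /eqP ep nbf.
have ne : b != a by apply/eqP => e; move: ep; rewrite e; lia.
have bba : bf b a by rewrite (before_tot (inw b) (inw a) ne).
suff -> : ev string_point (ordprod (zeta_kernel hbar u col) bf EN) = 0 by apply: dv0.
rewrite ordprod_all (bigD1 b) //= (bigD1 a) //=.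
have ez : ev string_point (zeta_kernel hbar u col b a) = 0.
  rewrite /zeta_kernel -!str_col es eqxx !rmorphM /= ev_string_point_lin es ep.
  have -> : hbar - hbar *~ ((pos a).+1%:Z - (pos a)%:Z) = 0.
    have -> : (pos a).+1%:Z - (pos a)%:Z = 1 by lia.
    by rewrite mulr1z subrr.
  by rewrite /lin mpolyC0 subr0 subrr !mul0r.
by rewrite rmorphM rmorphM /= ez !mul0r.
Qed.

End Word.

Let cross_form (p q : 'I_m) (c : F) : Prop := p != q /\ exists g (z : int), c = u g - hbar *~ z.
Let difference_form (p q : 'I_m) (c : F) : Prop :=
  exists z : int, c = hbar *~ z /\ (p = q -> z != 0).

Lemma arrow_factor_cross g p q k k' : q != p -> fprod cross_form (arrow_factor hbar u g k k' ('X_q - 'X_p)).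
Proof.
move=> ne; apply: fprod_prod => t _ _; apply: fprodX => _.
have -> : 'X_q - 'X_p + (hbar *~ (t%:Z - k%:Z) - u g)%:MP = lin q p (u g - hbar *~ (t%:Z - k%:Z)).
  by rewrite /lin -rmorphN opprB.
by apply: fprod_lin; split=> //; exists g, (t%:Z - k%:Z).
Qed.

Lemma ev_string_point_Delta : fprod difference_form (ev string_point (Delta F col EN)).
Proof.
rewrite rmorph_prod; apply: fprod_prod => a _ _; rewrite rmorph_prod /=.
apply: fprod_prod => b _ /andP[ne _]; rewrite linE ev_string_point_lin sub0r -mulrNz.
apply: fprod_lin; exists (- ((pos a)%:Z - (pos b)%:Z)); split=> // es.
rewrite oppr_eq0 subr_eq0 eqz_nat; apply: contra ne => /eqP ep.
by apply/eqP/esym/str_inj.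
Qed.

(** Delta specializes to forms X_p - X_q - m hbar and nonzero constants, none of which
    is proportional to a factor of the divisor. *)
Theorem in_span_off_diagonal E : in_span col (zeta_kernel hbar u col) EN E -> dv off_diagonal (ev string_point E).
Proof.
move=> [L [hL eE]].
apply: (@fprod_cancel _ _ cross_form difference_form _ (ev string_point (Delta F col EN))).
- apply: fprod_prod => g _ _; apply: fprod_prod => p _ _; apply: fprod_prod => q _ /andP[_ ne].
  exact: arrow_factor_cross.
- exact: ev_string_point_Delta.
- by move=> a b c [].
- move=> a b c a' b' c' [ne [g [z ->]]] [z' [-> hz']] hdv.
  have [eab|neab] := eqVneq a' b'; last first.
    case: (lin_assoc ne neab hdv) => -[_ [_ e]].
      by apply: (@weight_not_multiple _ _ _ _ cone_neq0 g (z' + z)); rewrite mulrzDr e subrK.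
    by apply: (@weight_not_multiple _ _ _ _ cone_neq0 g (z - z')); rewrite mulrzBr e opprB subKr.
  case: hdv => r er; have := congr1 (meval (fun k => if k == a then u g - hbar *~ z else 0)) er.
  rewrite mevalM !meval_lin eab eqxx [b == a]eq_sym (negbTE ne) !subrr subr0 subrr mulr0 sub0r.
  move/eqP; rewrite oppr_eq0 => /eqP hz; have := hz' eab.
  by rewrite (hbar_inj cone_neq0 char0 (c := z') (c' := 0)) ?eqxx.
rewrite -rmorphM /= eE rmorph_sum /= big_seq; apply: dv_sum => -[w p] /hL /= pw.
rewrite /Sym rmorph_sum; apply: dv_sum => s hs.
rewrite rmorphM /= (sb_ordprod w _ (enum_uniq _) hs); last first.
  by move=> s' a b /inWP[hc _]; apply: sb_zeta_kernel.
rewrite rmorphM; apply: dv_mull; apply: off_diagonal_dv_ordprod.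
apply: perm_trans (inW_map (enum_uniq _) hs); exact: perm_map.
Qed.

Lemma comp_div_factor : exists2 k : F, k != 0 & comp_div = off_diagonal * k%:MP.
Proof.
pose dg (g : arrow Q) p : F :=
  \prod_(t < (len p + len p).+1) (hbar *~ (t%:Z - (len p)%:Z) - u g) ^+ chi (len p) (len p) (t%:Z - (len p)%:Z).
exists (\prod_(g : arrow Q) \prod_(p | scl p == src g) (if scl p == tgt g then dg g p else 1)).
  apply/prodf_neq0 => g _; apply/prodf_neq0 => p _; case: ifP => _; last exact: oner_neq0.
  apply/prodf_neq0 => t _; apply: expf_neq0; rewrite subr_eq0 eq_sym.
  by apply/eqP; apply: weight_not_multiple.
rewrite rmorph_prod -big_split; apply: eq_bigr => g _ /=.
rewrite rmorph_prod -big_split; apply: eq_bigr => p _ /=.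
case: ifP => hp; last first.
  by rewrite rmorph1 mulr1; apply: eq_bigl => q; case: (eqVneq q p) => [->|]; rewrite ?andbT ?andbF //.
rewrite (bigD1 p hp) mulrC; congr (_ * _).
rewrite /arrow_factor rmorph_prod; apply: eq_bigr => t _ /=.
by rewrite subrr add0r rmorphXn.
Qed.

Theorem in_span_specialize E : in_span col (zeta_kernel hbar u col) EN E -> dv comp_div (ev string_point E).
Proof.
have [k nz ->] := comp_div_factor; case/in_span_off_diagonal => q ->; exists (q * (k^-1)%:MP).
by rewrite [off_diagonal * _]mulrC mulrA -(mulrA q) -mpolyCM mulVf // mulr1.
Qed.

End StringSpecialization.

(** * Integrality over a field *)

Section Layout.
Variables (Q : quiver) (F : fieldType) (hbar : F) (u : arrow Q -> F).
Notation I := (vert Q).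
Implicit Types d e : dimvec I.

Lemma zX_var d (k : 'I_(nvar d)) : zX F d (vcol k) (vnum k) = 'X_k.
Proof. exact: zX_enum. Qed.

Lemma big_col (R : Type) (idx : R) (op : Monoid.com_law idx) d i (G : I -> nat -> R) :
  \big[op/idx]_(k : 'I_(nvar d) | vcol k == i) G (vcol k) (vnum k) = \big[op/idx]_(a < d i) G i a.
Proof.
rewrite big_mkcond (big_var _ _ (fun j a => if j == i then G j a else idx)) (bigD1 i) //= eqxx.
by rewrite [X in op _ X]big1 ?Monoid.mulm1 // => j /negbTE ->; rewrite big1.
Qed.

Lemma count_vcol d i : count (fun k => vcol k == i) (enum 'I_(nvar d)) = d i.
Proof.
rewrite -sum1_count big_enum_cond /= (eq_bigl (fun k => vcol k == i)) //.
by rewrite (big_col _ d i (fun _ _ => 1%N)) sum1_card card_ord.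
Qed.

Lemma nth_strings (c : I -> seq nat) i a : (a < sumn (c i))%N ->
  nth 0 (strings hbar c i) a =
  zX F (nparts c) i (reshape_index (c i) a) + (hbar *+ reshape_offset (c i) a)%:MP.
Proof.
move=> lt; rewrite /strings.
have esh : shape [seq [seq zX F (nparts c) i p + (hbar *+ t)%:MP | t <- iota 0 (part c i p)]
                 | p <- iota 0 (size (c i))] = c i.
  rewrite /shape -map_comp -[RHS](mkseq_nth 0%N) /mkseq; apply: eq_map => p /=.
  by rewrite size_map size_iota.
rewrite nth_flatten esh; have lti := reshape_indexP lt; have lto := reshape_offsetP lt.
by rewrite (nth_map 0%N) ?size_iota // nth_iota // (nth_map 0%N) ?size_iota // nth_iota.
Qed.

Section Composition.
Variables (d : dimvec I) (c : I -> seq nat).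
Hypothesis compc : is_composition d c.
Notation e := (nparts c).

Definition part_size (q : 'I_(nvar e)) : nat := part c (vcol q) (vnum q).

Let lt_sum (k : 'I_(nvar d)) : (vnum k < sumn (c (vcol k)))%N.
Proof. by case: (compc (vcol k)) => _ ->; apply: vnum_lt. Qed.

Let lt_part (k : 'I_(nvar d)) : (reshape_index (c (vcol k)) (vnum k) < e (vcol k))%N.
Proof. by rewrite ffunE; apply: reshape_indexP. Qed.

Definition layout_part (k : 'I_(nvar d)) : 'I_(nvar e) := vix (Ordinal (lt_part k)).
Definition layout_pos (k : 'I_(nvar d)) : nat := reshape_offset (c (vcol k)) (vnum k).

Lemma layout_col k : vcol (layout_part k) = vcol k. Proof. exact: vcol_vix. Qed.
Lemma layout_num k : vnum (layout_part k) = reshape_index (c (vcol k)) (vnum k).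
Proof. exact: vnum_vix. Qed.

Lemma layout_lt k : (layout_pos k < part_size (layout_part k))%N.
Proof. by rewrite /part_size layout_col layout_num; apply: reshape_offsetP. Qed.

Lemma layout_inj k k' : layout_part k = layout_part k' -> layout_pos k = layout_pos k' -> k = k'.
Proof.
move=> ep eo; have ec : vcol k = vcol k' by rewrite -layout_col ep layout_col.
apply: var_inj => //; rewrite -(reshape_indexK (c (vcol k)) (vnum k)) -(reshape_indexK (c (vcol k')) (vnum k')).
by rewrite -!layout_num -/(layout_pos k) -/(layout_pos k') ep eo ec.
Qed.

Lemma layout_surj q j : (j < part_size q)%N -> exists k, layout_part k = q /\ layout_pos k = j.
Proof.
move=> lt; set i := vcol q; have lt' : (flatten_index (c i) (vnum q) j < d i)%N.
  by case: (compc i) => _ <-; apply: flatten_indexP.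
exists (vix (Ordinal lt')); split.
  by apply: var_inj; rewrite ?layout_num ?layout_col vcol_vix // vnum_vix; apply: flatten_indexKl.
by rewrite /layout_pos vcol_vix vnum_vix; apply: flatten_indexKr.
Qed.

Lemma specialize_string_point (E : zpoly F d) :
  specialize hbar c E = ev (string_point hbar layout_part layout_pos) E.
Proof.
rewrite /specialize zsubst_ev; apply: ev_eq => k; rewrite nth_strings //.
by rewrite /string_point -zX_var layout_col layout_num.
Qed.

Lemma divisorE : divisor hbar u d c =
  (\prod_i (hbar ^+ d i * (\prod_(a < size (c i)) (part c i a)`!)%:R))%:MP *
  comp_div hbar u (@vcol _ e) part_size.
Proof.
rewrite /divisor /comp_div; congr (_ * _); apply: eq_bigr => g _.
pose G i a j b := arrow_factor hbar u g (part c i a) (part c j b) (zX F e j b - zX F e i a).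
transitivity (\prod_(a < e (src g)) \prod_(b < e (tgt g)) G (src g) a (tgt g) b).
  have range n n' (f : nat -> zpoly F e) : n = n' -> \prod_(a < n) f a = \prod_(a < n') f a.
    by move=> ->.
  rewrite (range (e (src g)) (size (c (src g)))
    (fun a => \prod_(b < e (tgt g)) G (src g) a (tgt g) b)) ?ffunE //.
rewrite -(big_col _ e _ (fun i a => \prod_(b < e (tgt g)) G i a (tgt g) b)).
apply: eq_bigr => p _; rewrite -(big_col _ e _ (G (vcol p) (vnum p))).
by apply: eq_bigr => q _; rewrite /G !zX_var.
Qed.
End Composition.
End Layout.

Section OverField.
Variables (Q : quiver) (F : fieldType) (hbar : F) (u : arrow Q -> F).
Hypothesis cone_neq0 : forall c, cone hbar u c -> c != 0.
Hypothesis char0 : forall k, k.+1%:R != 0 :> F.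
Notation I := (vert Q).
Notation EN d := (enum 'I_(nvar d)).
Implicit Types d : dimvec I.

Lemma in_dim_span_sym d (E : zpoly F d) : in_dim_span hbar u E -> zsym E.
Proof.
move=> [L [_ eE]]; apply/zsym_inW => s hs.
apply: (mulfI (Delta_neq0 F (@vcol _ d) (EN d))).
have eD : sb s (Delta F (@vcol _ d) (EN d) * E) = Delta F (@vcol _ d) (EN d) * sb s E.
  by rewrite -[in RHS](sb_Delta F (enum_uniq _) hs) rmorphM.
rewrite -eD eE rmorph_sum; apply: eq_bigr => x _; exact: sb_Sym.
Qed.

Lemma in_dim_span_divisible d (c : I -> seq nat) (E : zpoly F d) : is_composition d c ->
  in_dim_span hbar u E -> exists q, specialize hbar c E = q * divisor hbar u d c.
Proof.
move=> compc /(in_span_specialize cone_neq0 char0 (layout_col compc) (layout_lt compc)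
  (@layout_inj _ _ _ compc) (layout_surj compc)) [q eq].
rewrite (specialize_string_point hbar compc) eq divisorE //; set k := \prod_i _.
have nzk : k != 0.
  apply/prodf_neq0 => i _; apply: mulf_neq0; first exact/expf_neq0/cone_neq0/cone_hbar.
  have : (0 < \prod_(a < size (c i)) (part c i a)`!)%N.
    by apply: prodn_gt0 => a; apply: fact_gt0.
  by case: (\prod_(_ < _) _)%N => // k0 _; apply: char0.
exists (q * (k^-1)%:MP); rewrite [k%:MP * _]mulrC mulrA [RHS]mulrAC -[in RHS](mulrA q).
by rewrite -mpolyCM mulVf // mulr1.
Qed.

Section StringFamily.
Variables (d : dimvec I) (S : seq (seq 'I_(nvar d))) (x : seq 'I_(nvar d) -> zpoly F d).
Hypotheses (pS : perm_eq (flatten S) (EN d)) (mS : all (monochrome (@vcol _ d)) S).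
Notation St i := [seq s <- S | scol (@vcol _ d) i s].

Definition string_parts (i : I) : seq nat := [seq size s | s <- St i].

Lemma flatten_color i : flatten (St i) = [seq k <- flatten S | vcol k == i].
Proof.
have : all (monochrome (@vcol _ d)) S by [].
elim: (S) => //= s S' IH /andP[hs /IH e]; rewrite filter_cat -e.
case: s hs => [//|a s] /= hs.
have -> : [seq k <- s | vcol k == i] = if vcol a == i then s else [::].
  elim: s hs => [|b s IHs] /=; first by case: (vcol a == i).
  by move=> /andP[/eqP -> /IHs ->]; case: (vcol a == i).
by case: (vcol a == i).
Qed.

Lemma string_parts_composition : is_composition d string_parts.
Proof.
move=> i; split.
  apply/allP => n /mapP[s]; rewrite mem_filter => /andP[_ /(allP mS)].
  by case: s => // a s _ ->.
rewrite -[LHS]size_flatten flatten_color size_filter.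
by rewrite (seq.permP pS) count_vcol.
Qed.
Notation compS := string_parts_composition.
Notation e := (nparts string_parts).

Definition part_string (q : 'I_(nvar e)) : seq 'I_(nvar d) := nth [::] (St (vcol q)) (vnum q).

Lemma part_string_lt (q : 'I_(nvar e)) : (vnum q < size (St (vcol q)))%N.
Proof. by have := vnum_lt q; rewrite ffunE size_map. Qed.

Lemma size_part_string q : size (part_string q) = part_size q.
Proof. by rewrite /part_size /part (nth_map [::]) ?part_string_lt. Qed.

Lemma ev_comp_div : ev (fun q => x (part_string q)) (comp_div hbar u (@vcol _ e) (@part_size _ _)) =
  family_div hbar u (@vcol _ d) S x.
Proof.
rewrite /comp_div /family_div rmorph_prod; apply: eq_bigr => g _ /=.
have conv i (f : seq 'I_(nvar d) -> zpoly F d) :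
    \prod_(q | vcol q == i) f (part_string q) = \prod_(s <- S | scol (@vcol _ d) i s) f s.
  rewrite (big_col _ e i (fun j a => f (nth [::] (St j) a))) -big_filter (big_nth [::]) big_mkord.
  by have -> : e i = size (St i) by rewrite ffunE size_map.
rewrite -conv rmorph_prod; apply: eq_bigr => p _ /=.
rewrite -conv rmorph_prod; apply: eq_bigr => q _ /=.
rewrite /arrow_factor !size_part_string rmorph_prod; apply: eq_bigr => t _ /=.
by rewrite rmorphXn rmorphD rmorphB /= !evX evC.
Qed.

Lemma sval_mem k : k \in flatten S ->
  exists s, [/\ s \in S, k \in s & sval hbar S x k = x s + (hbar *+ index k s)%:MP].
Proof.
elim: (S) => //= s S' IH; rewrite mem_cat; case hk: (k \in s) => /=.
  by move=> _; exists s; rewrite mem_head.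
by move=> /IH [s' [h1 h2 h3]]; exists s'; rewrite inE h1 orbT.
Qed.

Lemma string_family_layout (k : 'I_(nvar d)) : exists k0 : 'I_(nvar d),
  [/\ vcol k0 = vcol k,
      k = nth k (part_string (layout_part compS k0)) (layout_pos string_parts k0)
    & sval hbar S x k =
      ev (fun q => x (part_string q)) (string_point hbar (layout_part compS) (layout_pos string_parts) k0)].
Proof.
have [|s [hs hk ek]] := @sval_mem k; first by rewrite (perm_mem pS) mem_enum.
have hsc : scol (@vcol _ d) (vcol k) s.
  have := allP mS s hs; case: (s) hk => // a s'; rewrite inE /= => /orP[/eqP -> //|h] /allP /(_ k h).
  by rewrite eq_sym.
have hsi : s \in St (vcol k) by rewrite mem_filter hsc.
have lt : (index s (St (vcol k)) < e (vcol k))%N by rewrite ffunE size_map index_mem.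
pose q := vix (Ordinal lt).
have eq : part_string q = s by rewrite /part_string vcol_vix vnum_vix nth_index.
have [|k0 [e1 e2]] := layout_surj compS (q := q) (j := index k s).
  by rewrite -size_part_string eq index_mem.
exists k0; rewrite /string_point rmorphD /= evX evC e1 e2 eq nth_index //; split=> //.
by rewrite -(layout_col compS) e1 vcol_vix.
Qed.
End StringFamily.

(** The strings of each colour form a composition. Its specialization, followed by the
    substitution of the positions x, differs from the evaluation at the strings
    by a permutation, under which E is invariant. *)
Lemma divisible_string_divisible d (E : zpoly F d) : zsym E ->
  (forall c, is_composition d c -> exists q, specialize hbar c E = q * divisor hbar u d c) ->
  string_divisible hbar u (@vcol _ d) E.
Proof.
move=> /zsym_inW symE hE S x pS mS; set c := string_parts S.
pose compS := string_parts_composition pS mS.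
have [q] := hE c compS; rewrite (specialize_string_point hbar compS) divisorE //.
move/(congr1 (ev (fun q => x (@part_string d S q)))); rewrite ev_comp => eq.
pose R (k k0 : 'I_(nvar d)) := [/\ vcol k0 = vcol k,
    k = nth k (@part_string d S (layout_part compS k0)) (layout_pos c k0)
  & sval hbar S x k =
    ev (fun q => x (@part_string d S q)) (string_point hbar (layout_part compS) (layout_pos c) k0)].
have [g hg] : exists g : 'I_(nvar d) -> 'I_(nvar d), forall k, R k (g k).
  apply: (@fin_all_exists 'I_(nvar d) (fun=> 'I_(nvar d)) R) => k.
  exact: string_family_layout x pS mS k.
have g_inj : injective g.
  move=> k k' ek; have [_ e1 _] := hg k; have [_ e2 _] := hg k'.
  rewrite e1 e2 ek; apply: set_nth_default; rewrite size_part_string.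
  exact: layout_lt.
have hs : inW (@vcol _ d) (EN d) (perm g_inj).
  by apply/inWP; split=> [k|k]; rewrite ?mem_enum // permE; case: (hg k).
have -> : ev (sval hbar S x) E = ev (fun k => ev (fun q => x (@part_string d S q))
    (string_point hbar (layout_part compS) (layout_pos c) k)) E.
  rewrite -[in RHS](symE _ hs) ev_sb; apply: ev_eq => k /=.
  by rewrite permE; case: (hg k).
rewrite eq 2!rmorphM /= ev_comp_div.
exact/dv_mull/dv_mull/dv_refl.
Qed.

Theorem Splus_in_span_fam (X : vfamily I F) : Splus hbar u X <-> in_span_fam hbar u X.
Proof.
split=> [[[fin symX] hX]|[fin hX]].
  split=> // d; apply: string_divisible_in_span => //; first exact/zsym_inW.
  by apply: divisible_string_divisible => // c; apply: hX.
split; first by split=> // d; apply: in_dim_span_sym.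
by move=> d c compc; apply: in_dim_span_divisible.
Qed.
End OverField.

(** * Clearing denominators *)

Section FractionField.
Variable R : idomainType.
Notation tofrac := (@FracField.tofrac R).
Local Notation "x %:F" := (tofrac x).

Lemma fraction_denominator (x : {fraction R}) : exists s a : R, s != 0 /\ s%:F * x = a%:F.
Proof.
elim/quotW: x => r; exists (\d_r), (\n_r); split; first exact: denom_ratioP.
unlock FracField.tofrac; rewrite -[LHS]FracField.pi_mul; apply/eqmodP => /=.
rewrite FracField.equivfE /FracField.mulf /= !numden_Ratio ?(oner_neq0, mulr1, mul1r) //;
  rewrite ?denom_ratioP //.
Qed.

Section Extension.
Variables (Q : quiver) (hbar : R) (u : arrow Q -> R).
Notation I := (vert Q).
Notation M p := (map_mpoly tofrac p).
Implicit Types d e : dimvec I.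

Lemma map_frac_inj n : injective (map_mpoly tofrac : {mpoly R[n]} -> _).
Proof.
move=> p q e; apply/mpolyP => m; apply/eqP; rewrite -tofrac_eq; apply/eqP.
by rewrite -(mcoeff_map_mpoly tofrac m p) e mcoeff_map_mpoly.
Qed.

Lemma map_frac_zX d i a : M (zX R d i a) = zX {fraction R} d i a.
Proof. by rewrite /zX; case: insubP => [b _ _|_]; rewrite ?map_mpolyX ?rmorph0. Qed.

Lemma map_frac_zsubst d e (y : I -> nat -> zpoly R e) (p : zpoly R d) :
  M (zsubst y p) = zsubst (fun i a => M (y i a)) (M p).
Proof.
elim/mpolyind: p => [|c m p _ _ IH]; first by rewrite !rmorph0.
rewrite -mul_mpolyC !rmorphD !rmorphM /= IH zsubstC !map_mpolyC zsubstC; congr (_ * _ + _).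
rewrite map_mpolyX /zsubst !mmapX /mmap1 rmorph_prod; apply: eq_bigr => k _.
by rewrite rmorphXn.
Qed.

Lemma map_frac_zsym d (p : zpoly R d) : zsym p <-> zsym (M p).
Proof.
have eM s : M (zsubst (permz R s) p) = zsubst (permz {fraction R} s) (M p).
  rewrite map_frac_zsubst; apply: zsubst_eq => i a _; rewrite /permz.
  by case: insubP => [b _ _|_]; rewrite ?map_frac_zX ?rmorph0.
split=> h s; first by rewrite -eM h.
by apply: map_frac_inj; rewrite eM h.
Qed.

Lemma map_frac_strings (c : I -> seq nat) i : [seq M p | p <- strings hbar c i] = strings hbar%:F c i.
Proof.
rewrite /strings map_flatten -map_comp; congr flatten; apply: eq_map => a /=.
rewrite -map_comp; apply: eq_map => t /=.
by rewrite rmorphD /= map_frac_zX map_mpolyC /= tofracMn.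
Qed.

Lemma map_frac_specialize d (c : I -> seq nat) (E : zpoly R d) :
  M (specialize hbar c E) = specialize hbar%:F c (M E).
Proof.
rewrite /specialize map_frac_zsubst; apply: zsubst_eq => i a _; rewrite -map_frac_strings.
have [lt|ge] := ltnP a (size (strings hbar c i)); first by rewrite (nth_map 0).
by rewrite !nth_default ?size_map ?rmorph0.
Qed.

Lemma map_frac_divisor d (c : I -> seq nat) :
  M (divisor hbar u d c) = divisor hbar%:F (fun g => (u g)%:F) d c.
Proof.
rewrite /divisor rmorphM /= map_mpolyC /=; congr (_%:MP * _).
  by rewrite rmorph_prod; apply: eq_bigr => i _; rewrite rmorphM rmorphXn rmorph_nat.
do 4 (rewrite rmorph_prod; apply: eq_bigr => ? _) => /=.
by rewrite rmorphXn rmorphD rmorphB /= !map_frac_zX map_mpolyC /= rmorphB rmorphMz.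
Qed.

Lemma zsubstZ (A : idomainType) d e (y : I -> nat -> zpoly A e) c (p : zpoly A d) :
  zsubst y (c *: p) = c *: zsubst y p.
Proof. by rewrite -!mul_mpolyC rmorphM /= zsubstC. Qed.

Lemma Sloc_Splus X : Sloc hbar u X -> Splus hbar%:F (fun g => (u g)%:F) X.
Proof.
move=> [s [E [nzs [[[r hr] symE] hE] eX]]]; split.
  split; first by exists r => d /hr e; rewrite eX e rmorph0 scaler0.
  move=> d p; have symM := iffLR (map_frac_zsym (E d)) (symE d) p.
  by rewrite eX zsubstZ symM.
move=> d c /(hE d) [q eq]; exists ((s%:F)^-1 *: M q).
rewrite eX /specialize zsubstZ -/(specialize _ _ _) -map_frac_specialize eq.
by rewrite rmorphM /= map_frac_divisor scalerAl.
Qed.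

Lemma mpoly_denominator n (p : {mpoly {fraction R}[n]}) :
  exists (s : R) (E : {mpoly R[n]}), s != 0 /\ s%:F *: p = M E.
Proof.
elim/mpolyind: p => [|c m p _ _ [s [E [nzs e]]]].
  by exists 1, 0; rewrite oner_neq0 rmorph0 scaler0.
have [t [a [nzt ea]]] := fraction_denominator c.
exists (s * t), ((s * a) *: 'X_[m] + t *: E); split; first by rewrite mulf_neq0.
rewrite scalerDr rmorphD /= !map_mpolyZ map_mpolyX -e !scalerA /= !tofracM -ea mulrA.
by rewrite [t%:F * s%:F]mulrC.
Qed.

(** K will run through finite sets of compositions, enlarged one composition at a
    time. *)
Definition clears d (X : zpoly {fraction R} d) (K : (I -> seq nat) -> Prop) (s : R) (E : zpoly R d) :=
  s%:F *: X = M E /\ forall c, K c -> is_composition d c ->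
    exists q, specialize hbar c E = q * divisor hbar u d c.

Lemma clears_scale d X K s t (E : zpoly R d) : clears X K s E -> clears X K (t * s) (t *: E).
Proof.
move=> [e h]; split; first by rewrite map_mpolyZ -e rmorphM scalerA.
move=> c Kc /(h c Kc) [q eq]; exists (t *: q).
by rewrite /specialize zsubstZ -/(specialize _ _ _) eq scalerAl.
Qed.

Lemma clears_add d X K s (E : zpoly R d) c :
  (is_composition d c ->
     exists q, specialize hbar%:F c X = q * divisor hbar%:F (fun g => (u g)%:F) d c) ->
  s != 0 -> clears X K s E -> exists s' E', s' != 0 /\ clears X (fun c' => c' = c \/ K c') s' E'.
Proof.
move=> hX nzs hE; have [/hX [q eq]|nc] := classic (is_composition d c); last first.
  by exists s, E; split=> //; case: hE => e h; split=> // c' [-> //|]; apply: h.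
have [t [q' [nzt eq']]] := mpoly_denominator q.
have [e h] := clears_scale t hE; exists (t * s), (t *: E); split; first by rewrite mulf_neq0.
split=> // c' [->|Kc'] hc'; last exact: h.
exists (s *: q'); apply: map_frac_inj.
have mM p1 p2 : M (p1 * p2 : zpoly R (nparts c)) = M p1 * M p2 by rewrite rmorphM.
rewrite map_frac_specialize -e mM map_frac_divisor map_mpolyZ /= -eq' scalerA -tofracM mulrC.
by rewrite /specialize zsubstZ -/(specialize _ _ _) eq scalerAl [(s * t)%R]mulrC.
Qed.

Fixpoint bounded_seqs (l : seq nat) (k : nat) : seq (seq nat) :=
  if k is k'.+1 then [::] :: [seq a :: s | a <- l, s <- bounded_seqs l k'] else [:: [::]].

Lemma bounded_seqsP l k s : (size s <= k)%N -> all (mem l) s -> s \in bounded_seqs l k.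
Proof.
elim: k s => [|k IH] [|a s] //=; rewrite ltnS inE => /IH {}IH /andP[la /IH h] /=.
by apply/allpairsPdep; exists a, s.
Qed.

(** This makes one common denominator suffice for all quotients. *)
Lemma finitely_many_compositions d :
  exists cs : seq (I -> seq nat), forall c, is_composition d c -> List.In c cs.
Proof.
pose N := (\sum_i d i)%N; pose L := bounded_seqs (iota 0 N.+1) N.
pose cof (f : {ffun I -> 'I_(size L)}) (i : I) := nth [::] L (f i).
exists (map cof (enum {: {ffun I -> 'I_(size L)}})) => c hc.
have hL i : c i \in L.
  have [pos sm] := hc i; have le : (d i <= N)%N by rewrite /N (bigD1 i) //= leq_addr.
  apply: bounded_seqsP.
    apply: leq_trans le; rewrite -sm; elim: (c i) pos => //= a s IH /andP[la /IH h]; lia.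
  apply: (@sub_all _ (fun a => a <= sumn (c i))%N) => [a ha|].
    by rewrite inE mem_iota add0n ltnS (leq_trans ha) // sm.
  elim: (c i) {pos sm} => //= a s IH; rewrite leq_addr /=.
  by apply: sub_all IH => b hb; apply: leq_trans hb (leq_addl _ _).
have lt i : (index (c i) L < size L)%N by rewrite index_mem.
suff -> : c = cof [ffun i => Ordinal (lt i)].
  have : [ffun i => Ordinal (lt i)] \in enum {: {ffun I -> 'I_(size L)}} by rewrite mem_enum.
  elim: (enum _) => // f fs IH; rewrite inE => /orP[/eqP ->|/IH h]; [by left | by right].
by apply: functional_extensionality => i; rewrite /cof ffunE nth_index.
Qed.

Lemma clears_all d (X : zpoly {fraction R} d) :
  (forall c, is_composition d c ->
     exists q, specialize hbar%:F c X = q * divisor hbar%:F (fun g => (u g)%:F) d c) ->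
  exists s E, s != 0 /\ clears X (fun=> True) s E.
Proof.
move=> hX; have [cs hcs] := finitely_many_compositions d.
suff [s [E [nzs [e h]]]] : exists s E, s != 0 /\ clears X (fun c => List.In c cs) s E.
  by exists s, E; split=> //; split=> // c _ hc; apply: h => //; apply: hcs.
elim: cs {hcs} => [|c cs [s [E [nzs h]]]].
  by have [s [E [nzs e]]] := mpoly_denominator X; exists s, E; split=> //; split.
have [s' [E' [nzs' [e h']]]] := clears_add (hX c) nzs h.
exists s', E'; split=> //; split=> // c' hc'; apply: h'.
by case: hc' => [->|]; [left | right].
Qed.

Lemma Splus_Sloc X : Splus hbar%:F (fun g => (u g)%:F) X -> Sloc hbar u X.
Proof.
move=> [[[r hr] symX] hX].
have [s [nzs hs]] : exists s, s != 0 /\ forall d, d \in r -> exists E, clears (X d) (fun=> True) s E.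
  elim: (r) => [|d r' [s [nzs hs]]]; first by exists 1; rewrite oner_neq0.
  have [t [E [nzt ht]]] := clears_all (hX d).
  exists (s * t); split=> [|d']; first by rewrite mulf_neq0.
  rewrite inE => /orP[/eqP ->|/hs [E' hE']]; first by exists (s *: E); apply: clears_scale.
  by rewrite mulrC; exists (t *: E'); apply: clears_scale.
have hE d : exists E, clears (X d) (fun=> True) s E.
  have [/hs //|/hr e] := boolP (d \in r).
  exists 0; split; first by rewrite e rmorph0 scaler0.
  by move=> c _ _; exists 0; rewrite mul0r /specialize rmorph0.
pose E d := proj1_sig (constructive_indefinite_description _ (hE d)).
have EP d : clears (X d) (fun=> True) s (E d).
  exact: proj2_sig (constructive_indefinite_description _ (hE d)).
have nzF : s%:F != 0 by rewrite tofrac_eq0.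
exists s, E; split=> // [|d]; last first.
  by case: (EP d) => <- _; rewrite scalerA mulVf // scale1r.
split; last by move=> d c hc; case: (EP d) => _ h; apply: h.
split; first exists r => d nd; last move=> d.
  by apply: map_frac_inj; case: (EP d) => <- _; rewrite (hr d nd) scaler0 rmorph0.
apply/map_frac_zsym; case: (EP d) => <- _ p; by rewrite zsubstZ symX.
Qed.

(** Under the positivity assumption, a nonzero nonnegative combination of the
    weights does not vanish: hbar itself is such a combination of the weights of
    an arrow and its opposite. *)
Lemma hard_sign_cone (char0 : forall k, k.+1%:R != 0 :> R) : assumption_hard_sign hbar u ->
  forall c, cone hbar%:F (fun g => (u g)%:F) c -> c != 0.
Proof.
move=> [nzh hard] c hc.
case: (pickP (@predT (arrow Q))) => [g0 _|none]; last first.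
  suff [k ->] : exists k, c = (hbar *+ k.+1)%:F.
    by rewrite tofrac_eq0 -mulr_natl mulf_neq0.
  elim: hc => [|g|g|x y _ [k ->] _ [l ->]]; [by exists 0%N | by have := none g | by have := none g |].
  by exists (k + l.+1)%N; rewrite -rmorphD -mulrnDr addSn.
pose comb (x y : arrow Q -> nat) := \sum_(g : arrow Q) (u g *+ x g + (hbar - u g) *+ y g).
have single g (a b : nat) : comb (fun h => if h == g then a else 0%N) (fun h => if h == g then b else 0%N) =
    u g *+ a + (hbar - u g) *+ b.
  rewrite /comb (bigD1 g) //= eqxx big1 ?addr0 // => h /negbTE ->.
  by rewrite !mulr0n addr0.
suff [x [y [g [-> pos]]]] : exists x y g, c = (comb x y)%:F /\ (0 < x g + y g)%N.
  rewrite tofrac_eq0; apply/eqP => /hard /(_ g) [ex ey].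
  by rewrite ex ey in pos.
elim: hc => [|g|g|x y _ [x1 [y1 [g [-> pos]]]] _ [x2 [y2 [_ [-> _]]]]].
- exists (fun h => if h == g0 then 1%N else 0%N), (fun h => if h == g0 then 1%N else 0%N), g0.
  by rewrite single eqxx !mulr1n addrC subrK.
- exists (fun h => if h == g then 1%N else 0%N), (fun h => if h == g then 0%N else 0%N), g.
  by rewrite single eqxx mulr1n mulr0n addr0.
- exists (fun h => if h == g then 0%N else 0%N), (fun h => if h == g then 1%N else 0%N), g.
  by rewrite single eqxx mulr1n mulr0n add0r rmorphB.
exists (fun h => x1 h + x2 h)%N, (fun h => y1 h + y2 h)%N, g; split; last by lia.
rewrite -rmorphD /comb -big_split; congr (_%:F); apply: eq_bigr => h _ /=.
by rewrite !mulrnDr addrACA.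
Qed.
End Extension.
End FractionField.

Theorem theorem1p2 (Q : quiver) (r : nat)
    (chi_hbar : 'rV[int]_r) (chi_u : arrow Q -> 'rV[int]_r) :
  let hbar : Rtorus r := char_lin chi_hbar in
  let u (g : arrow Q) : Rtorus r := char_lin (chi_u g) in
  let hbarF : {fraction Rtorus r} := FracField.tofrac hbar in
  let uF (g : arrow Q) : {fraction Rtorus r} := FracField.tofrac (u g) in
  assumption_hard_sign hbar u ->
  assumption_soft_sign hbar u ->
  forall X : vfamily (vert Q) {fraction Rtorus r},
    Sloc hbar u X <->
    generated hbarF uF
      (fun Y => exists (i : vert Q) (k : nat), Y = e_ {fraction Rtorus r} i k) X.
Proof.
move=> hbar u hbarF uF hard _ X.
have char0 k : k.+1%:R != 0 :> Rtorus r.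
  by rewrite -(rmorph_nat (@mpolyC r int)) mpolyC_eq0 pnatr_eq0.
have char0F k : k.+1%:R != 0 :> {fraction Rtorus r}.
  by rewrite -(rmorph_nat (@FracField.tofrac (Rtorus r))) tofrac_eq0.
have cone_neq0 := hard_sign_cone char0 hard.
rewrite generated_in_span_fam // -Splus_in_span_fam //.
by split; [apply: Sloc_Splus | apply: Splus_Sloc].
Qed.
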